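(* Let $d \in \mathbb{N}$, $d \geq 2$. For every $\epsilon \in (0,1)$ there exist $c \in (0,1)$ and a constant $C>0$ depending only on $d$ and $\epsilon$ such that, for all $(\ell,m) \in I_d$, the following hold. (i) If $m \geq \epsilon \ell$, then $$|X_{\ell,m}^d(x)| \leq C\, (\ell^{-1} + |x^2-a_{\ell,m}^2|)^{-1/4} \quad\text{for all } x\in[-1,1],$$ $$|X_{\ell,m}^d(x)| \leq C\, |x|^{-1/2} (1-x^2)^{(c\ell-(d-2)/4)_+} \quad\text{for all } x \in [-1,1] \text{ with } |x| \geq 2 a_{\ell,m}.$$ (ii) If $m \leq \epsilon \ell$, then, with $y = \sqrt{1-x^2}$, $$|X^d_{\ell,m}(x)| \leq C\, y^{-(d-2)/2} \left( \ell^{-2} (1+m)^{4/3} + |y^2-b_{\ell,m}^2|\right)^{-1/4} \quad\text{for all } x \in[-1,1],$$ $$|X^d_{\ell,m}(x)| \leq C\, \ell^{(d-1)/2} \, 2^{-m} \quad\text{for all } x \in [-1,1] \text{ with } y \leq b_{\ell,m}/(2e).$$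
   Context: $\mathbb{N}=\{0,1,2,\dots\}$. For integers $k\ge 1$, $\mathbb{N}_k = \mathbb{N} + (k-1)/2 = \{j+(k-1)/2 : j\in\mathbb{N}\}$. For $d\ge 2$, $I_d = \{(\ell,m) : \ell \in \mathbb{N}_d,\ m \in \mathbb{N}_{d-1},\ \ell \geq m\}$ (so that $\ell-m-1/2\in\mathbb{N}$). $P^{(\alpha,\beta)}_j$ is the Jacobi polynomial of degree $j\in\mathbb{N}$ and indices $\alpha,\beta>-1$, given by Rodrigues' formula $$P^{(\alpha,\beta)}_j(x)= \frac{(-1)^j}{2^j\, j!} (1-x)^{-\alpha} (1+x)^{-\beta} \left(\frac{d}{dx}\right)^j \left((1-x)^{\alpha+j} (1+x)^{\beta+j} \right),\quad x\in(-1,1).$$ For $(\ell,m)\in I_d$ and $x\in[-1,1]$, $$X_{\ell,m}^d(x) = c_{\ell m} (1-x^2)^{m/2-(d-2)/4} P_{\ell-m-1/2}^{(m,m)}(x),\qquad c_{\ell m} = \frac{[\ell \, \Gamma ( \ell-m+1/2)\, \Gamma (\ell +m+1/2)]^{1/2}}{2^m \,\Gamma( \ell+1/2)}.$$ Further, $a_{\ell,m},b_{\ell,m}\in[0,1]$ are defined by $b_{\ell,m} = m/\ell$ and $a_{\ell,m}^2 = 1-b_{\ell,m}^2=(\ell-m)(\ell+m)/\ell^2$. Here $e$ is Euler's number and $t_+=\max\{t,0\}$. Conventions: $0^0=1$, and a negative power of $0$ on the right-hand side of an upper bound is interpreted as $+\infty$. *)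

(* Defs.v *)
From HB Require Import structures.
From mathcomp Require Import all_boot all_order all_algebra.
From mathcomp Require Import all_classical all_reals all_analysis.
From mathcomp Require Import ring lra.

Set Implicit Arguments.
Unset Strict Implicit.
Unset Printing Implicit Defensive.

Import Order.TTheory GRing.Theory Num.Theory.
Import numFieldNormedType.Exports.

Local Open Scope classical_set_scope.
Local Open Scope ring_scope.

(* Used for [s > 0] only, where the integral converges. *)
Definition Gamma (R : realType) (s : R) : R :=
  Rintegral lebesgue_measure `]0, +oo[%classic
    (fun t : R => t `^ (s - 1) * expR (- t)).

Definition rodrigues (R : realType) (alpha beta : R) (j : nat) (x : R) : R :=
  (-1) ^+ j / (2 ^+ j * (j`!)%:R) * (1 - x) `^ (- alpha) * (1 + x) `^ (- beta) *
  derive1n j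
    (fun t : R => (1 - t) `^ (alpha + j%:R) * (1 + t) `^ (beta + j%:R)) x.

(* The polynomial given on ]-1, 1[ by Rodrigues' formula: it exists by
   [jacobiE] and is unique by [jacobi_unique].  Going through a polynomial
   provides the values at the endpoints -1 and 1, where the formula itself
   is singular. *)
Definition jacobi (R : realType) (alpha beta : R) (j : nat) : {poly R} :=
  xget 0 [set p : {poly R} |
    forall x : R, -1 < x < 1 -> p.[x] = rodrigues alpha beta j x].

(* NN k is the set N_k of the real numbers j + (k - 1)/2 with j natural. *)
Definition NN (R : realType) (k : nat) : set R :=
  [set j%:R + (k%:R - 1) / 2 | j in [set: nat]].

Definition Id (R : realType) (d : nat) (l m : R) : Prop :=
  [/\ NN d l, NN d.-1 m & m <= l].

Definition c_ (R : realType) (l m : R) : R :=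
  Num.sqrt (l * Gamma (l - m + 2^-1) * Gamma (l + m + 2^-1)) /
  (2 `^ m * Gamma (l + 2^-1)).

(* On [Id d l m] the real number l - m - 1/2 is a natural number, which
   [Num.truncn] recovers.  Since 0 `^ 0 = 1 for [powR], the values at
   x = -1, 1 follow the convention 0^0 = 1. *)
Definition X_ (R : realType) (d : nat) (l m x : R) : R :=
  c_ l m * (1 - x ^+ 2) `^ (m / 2 - (d%:R - 2) / 4) *
  (jacobi m m (Num.truncn (l - m - 2^-1))).[x].

Definition b_ (R : realType) (l m : R) : R := m / l.

Definition a_ (R : realType) (l m : R) : R := Num.sqrt (1 - b_ l m ^+ 2).

(* x to the power r, for x >= 0, where negative powers of 0 are +oo
   (they are 0 for [powR]). *)
Definition bpow (R : realType) (x r : R) : \bar R :=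
  if (x == 0) && (r < 0) then +oo%E else (x `^ r)%:E.

Lemma rodrigues_poly (R : realType) (a b : R) (k : nat) :
  exists q : {poly R}, forall x : R, -1 < x < 1 ->
    derive1n k (fun t : R => (1 - t) `^ a * (1 + t) `^ b) x =
    (1 - x) `^ (a - k%:R) * (1 + x) `^ (b - k%:R) * q.[x].
Proof.
elim: k => [|k [q IH]].
  by exists 1 => x _; rewrite derive1n0 !subr0 hornerE mulr1.
exists (- (a - k%:R)%:P * (1 + 'X) * q + (b - k%:R)%:P * (1 - 'X) * q +
        (1 - 'X) * (1 + 'X) * q^`()) => x /andP[x1 x2].
rewrite derive1nS derive1E.
have xm : 0 < 1 - x by rewrite subr_gt0.
have xp : 0 < 1 + x by rewrite -ltrBlDl sub0r.
pose g (t : R) := (1 - t) `^ (a - k%:R) * (1 + t) `^ (b - k%:R) * q.[t].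
rewrite (@near_eq_derive _ _ _ _ g) ?oner_eq0//; last first.
  near=> t; apply: IH; apply/andP; split; near: t.
  - exact: lt_nbhsr.
  - exact: lt_nbhsl.
have dm : is_derive x 1 (fun t : R => 1 - t) (-1).
  by rewrite -[X in is_derive _ _ _ X]sub0r; apply: is_deriveB.
have dp : is_derive x 1 (fun t : R => 1 + t) 1.
  by rewrite -[X in is_derive _ _ _ X]add0r; apply: is_deriveD.
have Dm : is_derive x 1 (fun t : R => (1 - t) `^ (a - k%:R))
    (- ((a - k%:R) * (1 - x) `^ (a - k%:R - 1))).
  have := is_derive1_powR (a - k%:R) xm => h.
  have := @is_derive1_comp _ (@powR R ^~ (a - k%:R)) (fun t : R => 1 - t) x _ _ h dm.
  by rewrite mulrN1.
have Dp : is_derive x 1 (fun t : R => (1 + t) `^ (b - k%:R))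
    ((b - k%:R) * (1 + x) `^ (b - k%:R - 1)).
  have := is_derive1_powR (b - k%:R) xp => h.
  have := @is_derive1_comp _ (@powR R ^~ (b - k%:R)) (fun t : R => 1 + t) x _ _ h dp.
  by rewrite mulr1.
have Dq := is_derive_poly q x.
have -> : g = ((fun t : R => (1 - t) `^ (a - k%:R)) *
    (fun t : R => (1 + t) `^ (b - k%:R))) * horner q by [].
rewrite derive_val.
have powRS (u r : R) : 0 < u -> u `^ r = u `^ (r - 1) * u.
  move=> u0; rewrite -{3}(powRr1 (ltW u0)) -powRD ?subrK//.
  by rewrite (gt_eqF u0) implybT.
have em := powRS _ (a - k%:R) xm.
have ep := powRS _ (b - k%:R) xp.
have e1 c : c - k.+1%:R = c - k%:R - 1 :> R by rewrite -natr1; ring.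
rewrite fctE !e1 em ep !hornerE /GRing.scale /=.
by ring.
Unshelve. all: by end_near.
Qed.

Lemma jacobiE (R : realType) (alpha beta : R) (j : nat) (x : R) :
  -1 < x < 1 -> (jacobi alpha beta j).[x] = rodrigues alpha beta j x.
Proof.
rewrite /jacobi; case: xgetP => [p _ /= h|h] x1; first exact: h.
have [q hq] := rodrigues_poly (alpha + j%:R) (beta + j%:R) j.
case: (h (((-1) ^+ j / (2 ^+ j * (j`!)%:R)) *: q)) => y y1 /=.
have /andP[y2 y3] := y1.
rewrite hornerZ /rodrigues hq// !addrK.
have ym : (1 - y) `^ alpha != 0 by rewrite gt_eqF// powR_gt0// subr_gt0.
have yp : (1 + y) `^ beta != 0.
  by rewrite gt_eqF// powR_gt0// -ltrBlDl sub0r.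
rewrite !powRN; move: ((-1) ^+ j / _) => K.
by field; rewrite ym yp.
Qed.

Lemma jacobi_unique (R : realType) (alpha beta : R) (j : nat) (p : {poly R}) :
  (forall x : R, -1 < x < 1 -> p.[x] = rodrigues alpha beta j x) ->
  p = jacobi alpha beta j.
Proof.
move=> hp; apply/eqP; rewrite -subr_eq0; apply/eqP.
set q := p - _.
apply: (@roots_geq_poly_eq0 _ _ [seq i.+2%:R^-1 | i <- iota 0 (size q)]).
- apply/allP => _ /mapP[i _ ->].
  have hi : -1 < (i.+2%:R^-1 : R) < 1.
    apply/andP; split; last by rewrite invf_lt1 ?ltr1n.
    by rewrite (lt_trans (ltrN10 _))// invr_gt0.
  by rewrite rootE /q hornerD hornerN hp// jacobiE// subrr.
- rewrite map_inj_uniq ?iota_uniq// => i k /invr_inj /eqP.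
  by rewrite eqr_nat => /eqP[].
- by rewrite size_map size_iota.
Qed.

(* Main.v *)
Require Import Defs.
From mathcomp Require Import all_boot all_order all_algebra.
From mathcomp Require Import all_classical all_reals all_analysis measurable_realfun.
From mathcomp Require Import ring lra.

Import Order.TTheory GRing.Theory Num.Theory.
Import numFieldNormedType.Exports.
Local Open Scope classical_set_scope.
Local Open Scope ring_scope.

(** Put [p = 1 - x ^ 2], [lam = l ^ 2 - 1/4] and [mu = (d - 2) / 2].  The function
    [u = c_ l m * p ^ (m / 2) * P], with [P] the Jacobi polynomial, satisfies
    [X = u * p ^ (- mu / 2)] and solves the associated Legendre equation
    [(p u')' + (lam - m ^ 2 / p) u = 0].  Everything follows from one estimate,
    uniform in [l] and [m] ([ufun_amplitude]): [u ^ 4 * (tau + |x ^ 2 - a ^ 2|)]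
    is bounded, where [tau] is the width of the region around the turning
    point [x = a] in which the equation looks like that of Airy.

    Before the turning point, the Liouville transformation turns the equation
    into [W'' + Phi W = 0] with [W ^ 4 = s u ^ 4] and [s = 1 - be - x ^ 2].  For
    [be = (m ^ 2 + 1/2) / lam], which places the singularity of the
    transformation slightly before the true turning point, [Phi] is positive and
    increases with [|x|] for all [l] and [m].  Hence the Sonin function
    [W ^ 2 + W' ^ 2 / Phi] decreases, and [s u ^ 4] is at most its squared value
    at the equator ([sonin_bound]).  That value is a product of Gamma quotients,
    bounded by induction on the degree with [l - 1/2] fixed ([rsq0_le],
    [wallis_le], [sonin_at0_le]); no asymptotic expansion is involved.

    Across the turning point, the energy [(p u') ^ 2 + (lam p - m ^ 2) u ^ 2]
    decreases and so controls [u'] over the width [tau] ([amplitude_airy]).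
    Beyond it, the energy is still nonnegative because it vanishes at the pole,
    and [u] and [u'] have opposite signs; together this is a lower bound on the
    logarithmic derivative of [1 / u] ([decay]), which gives the estimate there
    ([amplitude_exp]) and also the two refinements used near the poles,
    [X_pow4_nincr] and [ufun_beyond].

    The bound for [y <= b / (2 e)] is of another kind: [|P|] is largest at the
    poles, where its value is explicit, and half of Stirling's formula bounds the
    result ([jacobi_le1], [c_jacobi1_le], [X_polar]).  Finitely many pairs have
    [l] below a given threshold, and for these a continuous function on
    [-1, 1] is simply bounded ([X_small_l]). *)

Set Implicit Arguments.
Unset Strict Implicit.
Unset Printing Implicit Defensive.

(** * The Gamma function on [[1, +oo[] *)

Section GammaFunction.

Lemma cvg_powR_at_right0 (R : realType) (r : R) :
  0 <= r -> (fun t : R => t `^ r) @ 0^'+ --> (0 `^ r : R).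
Proof.
rewrite le_eqVlt => /predU1P[<-|r0].
  under eq_fun do rewrite powRr0.
  rewrite powRr0; exact: cvg_cst.
rewrite powR0 ?gt_eqF//; exact: powR_cvg0.
Qed.

Lemma is_derive_expRN (R : realType) (k x : R) :
  is_derive x 1 (fun t : R => expR (- (k * t))) (- k * expR (- (k * x))).
Proof.
have h : is_derive x 1 (fun t : R => - (k * t)) (- k).
  have hid := is_derive_id x (1 : R).
  have := is_deriveN (is_deriveZ k hid).
  by rewrite /GRing.scale /= mulr1.
have := @is_derive1_comp _ expR (fun t : R => - (k * t)) x _ _ (is_derive_expR _) h.
by rewrite mulrC.
Qed.

Lemma is_derive_powR_expRN (R : realType) (r x : R) : 0 < x ->
  is_derive x 1 (fun t : R => t `^ r * expR (- t))
    ((r * x `^ (r - 1) - x `^ r) * expR (- x)).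
Proof.
move=> x0.
have h1 := is_derive1_powR r x0.
have h2 := is_derive_expRN (1 : R) x.
rewrite (_ : (fun t : R => expR (- (1 * t))) = (fun t => expR (- t))) in h2; last first.
  by apply/funext => t; rewrite mul1r.
have h3 := is_deriveM h1 h2.
apply: (is_derive_eq h3).
by rewrite /GRing.scale /= mul1r; ring.
Qed.

(** Comparing [t ^ r] with one term of the exponential series. *)
Lemma powR_expRN_bound (R : realType) (r : R) : 0 <= r ->
  exists2 C : R, 0 < C &
    forall t, 0 <= t -> t `^ r * expR (- t) <= C * expR (- (2^-1 * t)).
Proof.
move=> r0; set n := Num.truncn r.
have hn : r <= n.+1%:R by rewrite ltW// /n truncnS_gt.
exists (1 + 2 ^+ n.+1 * (n.+1)`!%:R) => [|t t0].
  by rewrite ltr_wpDr// mulr_ge0// exprn_ge0.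
have hh : expR (- t) = expR (- (2^-1 * t)) * expR (- (2^-1 * t)).
  by rewrite -expRD; congr expR; lra.
rewrite hh mulrA ler_wpM2r ?expR_ge0//.
have e1 : expR (2^-1 * t) >= 1 + (2^-1 * t) ^+ n.+1 / n.+1`!%:R.
  by apply: expR_ge1Dxn; rewrite mulr_ge0.
have e0 : 1 <= expR (2^-1 * t).
  by apply: le_trans e1; rewrite lerDl divr_ge0// exprn_ge0// mulr_ge0.
rewrite expRN ler_pdivrMr ?expR_gt0//.
have [t1|t1] := leP t 1.
  apply: (@le_trans _ _ 1).
    have -> : 1 = 1 `^ r :> R by rewrite powR1.
    by apply: ge0_ler_powR; rewrite ?nnegrE.
  rewrite -[leLHS]mul1r ler_pM//.
  by rewrite lerDl mulr_ge0// exprn_ge0.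
apply: (@le_trans _ _ (t ^+ n.+1)).
  by rewrite -powR_mulrn//; apply: ler_powR => //; exact: ltW.
have f0 : 0 < (n.+1)`!%:R :> R by rewrite ltr0n fact_gt0.
apply: (@le_trans _ _ (2 ^+ n.+1 * (n.+1)`!%:R * expR (2^-1 * t))); last first.
  by rewrite ler_wpM2r ?expR_ge0// lerDr.
have -> : t ^+ n.+1 = 2 ^+ n.+1 * (n.+1)`!%:R * ((2^-1 * t) ^+ n.+1 / n.+1`!%:R).
  rewrite exprMn exprVn; field.
  by rewrite -natr1 expf_neq0// gt_eqF// natr1.
rewrite ler_wpM2l//.
by apply: le_trans e1; rewrite lerDr.
Qed.

Lemma cvg_expRN_half (R : realType) (C : R) :
  (fun t : R => C * expR (- (2^-1 * t))) @ +oo --> (0 : R).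
Proof.
rewrite -[X in _ --> X](mulr0 C).
apply: cvgM; first exact: cvg_cst.
apply: (@cvg_comp _ _ _ (fun t : R => 2^-1 * t) (fun x => expR (- x)) _ +oo%R); last exact: cvgr_expR.
exact: gt0_cvgMry.
Qed.

Local Notation mu := lebesgue_measure.

Lemma is_derive1_cvg (R : realType) (f : R -> R) (x df : R) :
  is_derive x 1 f df -> f @ x --> f x.
Proof.
move=> h; have /derivable1_diffP/differentiable_continuous := @ex_derive _ _ _ _ _ _ _ h.
exact.
Qed.

Lemma continuous_expRN (R : realType) (k : R) :
  continuous (fun t : R => expR (- (k * t))).
Proof.
move=> x; exact: is_derive1_cvg (is_derive_expRN k x).
Qed.

Lemma cvg_expRN0 (R : realType) : (fun t : R => expR (- t)) @ (0 : R) --> expR (- 0 : R).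
Proof.
have := @continuous_expRN R 1 0; rewrite /continuous_at mul1r.
by under eq_fun do rewrite mul1r.
Qed.

Lemma integral_expRN (R : realType) (k a : R) : 0 < k ->
  (\int[mu]_(t in `[a, +oo[) (expR (- (k * t)))%:E = (k^-1 * expR (- (k * a)))%:E)%E.
Proof.
move=> k0.
have hd (x : R) : is_derive x 1 (fun t : R => - k^-1 * expR (- (k * t))) (expR (- (k * x))).
  have h := is_deriveZ (- k^-1) (is_derive_expRN k x).
  by apply: (is_derive_eq h); rewrite /GRing.scale /= mulrA mulrNN mulVf ?mul1r// gt_eqF.
have hc : {within `[a, +oo[, continuous (fun t : R => expR (- (k * t)))}.
  by apply: continuous_subspaceT; exact: continuous_expRN.
have hl : (fun t : R => - k^-1 * expR (- (k * t))) @ +oo --> (0 : R).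
  rewrite -[X in _ --> X](mulr0 (- k^-1)); apply: cvgM; first exact: cvg_cst.
  apply: (@cvg_comp _ _ _ (fun t : R => k * t) (fun x => expR (- x)) _ +oo%R); last exact: cvgr_expR.
  exact: gt0_cvgMry.
rewrite (@ge0_continuous_FTC2y R _ (fun t : R => - k^-1 * expR (- (k * t))) a 0 _ hc hl).
- by rewrite -EFinB sub0r mulNr opprK.
- by move=> x _; exact: expR_ge0.
- by move=> x _; exact: (@ex_derive _ _ _ _ _ _ _ (hd x)).
- apply: cvg_at_right_filter; exact: is_derive1_cvg (hd a).
- by move=> x _; rewrite derive1E; exact: derive_val.
Qed.

Lemma integrable_expRN (R : realType) (k a : R) : 0 < k ->
  mu.-integrable `[a, +oo[ (EFin \o (fun t : R => expR (- (k * t)))).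
Proof.
move=> k0; apply/integrableP; split.
  apply/measurable_EFinP; apply: measurable_funTS.
  by apply: continuous_measurable_fun; exact: continuous_expRN.
under eq_integral do rewrite /= ger0_norm ?expR_ge0//.
by rewrite integral_expRN// ltry.
Qed.

Lemma within_continuous_powR_expRN (R : realType) (r : R) : 0 <= r ->
  {within `[0, +oo[, continuous (fun t : R => t `^ r * expR (- t))}.
Proof.
move=> r0; apply/continuous_within_itvcyP; split.
  move=> x; rewrite in_itv/= andbT => x0.
  exact: is_derive1_cvg (is_derive_powR_expRN r x0).
apply: cvgM; first exact: cvg_powR_at_right0.
apply: cvg_at_right_filter.
exact: cvg_expRN0.
Qed.

Lemma integrable_powR_expRN (R : realType) (r : R) : 0 <= r ->
  mu.-integrable `[0, +oo[ (EFin \o (fun t : R => t `^ r * expR (- t))).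
Proof.
move=> r0; have [C C0 hC] := powR_expRN_bound r0.
have h2 : 0 < 2^-1 :> R by [].
have ig : mu.-integrable `[0, +oo[ (fun t : R => C%:E * (expR (- (2^-1 * t)))%:E)%E.
  by apply: integrableZl => //; exact: integrable_expRN.
apply: le_integrable ig => //.
  apply/measurable_EFinP; apply: subspace_continuous_measurable_fun => //.
  exact: within_continuous_powR_expRN.
move=> x; rewrite /= in_itv/= andbT => x0.
rewrite lee_fin !ger0_norm; first exact: hC.
  by rewrite mulr_ge0 ?expR_ge0// ltW.
by rewrite mulr_ge0 ?powR_ge0 ?expR_ge0.
Qed.

Lemma integrable_EFin_Zl (R : realType) (a k : R) (f : R -> R) :
  mu.-integrable `[a, +oo[ (EFin \o f) ->
  mu.-integrable `[a, +oo[ (EFin \o (fun t => k * f t)).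
Proof.
move=> h; have : mu.-integrable `[a, +oo[ (fun t => k%:E * (EFin \o f) t)%E.
  by apply: integrableZl.
exact.
Qed.

Lemma integrable_EFin_B (R : realType) (a : R) (f g : R -> R) :
  mu.-integrable `[a, +oo[ (EFin \o f) -> mu.-integrable `[a, +oo[ (EFin \o g) ->
  mu.-integrable `[a, +oo[ (EFin \o (fun t => f t - g t)).
Proof.
move=> hf hg.
have : mu.-integrable `[a, +oo[ ((EFin \o f) \- (EFin \o g))%E by apply: integrableB.
exact.
Qed.

Lemma GammaE (R : realType) (s : R) : 1 <= s ->
  Gamma s = \int[mu]_(t in `[0, +oo[) (t `^ (s - 1) * expR (- t)).
Proof.
move=> s1; rewrite /Gamma Rintegral_itv_obnd_cbnd//.
apply: integrableS (integrable_powR_expRN _); rewrite ?subr_ge0//.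
by move=> x; rewrite /= !in_itv/= !andbT => /ltW.
Qed.

(** The primitive [- t ^ s * exp (- t)] of the difference of both integrands
    vanishes at both ends.  Adding [C * exp (- t / 2)] makes the difference
    nonnegative, so that the fundamental theorem on the half line applies. *)
Lemma GammaS (R : realType) (s : R) : 1 <= s -> Gamma (s + 1) = s * Gamma s.
Proof.
move=> s1; have s0 : 0 <= s by apply: le_trans s1.
rewrite !GammaE//; last by rewrite (le_trans s1)// lerDl.
have sm : 0 <= s - 1 by rewrite subr_ge0.
rewrite addrK.
have [C C0 hC] := powR_expRN_bound sm.
have [C' C'0 hC'] := powR_expRN_bound s0.
have h2 : 0 < 2^-1 :> R by [].
have iA := integrable_powR_expRN s0.
have iB := integrable_powR_expRN sm.
have iE := integrable_expRN 0 h2.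
pose K := s * C.
have K0 : 0 <= K by rewrite mulr_ge0// ltW.
have iE' : mu.-integrable `[0, +oo[ (EFin \o (fun t : R => K * expR (- (2^-1 * t)))).
  exact: integrable_EFin_Zl.
have iB' : mu.-integrable `[0, +oo[ (EFin \o (fun t : R => s * (t `^ (s - 1) * expR (- t)))).
  exact: integrable_EFin_Zl.
have main : \int[mu]_(t in `[0, +oo[)
    ((t `^ s * expR (- t) - s * (t `^ (s - 1) * expR (- t))) + K * expR (- (2^-1 * t)))
    = 2 * K.
  pose F (t : R) := - (t `^ s * expR (- t)) + (- (2 * K)) * expR (- (2^-1 * t)).
  have hF (x : R) : 0 < x -> is_derive x 1 F
      (x `^ s * expR (- x) - s * (x `^ (s - 1) * expR (- x)) + K * expR (- (2^-1 * x))).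
    move=> x0.
    have := is_deriveD (is_deriveN (is_derive_powR_expRN s x0))
       (is_deriveZ (- (2 * K)) (is_derive_expRN 2^-1 x)).
    move=> h; apply: (is_derive_eq h); rewrite /GRing.scale /=.
    by field.
  rewrite (@Rintegral_ge0_continuous_FTC2y R _ F 0 0).
  - by rewrite /F powR0 ?gt_eqF ?(lt_le_trans ltr01)// !mul0r !mulr0 !oppr0 expR0 add0r; ring.
  - move=> x x0.
    have := hC _ x0 => h.
    have : s * (x `^ (s - 1) * expR (- x)) <= K * expR (- (2^-1 * x)).
      by rewrite /K -mulrA ler_wpM2l.
    have : 0 <= x `^ s * expR (- x) by rewrite mulr_ge0 ?powR_ge0 ?expR_ge0.
    by lra.
  - apply: within_continuousD.
      apply: within_continuousB; first exact: within_continuous_powR_expRN.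
      move=> x; apply: cvgM; first exact: cvg_cst.
      exact: within_continuous_powR_expRN.
    apply: continuous_subspaceT => x; apply: cvgM; first exact: cvg_cst.
    exact: continuous_expRN.
  - rewrite /F -[X in _ --> X]addr0; apply: cvgD; last exact: cvg_expRN_half.
    rewrite -oppr0; apply: cvgN.
    apply: (@squeeze_cvgr _ _ _ _ (cst 0) (fun t : R => C' * expR (- (2^-1 * t)))).
    + near=> t; rewrite mulr_ge0 ?powR_ge0 ?expR_ge0//=; apply: hC'.
      by near: t; apply: nbhs_pinfty_ge; exact: num_real.
    + exact: cvg_cst.
    + exact: cvg_expRN_half.
  - by move=> x x0; exact: (@ex_derive _ _ _ _ _ _ _ (hF x x0)).
  - rewrite /F; apply: cvgD.
      apply: cvgN; apply: cvgM; first exact: cvg_powR_at_right0.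
      apply: cvg_at_right_filter.
      exact: cvg_expRN0.
    apply: cvg_at_right_filter; apply: cvgM; first exact: cvg_cst.
    exact: continuous_expRN.
  - move=> x; rewrite in_itv/= andbT => x0; rewrite derive1E.
    by have := hF x x0 => h; exact: derive_val.
have iAB : mu.-integrable `[0, +oo[ (EFin \o (fun t : R =>
    t `^ s * expR (- t) - s * (t `^ (s - 1) * expR (- t)))).
  exact: integrable_EFin_B.
rewrite RintegralD// in main.
rewrite RintegralB// in main.
rewrite RintegralZl// in main.
rewrite RintegralZl// in main.
rewrite [X in K * X](_ : _ = 2) in main; last first.
  by rewrite /Rintegral integral_expRN//= mulr0 oppr0 expR0 mulr1 invrK.
by lra.
Unshelve. all: by end_near. Qed.

Lemma Gamma1 (R : realType) : Gamma 1 = 1 :> R.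
Proof.
rewrite GammaE// subrr.
have -> : (fun t : R => t `^ 0 * expR (- t)) = (fun t => expR (- (1 * t))).
  by apply/funext => t; rewrite powRr0 !mul1r.
rewrite /Rintegral integral_expRN//=.
by rewrite mulr0 oppr0 expR0 mulr1 invr1.
Qed.

(** On [[1, +oo[] the integrand is at least [exp (- t)]. *)
Lemma Gamma_gt0 (R : realType) (s : R) : 1 <= s -> 0 < Gamma s.
Proof.
move=> s1; have sm : 0 <= s - 1 by rewrite subr_ge0.
rewrite GammaE//.
have i1 := integrable_powR_expRN sm.
have sub : `[(1:R), +oo[%classic `<=` `[0, +oo[%classic.
  by move=> x; rewrite /= !in_itv/= !andbT; apply: le_trans.
apply: (@lt_le_trans _ _ (\int[mu]_(t in `[1, +oo[) expR (- (1 * t)))).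
  by rewrite /Rintegral integral_expRN//= mulr_gt0 ?expR_gt0.
rewrite /Rintegral fine_le//.
- by apply: integrable_fin_num => //; exact: integrable_expRN.
- by apply: integrable_fin_num.
apply: (@le_trans _ _ (\int[mu]_(t in `[1%R, +oo[) (t `^ (s - 1) * expR (- t))%:E)%E).
  apply: ge0_le_integral => //=.
  - apply/measurable_EFinP; apply: measurable_funTS.
    by apply: continuous_measurable_fun; exact: continuous_expRN.
  - apply: (measurable_funS _ sub) => //.
    by case/integrableP: i1.
  - move=> x; rewrite in_itv/= andbT => x1; rewrite lee_fin mul1r.
    rewrite ler_peMl ?expR_ge0//.
    have x0 : 0 <= (x : R) by apply: le_trans x1.
    by have := ge0_ler_powR sm (ler01 : 1 \in Num.nneg) (x0 : (x : R) \in Num.nneg) x1; rewrite powR1.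
apply: ge0_subset_integral => //.
  by case/integrableP: i1.
by move=> x _; rewrite lee_fin mulr_ge0 ?powR_ge0 ?expR_ge0.
Qed.

End GammaFunction.

(* Conversion tests should not look into the integral. *)
#[local] Opaque Gamma.

(** * Jacobi polynomials with equal indices *)

(** The polynomial factors in the successive derivatives of [(1 - x ^ 2) ^ a],
    namely [D^k (1 - x ^ 2) ^ a = (1 - x ^ 2) ^ (a - k) * rpoly a k].  Keeping
    [a] fixed while [k] varies makes them an Appell-like sequence: see
    [deriv_rpoly]. *)
Fixpoint rpoly (R : realType) (a : R) (k : nat) : {poly R} :=
  if k is k'.+1 then
    (2 * (k'%:R - a))%:P * 'X * rpoly a k' + (1 - 'X ^+ 2) * (rpoly a k')^`()
  else 1.

Definition rcoef (R : realType) (a : R) (k : nat) : R := k%:R * (2 * a + 1 - k%:R).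

(** Differentiating [(1 - x ^ 2) f' = - 2 a x f] for [f = (1 - x ^ 2) ^ a] relates
    three consecutive derivatives of [f]; this is the resulting relation
    between polynomials. *)
Lemma deriv_rpoly (R : realType) (a : R) (k : nat) :
  (rpoly a k.+1)^`() = (- rcoef a k.+1)%:P * rpoly a k.
Proof.
elim: k => [|k IH].
  rewrite /= derivD !derivM !derivC derivX !mulr0 !mul0r !addr0 add0r !mulr1 /rcoef.
  by congr polyC; ring.
have e : (1 - 'X ^+ 2) * (rpoly a k)^`() =
    rpoly a k.+1 - (2 * (k%:R - a))%:P * 'X * rpoly a k by rewrite /=; ring.
have -> : rpoly a k.+2 = (2 * (k.+1%:R - a))%:P * 'X * rpoly a k.+1
    + (1 - 'X ^+ 2) * (rpoly a k.+1)^`() by [].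
rewrite IH derivD !derivM !derivC IH derivB derivXn derivX !mul0r -polyC1 derivC.
apply/eqP; rewrite -subr_eq0; apply/eqP.
transitivity ((- rcoef a k.+1)%:P * ((1 - 'X ^+ 2) * (rpoly a k)^`()
    - (rpoly a k.+1 - (2 * (k%:R - a))%:P * 'X * rpoly a k))); last first.
  by rewrite e subrr mulr0.
move: (rpoly a k.+1) (rpoly a k) => p q.
rewrite /rcoef expr1 -!natr1; ring.
Qed.

Lemma horner_rpolySS (R : realType) (a x : R) (k : nat) :
  (rpoly a k.+2).[x] = 2 * (k.+1%:R - a) * x * (rpoly a k.+1).[x]
    - rcoef a k.+1 * (1 - x ^+ 2) * (rpoly a k).[x].
Proof.
have -> : rpoly a k.+2 = (2 * (k.+1%:R - a))%:P * 'X * rpoly a k.+1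
    + (1 - 'X ^+ 2) * (rpoly a k.+1)^`() by [].
rewrite deriv_rpoly; move: (rpoly a k.+1) (rpoly a k) => p q; rewrite !hornerE /=; ring.
Qed.

Lemma horner_rpolyN (R : realType) (a x : R) (k : nat) :
  (rpoly a k).[- x] = (-1) ^+ k * (rpoly a k).[x].
Proof.
suff : (rpoly a k).[- x] = (-1) ^+ k * (rpoly a k).[x] /\
    (rpoly a k.+1).[- x] = (-1) ^+ k.+1 * (rpoly a k.+1).[x] by case.
elim: k => [|k [IH1 IH2]]; first by split; rewrite /= ?derivC !hornerE /=; ring.
split => //; rewrite !horner_rpolySS IH1 IH2 !exprS; ring.
Qed.

(** The term with [1 - x ^ 2] drops out of the recursion at the pole. *)
Lemma horner_rpoly1 (R : realType) (a : R) (k : nat) :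
  (rpoly a k).[1] = \prod_(i < k) (2 * (i%:R - a)).
Proof.
elim: k => [|k IH]; first by rewrite big_ord0 hornerE.
by rewrite big_ord_recr /= -IH !hornerE /=; ring.
Qed.

Lemma rpoly_ode (R : realType) (m x : R) (n : nat) :
  let q := rpoly (m + n%:R) n in
  (1 - x ^+ 2) * q^`()^`().[x] - 2 * (m + 1) * x * q^`().[x]
    + n%:R * (n%:R + 2 * m + 1) * q.[x] = 0.
Proof.
case: n => [|n] /=; first by rewrite -polyC1 !derivC !hornerE /=; ring.
set a := m + _.
rewrite -/(rpoly a n.+1) deriv_rpoly derivM derivC mul0r add0r.
have e : (1 - x ^+ 2) * (rpoly a n)^`().[x] =
    (rpoly a n.+1).[x] - 2 * (n%:R - a) * x * (rpoly a n).[x].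
  by rewrite [rpoly a n.+1]/= !hornerE /=; ring.
rewrite !hornerM !hornerC mulrCA e /rcoef /a -natr1; ring.
Qed.

Lemma derive1n_1Xa (R : realType) (a : R) (k : nat) (x : R) : -1 < x < 1 ->
  derive1n k (fun t : R => (1 - t) `^ a * (1 + t) `^ a) x =
  (1 - x ^+ 2) `^ (a - k%:R) * (rpoly a k).[x].
Proof.
elim: k x => [|k IH] x /andP[x1 x2].
  rewrite derive1n0 subr0 hornerE mulr1 -powRM; [|lra|lra].
  by congr powR; ring.
have xp : 0 < 1 - x ^+ 2 by nra.
rewrite derive1nS derive1E.
pose g (t : R) := (1 - t ^+ 2) `^ (a - k%:R) * (rpoly a k).[t].
rewrite (@near_eq_derive _ _ _ _ g) ?oner_eq0//; last first.
  near=> t; apply: IH; apply/andP; split; near: t.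
  - exact: lt_nbhsr.
  - exact: lt_nbhsl.
have dp : is_derive x 1 (fun t : R => 1 - t ^+ 2) (- (2 * x)).
  have := is_derive_poly (1 - 'X ^+ 2) x.
  rewrite -polyC1 derivB derivC derivXn !hornerE /= => h.
  rewrite (_ : (fun t : R => 1 - t ^+ 2) = horner (1 - 'X ^+ 2)).
    by apply: (is_derive_eq h); ring.
  by apply/funext => t; rewrite !hornerE.
have Dm := @is_derive1_comp _ (@powR R ^~ (a - k%:R)) _ x _ _ (is_derive1_powR (a - k%:R) xp) dp.
have := is_deriveM Dm (is_derive_poly (rpoly a k) x) => h.
have -> : g =
  ((fun t : R => t `^ (a - k%:R)) \o (fun t : R => 1 - t ^+ 2)) * horner (rpoly a k) by [].
rewrite derive_val.
have em : (1 - x ^+ 2) `^ (a - k%:R) = (1 - x ^+ 2) `^ (a - k.+1%:R) * (1 - x ^+ 2).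
  rewrite -{3}(powRr1 (ltW xp)) -powRD; first by congr powR; rewrite -natr1; ring.
  by rewrite (gt_eqF xp) implybT.
have -> : a - k%:R - 1 = a - k.+1%:R by rewrite -natr1; ring.
by rewrite /= em !hornerE /GRing.scale /=; ring.
Unshelve. all: by end_near.
Qed.

Lemma jacobi_rpoly (R : realType) (m : R) (n : nat) :
  jacobi m m n = ((-1) ^+ n / (2 ^+ n * (n`!)%:R))%:P * rpoly (m + n%:R) n.
Proof.
apply/esym; apply: jacobi_unique => x x1; have /andP[x2 x3] := x1.
have xp : 0 < 1 - x ^+ 2 by nra.
rewrite /rodrigues derive1n_1Xa// addrK hornerM hornerC -!mulrA; congr (_ * (_ * _)).
have -> : (1 - x ^+ 2) `^ m = (1 - x) `^ m * (1 + x) `^ m.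
  rewrite -powRM; [|lra|lra]; by congr powR; ring.
rewrite !powRN; field.
by rewrite !gt_eqF// powR_gt0; lra.
Qed.

(** * Sonin function of the associated Legendre equation *)

(** On lambda terms, so that these rules compose into the derivative of a whole
    expression by unification. *)
Section DerivativeRules.
Variables (R : realType) (x : R).
Implicit Types (f g : R -> R) (df dg : R).

Lemma der_congr f df df' : is_derive x 1 f df -> df = df' -> is_derive x 1 f df'.
Proof. by move=> h <-. Qed.

Lemma der_cst (c : R) : is_derive x 1 (fun _ : R => c) 0.
Proof. exact: is_derive_cst. Qed.

Lemma der_var : is_derive x 1 (fun t : R => t) 1.
Proof. exact: is_derive_id. Qed.

Lemma der_add f g df dg : is_derive x 1 f df -> is_derive x 1 g dg ->
  is_derive x 1 (fun t => f t + g t) (df + dg).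
Proof. by move=> hf hg; exact: is_deriveD. Qed.

Lemma der_opp f df : is_derive x 1 f df -> is_derive x 1 (fun t => - f t) (- df).
Proof. by move=> hf; exact: is_deriveN. Qed.

Lemma der_sub f g df dg : is_derive x 1 f df -> is_derive x 1 g dg ->
  is_derive x 1 (fun t => f t - g t) (df - dg).
Proof. by move=> hf hg; exact: is_deriveB. Qed.

Lemma der_mul f g df dg : is_derive x 1 f df -> is_derive x 1 g dg ->
  is_derive x 1 (fun t => f t * g t) (df * g x + f x * dg).
Proof.
move=> hf hg; have h := is_deriveM hf hg.
by apply: (is_derive_eq h); rewrite /GRing.scale /=; ring.
Qed.

Lemma der_sqr f df : is_derive x 1 f df ->
  is_derive x 1 (fun t => f t ^+ 2) (2 * f x * df).
Proof.
move=> hf; apply: (der_congr (der_mul hf hf)); ring.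
Qed.

Lemma der_inv f df : is_derive x 1 f df -> f x != 0 ->
  is_derive x 1 (fun t => (f t)^-1) (- df / f x ^+ 2).
Proof.
move=> hf f0; have h := @is_deriveV _ f x df 1 f0 hf.
by apply: (is_derive_eq h); rewrite /GRing.scale /=; field.
Qed.

Lemma der_powR f df (r : R) : is_derive x 1 f df -> 0 < f x ->
  is_derive x 1 (fun t => f t `^ r) (r * f x `^ (r - 1) * df).
Proof.
move=> hf f0.
exact: (@is_derive1_comp _ (@powR R ^~ r) f x _ _ (is_derive1_powR r f0) hf).
Qed.

End DerivativeRules.

Lemma derive_le0_nincr (R : realType) (f df : R -> R) (a b : R) : a <= b ->
  (forall x, a <= x <= b -> is_derive x 1 f (df x)) ->
  (forall x, a <= x <= b -> df x <= 0) -> f b <= f a.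
Proof.
move=> ab hf hd.
have hc : {within `[a, b], continuous f}.
  apply: derivable_within_continuous => x; rewrite in_itv/= => xab.
  exact: (@ex_derive _ _ _ _ _ _ _ (hf x xab)).
have [x|c cab e] := @MVT_segment R f df a b ab _ hc.
  by rewrite in_itv/= => /andP[x1 x2]; apply: hf; rewrite !ltW.
rewrite -subr_le0 e; move: cab; rewrite in_itv/= => cab.
by rewrite mulr_le0_ge0 ?hd// subr_ge0.
Qed.

(** The pair [(u, U)] with [U = (1 - x ^ 2) u'] solves the associated Legendre
    equation of degree [l - 1/2] and order [m] on the open interval. *)
Definition legendre_sol (R : realType) (l m : R) (u U : R -> R) :=
  forall x : R, -1 < x < 1 ->
    is_derive x 1 u (U x / (1 - x ^+ 2)) /\
    is_derive x 1 U (- (l ^+ 2 - 4^-1 - m ^+ 2 / (1 - x ^+ 2)) * u x).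

(** Positive before [x ^ 2 = 1 - be], slightly short of the turning point
    [x ^ 2 = 1 - m ^ 2 / lam] for [be = (m ^ 2 + 1/2) / lam]. *)
Definition turn_gap (R : realType) (be x : R) : R := 1 - be - x ^+ 2.

(** With the phase density [sqrt s / (1 - x ^ 2)] and [W = s ^ (1/4) * u], where
    [s = turn_gap be x], the equation becomes [W'' + Phi W = 0] with
    [Phi = sonin_coef l be s / s]. *)
Definition sonin_coef (R : realType) (l be s : R) : R :=
  l ^+ 2 * s + 3 / 4 * (1 - be) + (6 * be - 9 * be ^+ 2) / (4 * s)
  + 5 * be ^+ 2 * (1 - be) / (4 * s ^+ 2).

(** [s ^ (- 1/4) * sonin_flux] is the derivative of [W] in the phase variable. *)
Definition sonin_flux (R : realType) (be : R) (u U : R -> R) (x : R) : R :=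
  U x - x * (1 - x ^+ 2) / (2 * turn_gap be x) * u x.

(** [sqrt s * sonin] is the Sonin function [W ^ 2 + W' ^ 2 / Phi] of the transformed
    equation; without the root it is a rational expression in [x], [u], [U]. *)
Definition sonin (R : realType) (l be : R) (u U : R -> R) (x : R) : R :=
  u x ^+ 2 + sonin_flux be u U x ^+ 2 / sonin_coef l be (turn_gap be x).

Section Sonin.
Variables (R : realType) (l m be : R) (u U : R -> R).
Hypothesis hsol : legendre_sol l m u U.
Hypothesis hbe : 0 < be < 1.
Hypothesis hm : be * (l ^+ 2 - 4^-1) = m ^+ 2 + 2^-1.

Lemma sonin_coef_ge (s : R) : 0 < s <= 1 - be -> l ^+ 2 * s + 3 / 4 * (1 - be) <= sonin_coef l be s.
Proof.
move: hbe => /andP[b0 b1] /andP[s0 sD]; rewrite /sonin_coef -addrA lerDl.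
have -> : (6 * be - 9 * be ^+ 2) / (4 * s) + 5 * be ^+ 2 * (1 - be) / (4 * s ^+ 2)
  = (6 * be * (1 - be) * s + be ^+ 2 * (2 * (1 - be) + 3 * (1 - be - s))) / (4 * s ^+ 2).
  by field; rewrite gt_eqF.
apply: divr_ge0; last by nra.
apply: addr_ge0; apply: mulr_ge0; nra.
Qed.

Lemma sonin_coef_gt0 (s : R) : 0 < s <= 1 - be -> 0 < sonin_coef l be s.
Proof.
move=> hs; apply: lt_le_trans (sonin_coef_ge hs); move: hbe hs => /andP[b0 b1] /andP[s0 sD].
apply: ltr_wpDl; last by nra.
by rewrite mulr_ge0 ?sqr_ge0// ltW.
Qed.

Lemma sonin_flux_derive (x : R) : -1 < x < 1 -> 0 < turn_gap be x ->
  is_derive x 1 (sonin_flux be u U)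
    (- (sonin_coef l be (turn_gap be x) / (1 - x ^+ 2)) * u x
     - x / (2 * turn_gap be x) * sonin_flux be u U x).
Proof.
move=> x1 s0; have [hu hU] := hsol x1.
have p0 : 0 < 1 - x ^+ 2 by move: x1 => /andP[? ?]; nra.
have dx := der_var x; have d1 := der_cst x (1 : R); have d2 := der_cst x (2 : R).
have db := der_cst x (1 - be).
have dp := der_sub d1 (der_sqr dx).
have ds : is_derive x 1 (turn_gap be) (- (2 * x)).
  by apply: (der_congr (der_sub db (der_sqr dx))); ring.
have s20 : 2 * turn_gap be x != 0 by rewrite gt_eqF// mulr_gt0.
have dW := der_mul (der_mul dx dp) (der_inv (der_mul d2 ds) s20).
apply: (der_congr (der_sub hU (der_mul dW hu))).
(* Everything is now rational in [x], [u x], [U x], [l] and [s]. *)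
have -> : m ^+ 2 = be * (l ^+ 2 - 4^-1) - 2^-1 by rewrite hm addrK.
rewrite /sonin_flux /sonin_coef.
have es : be = 1 - x ^+ 2 - turn_gap be x by rewrite /turn_gap; ring.
move: (turn_gap be x) es s0 s20 => s -> s0 s20.
by field; rewrite !gt_eqF.
Qed.

Lemma sonin_coef_derive (x : R) : 0 < turn_gap be x ->
  is_derive x 1 (fun t => sonin_coef l be (turn_gap be t))
    (- (2 * x) * (l ^+ 2 - (6 * be - 9 * be ^+ 2) / (4 * turn_gap be x ^+ 2)
       - 5 * be ^+ 2 * (1 - be) / (2 * turn_gap be x ^+ 3))).
Proof.
move=> s0.
have dx := der_var x; have db := der_cst x (1 - be).
have ds : is_derive x 1 (turn_gap be) (- (2 * x)).
  by apply: (der_congr (der_sub db (der_sqr dx))); ring.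
have s1 : 4 * turn_gap be x != 0 by rewrite gt_eqF// mulr_gt0.
have s2 : 4 * turn_gap be x ^+ 2 != 0 by rewrite gt_eqF// mulr_gt0// exprn_gt0.
have := der_add (der_add
  (der_add (der_mul (der_cst x (l ^+ 2)) ds) (der_cst x (3 / 4 * (1 - be))))
  (der_mul (der_cst x (6 * be - 9 * be ^+ 2)) (der_inv (der_mul (der_cst x 4) ds) s1)))
  (der_mul (der_cst x (5 * be ^+ 2 * (1 - be))) (der_inv (der_mul (der_cst x 4) (der_sqr ds)) s2)).
move=> h; apply: (der_congr h).
by field; rewrite gt_eqF.
Qed.

(** The derivative of a Sonin function has the sign opposite to that of [Phi'];
    here, with [M = s Phi], [2 x M + s M' = s ^ 2 Phi'] is nonnegative, a quadratic inequality in
    [s] that holds for all [0 < be < 1] thanks to the shift [1/2] in the choice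
    of [be]. *)
Lemma sonin_derive (x : R) : 0 <= x -> 0 < turn_gap be x ->
  exists2 df, is_derive x 1 (sonin l be u U) df &
    turn_gap be x * df <= x * sonin l be u U x.
Proof.
move=> x0 s0; move: (hbe) => /andP[b0 b1].
have x1 : -1 < x < 1 by move: s0; rewrite /turn_gap => s0; apply/andP; split; nra.
have [hu hU] := hsol x1.
have p0 : 0 < 1 - x ^+ 2 by move: x1 => /andP[? ?]; nra.
have sD : 0 < turn_gap be x <= 1 - be by rewrite s0 /turn_gap; nra.
have M0 := sonin_coef_gt0 sD.
have dMx := sonin_coef_derive s0.
have dZ := sonin_flux_derive x1 s0.
have h := der_add (der_sqr hu) (der_mul (der_sqr dZ) (der_inv dMx (lt0r_neq0 M0))).
eexists; first exact: h.
rewrite /sonin.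
set dm := - (2 * x) * _.
have hd : 0 <= 2 * x * sonin_coef l be (turn_gap be x) + turn_gap be x * dm.
  have -> : 2 * x * sonin_coef l be (turn_gap be x) + turn_gap be x * dm =
    2 * x * ((3 * (1 - be) * turn_gap be x ^+ 2 + 12 * be * (1 - be) * turn_gap be x
      + be ^+ 2 * (9 * (1 - be) + 6 * (1 - be - turn_gap be x))) / (4 * turn_gap be x ^+ 2)).
    by rewrite /dm /sonin_coef; field; rewrite gt_eqF.
  move: sD => /andP[_ sD].
  apply: mulr_ge0; first by rewrite mulr_ge0.
  apply: divr_ge0; last by rewrite mulr_ge0 ?sqr_ge0.
  have b1' : 0 <= 1 - be by lra.
  rewrite !addr_ge0// ?mulr_ge0 ?sqr_ge0//; try lra.
have eU : U x = sonin_flux be u U x + x * (1 - x ^+ 2) / (2 * turn_gap be x) * u x.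
  by rewrite /sonin_flux; ring.
rewrite -subr_ge0.
set Z := sonin_flux be u U x in eU *.
set M := sonin_coef _ _ _ in hd M0 *.
set s := turn_gap be x in hd s0 eU *.
rewrite eU.
have -> : x * (u x ^+ 2 + Z ^+ 2 / M) -
   s * (2 * u x * ((Z + x * (1 - x ^+ 2) / (2 * s) * u x) / (1 - x ^+ 2)) +
     (2 * Z * (- (M / (1 - x ^+ 2)) * u x - x / (2 * s) * Z) / M +
      Z ^+ 2 * (- dm / M ^+ 2))) = Z ^+ 2 / M ^+ 2 * (2 * x * M + s * dm).
  by field; rewrite !gt_eqF.
by rewrite mulr_ge0// divr_ge0 ?sqr_ge0.
Qed.

Lemma sonin_ge0 (x : R) : 0 < turn_gap be x -> 0 <= sonin l be u U x.
Proof.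
move=> s0; rewrite /sonin addr_ge0 ?sqr_ge0// divr_ge0 ?sqr_ge0// ltW//.
by apply: sonin_coef_gt0; rewrite s0 /turn_gap lerBlDr lerDl sqr_ge0.
Qed.

(** With [f] the function [sonin], [(s f ^ 2)' = 2 f (s f' - x f)] is nonpositive. *)
Lemma sonin_bound (x : R) : 0 <= x -> 0 < turn_gap be x ->
  turn_gap be x * sonin l be u U x ^+ 2 <= (1 - be) * sonin l be u U 0 ^+ 2.
Proof.
move=> x0 s0.
have hs t : 0 <= t <= x -> 0 < turn_gap be t.
  by move=> /andP[t0 tx]; move: s0; rewrite /turn_gap; nra.
pose df t := 'D_1 (sonin l be u U) t.
have hdf t : 0 <= t <= x -> is_derive t 1 (sonin l be u U) (df t) /\
   turn_gap be t * df t <= t * sonin l be u U t.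
  move=> ht; have /andP[t0 tx] := ht; have [d hd1 hd2] := sonin_derive t0 (hs _ ht).
  by rewrite /df derive_val.
have := @derive_le0_nincr R (fun t => turn_gap be t * sonin l be u U t ^+ 2)
  (fun t => 2 * sonin l be u U t * (turn_gap be t * df t - t * sonin l be u U t)) 0 x x0.
rewrite [turn_gap be 0]/turn_gap expr0n subr0; apply.
- move=> t ht; have [h1 _] := hdf t ht.
  have ds : is_derive t 1 (turn_gap be) (- (2 * t)).
    by apply: (der_congr (der_sub (der_cst t (1 - be)) (der_sqr (der_var t)))); ring.
  by apply: (der_congr (der_mul ds (der_sqr h1))); ring.
- move=> t ht; have [_ h2] := hdf t ht.
  apply: mulr_ge0_le0; last by rewrite subr_le0.
  by rewrite mulr_ge0// sonin_ge0// hs.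
Qed.

End Sonin.

(** * Energy and decay beyond the turning point *)

Definition energy (R : realType) (l m : R) (u U : R -> R) (x : R) : R :=
  U x ^+ 2 + ((l ^+ 2 - 4^-1) * (1 - x ^+ 2) - m ^+ 2) * u x ^+ 2.

Definition vanish_at1 (R : realType) (u : R -> R) :=
  forall e : R, 0 < e -> exists2 y : R, y < 1 & forall x : R, y < x < 1 -> `|u x| <= e.

Section Energy.
Variables (R : realType) (l m : R) (u U : R -> R).
Hypothesis hsol : legendre_sol l m u U.
Hypothesis hl : 0 <= l ^+ 2 - 4^-1.
Local Notation lam := (l ^+ 2 - 4^-1).
Local Notation E := (energy l m u U).

Let p_gt0 (x : R) : -1 < x < 1 -> 0 < 1 - x ^+ 2.
Proof. by move=> /andP[? ?]; nra. Qed.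

Lemma energy_derive (x : R) : -1 < x < 1 ->
  is_derive x 1 E (- (2 * lam * x * u x ^+ 2)).
Proof.
move=> x1; have [hu hU] := hsol x1; have p0 := p_gt0 x1.
have := der_add (der_sqr hU)
  (der_mul (der_sub (der_mul (der_cst x lam) (der_sub (der_cst x 1) (der_sqr (der_var x))))
    (der_cst x (m ^+ 2))) (der_sqr hu)).
move=> h; apply: (der_congr h).
by field; rewrite gt_eqF.
Qed.

Lemma energy_nincr (x y : R) : 0 <= x <= y -> y < 1 -> E y <= E x.
Proof.
move=> /andP[x0 xy] y1.
apply: (derive_le0_nincr (df := fun t => - (2 * lam * t * u t ^+ 2)) xy) => t /andP[xt ty].
  by apply: energy_derive; apply/andP; split; lra.
by rewrite oppr_le0 mulr_ge0 ?sqr_ge0// !mulr_ge0// (le_trans x0).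
Qed.

(** The derivative of [u] is controlled by the energy, which decreases. *)
Lemma energy_sup (x y : R) : 0 <= x <= y -> y < 1 ->
  m ^+ 2 <= lam * (1 - y ^+ 2) ->
  u y ^+ 2 <= 2 * u x ^+ 2 + 2 * (y - x) ^+ 2 * E x / (1 - y ^+ 2) ^+ 2.
Proof.
move=> /andP[x0 xy] y1 hy.
have py : 0 < 1 - y ^+ 2 by apply: p_gt0; apply/andP; split; lra.
have ht t : x <= t <= y -> -1 < t < 1 by move=> /andP[? ?]; apply/andP; split; lra.
have hc : {within `[x, y], continuous u}.
  apply: derivable_within_continuous => t; rewrite in_itv/= => /ht t1.
  by have [h _] := hsol t1; exact: (@ex_derive _ _ _ _ _ _ _ h).
have [t|c] := @MVT_segment R u (fun t => U t / (1 - t ^+ 2)) x y xy _ hc.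
  by rewrite in_itv/= => /andP[? ?]; have [] // := hsol (ht t _); apply/andP; split; lra.
rewrite in_itv/= => hcxy e; have /andP[xc cy] := hcxy.
have pc : 1 - y ^+ 2 <= 1 - c ^+ 2 by nra.
have hE : U c ^+ 2 <= E x.
  apply: le_trans (energy_nincr (x := x) (y := c) _ _); [|lra|lra].
  rewrite /energy lerDl mulr_ge0 ?sqr_ge0// subr_ge0 (le_trans hy)// ler_wpM2l//.
have h2 : (u y - u x) ^+ 2 <= (y - x) ^+ 2 * E x / (1 - y ^+ 2) ^+ 2.
  rewrite e exprMn expr_div_n mulrC -[leRHS]mulrA ler_wpM2l ?sqr_ge0//.
  apply: ler_pM; rewrite ?sqr_ge0 ?invr_ge0 ?sqr_ge0//.
  by rewrite lef_pV2 ?posrE ?exprn_gt0//; [nra|lra].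
have := sqr_ge0 (u y - 2 * u x); rewrite -!mulrA mulrA in h2 *.
by move: (_ / (1 - y ^+ 2) ^+ 2) h2 => w; nra.
Qed.

Hypothesis hu1 : vanish_at1 u.
Hypothesis hU1 : vanish_at1 U.

Lemma vanish_both (e x : R) : 0 < e -> x < 1 ->
  exists2 y, x < y < 1 & `|u y| <= e /\ `|U y| <= e.
Proof.
move=> e0 x1; have [a a1 ha] := hu1 e0; have [b b1 hb] := hU1 e0.
pose z := Num.max x (Num.max a b).
have z1 : z < 1 by rewrite !gt_max x1 a1 b1.
have : x <= z /\ a <= z /\ b <= z by rewrite /z !le_max !lexx !orbT.
move=> [xz [az bz]].
exists ((z + 1) / 2); first by apply/andP; split; lra.
by split; [apply: ha|apply: hb]; apply/andP; split; lra.
Qed.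

(** The energy decreases to a nonnegative limit: [U] and [u] vanish at the pole. *)
Lemma energy_ge0 (x : R) : 0 <= x < 1 -> 0 <= E x.
Proof.
move=> /andP[x0 x1]; rewrite leNgt; apply/negP => E0.
pose e := Num.min 1 (- E x / (m ^+ 2 + 1)).
have m0 : 0 < m ^+ 2 + 1 by rewrite ltr_wpDl ?sqr_ge0.
have e0 : 0 < e by rewrite lt_min ltr01 divr_gt0// oppr_gt0.
have [y /andP[xy y1] [hu hU]] := vanish_both e0 x1.
have h1 : E y <= E x by apply: energy_nincr => //; rewrite x0 ltW.
have py : 0 < 1 - y ^+ 2 by apply: p_gt0; apply/andP; split; lra.
have h2 : - m ^+ 2 * u y ^+ 2 <= E y.
  have a0 : 0 <= lam * (1 - y ^+ 2) * u y ^+ 2.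
    by apply: mulr_ge0; [apply: mulr_ge0 => //; exact: ltW|exact: sqr_ge0].
  by have := sqr_ge0 (U y); rewrite /energy; lra.
have h3 : u y ^+ 2 <= e.
  rewrite -real_normK ?num_real//; apply: (@le_trans _ _ (`|u y| * 1)); last by rewrite mulr1.
  by rewrite expr2 ler_wpM2l// (le_trans hu)// ge_min lexx.
have h4 : e * (m ^+ 2 + 1) <= - E x by rewrite -ler_pdivlMr// ge_min lexx orbT.
have h5 : m ^+ 2 * u y ^+ 2 <= m ^+ 2 * e by rewrite ler_wpM2l ?sqr_ge0.
clearbody e; move: (E x) (E y) h1 h2 h4 E0 => Ex Ey; rewrite mulrDr mulr1 mulNr [e * _]mulrC; lra.
Qed.

(** Beyond the turning point [u U] increases, and it tends to 0. *)
Lemma uU_le0 (x : R) : 0 <= x < 1 -> lam * (1 - x ^+ 2) <= m ^+ 2 -> u x * U x <= 0.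
Proof.
move=> /andP[x0 x1] hx; rewrite leNgt; apply/negP => E0.
pose e := Num.min 1 (u x * U x / 2).
have e0 : 0 < e by rewrite lt_min ltr01 divr_gt0.
have [y /andP[xy y1] [hu hU]] := vanish_both e0 x1.
have : - (u y * U y) <= - (u x * U x).
  apply: (derive_le0_nincr (f := fun t => - (u t * U t))
    (df := fun t => - (U t ^+ 2 / (1 - t ^+ 2)
         + (m ^+ 2 - lam * (1 - t ^+ 2)) * u t ^+ 2 / (1 - t ^+ 2))) (ltW xy)).
    move=> t /andP[xt ty]; have t1 : -1 < t < 1 by apply/andP; split; lra.
    have [h h'] := hsol t1; apply: (der_congr (der_opp (der_mul h h'))).
    by field; rewrite gt_eqF// p_gt0.
  move=> t /andP[xt ty]; have t1 : -1 < t < 1 by apply/andP; split; lra.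
  have p0 := p_gt0 t1.
  rewrite oppr_le0 addr_ge0// divr_ge0 ?sqr_ge0 ?(ltW p0)//.
  rewrite mulr_ge0 ?sqr_ge0// subr_ge0; apply: le_trans hx.
  by rewrite ler_wpM2l//; nra.
have : u y * U y <= e * e.
  by rewrite (le_trans (ler_norm _))// normrM ler_pM.
have e1 : e <= 1 by rewrite ge_min lexx.
have e2 : e <= u x * U x / 2 by rewrite ge_min lexx orbT.
by nra.
Qed.

(** Beyond the turning point [- U / u] is at least the square root of
    [m ^ 2 - lam (1 - x ^ 2)]; comparing logarithmic derivatives turns this
    into decay of [u] against any weight [w] of slower logarithmic growth. *)
Lemma decay (w dw g : R -> R) (x y : R) : 0 <= x <= y -> y < 1 ->
  lam * (1 - x ^+ 2) <= m ^+ 2 ->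
  (forall t, x <= t <= y -> is_derive t 1 w (dw t)) ->
  (forall t, x <= t <= y -> [/\ 0 <= w t, 0 <= g t,
     g t ^+ 2 <= m ^+ 2 - lam * (1 - t ^+ 2) &
     (1 - t ^+ 2) * dw t <= 4 * g t * w t]) ->
  u y ^+ 4 * w y <= u x ^+ 4 * w x.
Proof.
move=> /andP[x0 xy] y1 hx hw hg.
have ht t : x <= t <= y -> -1 < t < 1 by move=> /andP[? ?]; apply/andP; split; lra.
have := @derive_le0_nincr R (fun t => (u t ^+ 2) ^+ 2 * w t)
  (fun t => u t ^+ 2 / (1 - t ^+ 2) *
    (u t ^+ 2 * ((1 - t ^+ 2) * dw t) + 4 * (u t * U t) * w t)) x y xy.
rewrite -!exprM; apply.
  move=> t hxy; have [h _] := hsol (ht t hxy).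
  apply: (der_congr (der_mul (der_sqr (der_sqr h)) (hw t hxy))).
  by field; rewrite gt_eqF// p_gt0// ht.
move=> t hxy; have [w0 g0 gq hdw] := hg t hxy.
have p0 := p_gt0 (ht _ hxy); have /andP[xt ty] := hxy.
have t01 : 0 <= t < 1 by apply/andP; split; lra.
apply: mulr_ge0_le0; first by rewrite divr_ge0 ?sqr_ge0// ltW.
have le1 : lam * (1 - t ^+ 2) <= m ^+ 2.
  by apply: le_trans hx; rewrite ler_wpM2l//; nra.
have h1 := uU_le0 t01 le1.
have h2 := energy_ge0 t01; rewrite /energy in h2.
have h3 : g t * u t ^+ 2 <= - (u t * U t).
  have n1 : 0 <= g t * u t ^+ 2 by rewrite mulr_ge0 ?sqr_ge0.
  have n2 : 0 <= - (u t * U t) by rewrite oppr_ge0.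
  rewrite -(@ler_pXn2r _ 2)// ?nnegrE//.
  have -> : (g t * u t ^+ 2) ^+ 2 = g t ^+ 2 * u t ^+ 2 * u t ^+ 2 by ring.
  have -> : (- (u t * U t)) ^+ 2 = U t ^+ 2 * u t ^+ 2 by ring.
  rewrite ler_wpM2r ?sqr_ge0//.
  have : g t ^+ 2 * u t ^+ 2 <= (m ^+ 2 - lam * (1 - t ^+ 2)) * u t ^+ 2.
    by rewrite ler_wpM2r ?sqr_ge0.
  by lra.
have h4 : u t ^+ 2 * ((1 - t ^+ 2) * dw t) <= u t ^+ 2 * (4 * g t * w t).
  by rewrite ler_wpM2l ?sqr_ge0.
have h5 : g t * u t ^+ 2 * w t <= - (u t * U t) * w t.
  exact: (ler_wpM2r w0 h3).
by lra.
Qed.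

(** The weight 1: beyond the turning point [|u|] decreases. *)
Lemma norm_nincr (x y : R) : 0 <= x <= y -> y < 1 ->
  lam * (1 - x ^+ 2) <= m ^+ 2 -> u y ^+ 4 <= u x ^+ 4.
Proof.
move=> xy y1 hx.
have h := @decay (fun=> 1) (fun=> 0) (fun=> 0) x y xy y1 hx.
rewrite -[leLHS]mulr1 -[leRHS]mulr1; apply: h.
move=> t /andP[xt ty]; split; rewrite ?mulr0 ?mul0r//.
rewrite expr0n subr_ge0 (le_trans _ hx)// ler_wpM2l//.
by move: xy => /andP[x0 xy]; nra.
Qed.

End Energy.

(** * Amplitude on the whole interval *)

(** The loss in crossing the turning region: [2] from the splitting of
    [u y ^ 2] in [energy_sup] and [324 = 36 * 9] from the bounds [hh], [hp] and
    [key] in the proof of [amplitude_airy]. *)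
Definition airy_cst (R : realType) (K : R) : R := 2 + 324 * (1 + K / 2) ^+ 2.

(** [S] bounds the amplitude at the equator, and [tau] is the width, in [x ^ 2], of
    the turning region: [tau_cube] is the scaling of the Airy equation,
    [tau_le] keeps the region small compared to the distance of the turning
    point from 0 and from the pole, and [tau_ge] makes it absorb shifts of
    order [1 / lam]. *)
Section Amplitude.
Variables (R : realType) (l m be tau K th S : R) (u U : R -> R).
Local Notation lam := (l ^+ 2 - 4^-1).
Hypothesis hsol : legendre_sol l m u U.
Hypothesis hl : 1 <= l.
Hypothesis hbe : 0 < be < 1.
Hypothesis hm : be * lam = m ^+ 2 + 2^-1.
Hypothesis hS : (1 - be) * sonin l be u U 0 ^+ 2 <= S.
Hypothesis tau_gt0 : 0 < tau.
Hypothesis tau_le : 2 * tau <= be * (1 - be).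
Hypothesis tau_cube : l ^+ 2 * tau ^+ 3 = th * (1 - be) * be ^+ 2.
Hypothesis th_01 : 0 < th <= 1.
Hypothesis tau_ge : 1 <= K * lam * tau.

Let l2 : 1 <= l ^+ 2. Proof. by rewrite exprn_ege1. Qed.
Let lam_gt0 : 0 < lam. Proof. by have := l2; lra. Qed.
Let lam_ge : 3 / 4 * l ^+ 2 <= lam. Proof. by have := l2; lra. Qed.
Let lam_le : lam <= l ^+ 2. Proof. lra. Qed.

Lemma amplitude_osc (x : R) : 0 <= x -> 0 < turn_gap be x -> u x ^+ 4 * turn_gap be x <= S.
Proof.
move=> x0 s0; apply: le_trans hS; apply: le_trans (sonin_bound hsol hbe hm x0 s0).
rewrite mulrC ler_wpM2l ?(ltW s0)//.
have h : u x ^+ 2 <= sonin l be u U x.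
  rewrite /sonin lerDl divr_ge0 ?sqr_ge0// ltW//; apply: sonin_coef_gt0 => //.
  by rewrite s0 /turn_gap lerBlDr lerDl sqr_ge0.
have -> : u x ^+ 4 = (u x ^+ 2) ^+ 2 by rewrite -exprM.
by rewrite ler_pXn2r// nnegrE ?sqr_ge0// (le_trans _ h)// sqr_ge0.
Qed.

(** For [m = 0] the oscillatory region reaches to within [1 / l] of the pole,
    where a bound of the size of the value at the pole is enough. *)
Lemma amplitude_order0 (x : R) : m = 0 -> 0 <= x <= 1 -> u x ^+ 4 <= l ^+ 2 ->
  u x ^+ 4 * (tau + `|x ^+ 2 - 1|) <= (2 + K) * S + 4.
Proof.
move=> mz /andP[x0 x1] hu; move: (hbe) (hS) => /andP[b0 b1] S_ge.
have h0 := lam_gt0; have l2_ge := l2; have t0 := tau_gt0; have t_le := tau_le.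
have t_ge := tau_ge.
have K_ge0 : 0 <= K.
  have h := mulr_gt0 h0 t0; rewrite leNgt; apply/negP => k0; nra.
have S0 : 0 <= S.
  by apply: le_trans S_ge; rewrite mulr_ge0 ?sqr_ge0//; lra.
have u4 : 0 <= u x ^+ 4 by rewrite exprn_even_ge0.
have KS : 0 <= (2 + K) * S by rewrite mulr_ge0//; lra.
have p1 : 0 <= 1 - x ^+ 2 by nra.
have be2 : be * lam = 2^-1 by rewrite hm mz expr0n add0r.
rewrite ler0_norm; last by lra.
have [hs|hs] := leP tau (turn_gap be x).
  have s0 : 0 < turn_gap be x by apply: lt_le_trans hs.
  have h := amplitude_osc x0 s0.
  have hb : be <= K * turn_gap be x.
    rewrite -(ler_pM2r h0) be2; apply: (@le_trans _ _ 1); first lra.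
    apply: (le_trans t_ge); rewrite mulrAC; apply: ler_wpM2r; first exact: ltW.
    by apply: ler_wpM2l.
  have hb2 : tau - (x ^+ 2 - 1) <= (2 + K) * turn_gap be x.
    by move: hs hb; rewrite /turn_gap; lra.
  apply: (@le_trans _ _ (u x ^+ 4 * ((2 + K) * turn_gap be x))).
    by apply: ler_wpM2l => //; lra.
  rewrite mulrCA; apply: (@le_trans _ _ ((2 + K) * S)); last by lra.
  by apply: ler_wpM2l h; lra.
have hb : tau - (x ^+ 2 - 1) <= 2 * be.
  have : be * (1 - be) <= be by nra.
  by move: hs; rewrite /turn_gap; lra.
apply: (@le_trans _ _ (l ^+ 2 * (2 * be))); first by apply: ler_pM => //; lra.
have : be * l ^+ 2 <= 2 * (be * lam) by nra.
by rewrite be2; lra.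
Qed.

Hypothesis m_ge : 2^-1 <= m.

Let m2 : 4^-1 <= m ^+ 2. Proof. have := m_ge; nra. Qed.

(** At the left end of the turning region, [s = tau], both [u ^ 2] and [U ^ 2] are
    controlled by the Sonin function. *)
Lemma airy_energy (x : R) : 0 <= x -> x ^+ 2 = 1 - be - tau ->
  energy l m u U x <= sonin l be u U x *
    (3 * (l ^+ 2 * tau) + 2 + 3 * (be / tau) + 4 * ((1 - be) * be ^+ 2 / tau ^+ 2)).
Proof.
move=> x0 ex; move: (hbe) => /andP[b0 b1].
have es : turn_gap be x = tau by rewrite /turn_gap ex; ring.
have hs : 0 < tau <= 1 - be by apply/andP; split => //; nra.
have M0 := sonin_coef_gt0 l hbe hs.
set f := sonin l be u U x.
have eU : U x = sonin_flux be u U x + x * (1 - x ^+ 2) / (2 * tau) * u x.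
  by rewrite /sonin_flux es; ring.
have ef : f = u x ^+ 2 + sonin_flux be u U x ^+ 2 / sonin_coef l be tau by rewrite /f /sonin es.
have hu : u x ^+ 2 <= f by rewrite ef lerDl divr_ge0 ?sqr_ge0// ltW.
have f0 : 0 <= f by apply: le_trans hu; rewrite sqr_ge0.
have hZ : sonin_flux be u U x ^+ 2 <= sonin_coef l be tau * f.
  rewrite -ler_pdivrMl// mulrC ef lerDr sqr_ge0//.
set B := be / tau; set Q := (1 - be) * be ^+ 2 / tau ^+ 2.
have B0 : 0 <= B by rewrite divr_ge0// ltW.
have Q0 : 0 <= Q by rewrite divr_ge0 ?sqr_ge0// mulr_ge0 ?sqr_ge0//; lra.
have hM : sonin_coef l be tau <= l ^+ 2 * tau + 3 / 4 + 3 / 2 * B + 5 / 4 * Q.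
  rewrite /sonin_coef.
  have -> : (6 * be - 9 * be ^+ 2) / (4 * tau) = 3 / 2 * B - 9 / 4 * (be * B).
    by rewrite /B; field; rewrite gt_eqF.
  have -> : 5 * be ^+ 2 * (1 - be) / (4 * tau ^+ 2) = 5 / 4 * Q.
    by rewrite /Q; field; rewrite gt_eqF.
  have : 0 <= be * B by rewrite mulr_ge0// ltW.
  by lra.
have hW : (x * (1 - x ^+ 2) / (2 * tau)) ^+ 2 <= 9 / 16 * Q.
  have -> : (x * (1 - x ^+ 2) / (2 * tau)) ^+ 2 =
     x ^+ 2 * (1 - x ^+ 2) ^+ 2 / (4 * tau ^+ 2) by field; rewrite gt_eqF.
  have -> : 9 / 16 * Q = (1 - be) * (3 / 2 * be) ^+ 2 / (4 * tau ^+ 2).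
    by rewrite /Q; field; rewrite gt_eqF.
  apply: ler_wpM2r; first by rewrite invr_ge0 mulr_ge0 ?sqr_ge0.
  apply: ler_pM; rewrite ?sqr_ge0//.
    by rewrite ex; lra.
  have ep : 1 - x ^+ 2 = be + tau by rewrite ex; ring.
  have bb : be * (1 - be) <= be by nra.
  rewrite ep; apply: lerXn2r; rewrite ?nnegrE.
  - exact: addr_ge0 (ltW b0) (ltW tau_gt0).
  - by rewrite mulr_ge0 ?ltW.
  - have := tau_le; move: bb; set w := be * _ => w1 w2; lra.
have hUU : U x ^+ 2 <= 2 * (sonin_coef l be tau * f) + 9 / 8 * Q * f.
  apply: (@le_trans _ _ (2 * sonin_flux be u U x ^+ 2 +
      2 * ((x * (1 - x ^+ 2) / (2 * tau)) ^+ 2 * u x ^+ 2))).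
    rewrite eU.
    have := sqr_ge0 (sonin_flux be u U x - x * (1 - x ^+ 2) / (2 * tau) * u x).
    by move: (sonin_flux _ _ _ _) (x * (1 - x ^+ 2) / (2 * tau)) => Z W; nra.
  have : (x * (1 - x ^+ 2) / (2 * tau)) ^+ 2 * u x ^+ 2 <= 9 / 16 * Q * f.
    by rewrite ler_pM ?sqr_ge0.
  by lra.
have hq : (lam * (1 - x ^+ 2) - m ^+ 2) * u x ^+ 2 <= (l ^+ 2 * tau + 2^-1) * f.
  have -> : lam * (1 - x ^+ 2) - m ^+ 2 = lam * tau + 2^-1.
    by rewrite ex -(addrK 2^-1 (m ^+ 2)) -hm; ring.
  apply: ler_pM; rewrite ?sqr_ge0//.
    by rewrite addr_ge0// mulr_ge0// ltW.
  by rewrite lerD2r ler_wpM2r// ltW.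
have hMf : sonin_coef l be tau * f <= (l ^+ 2 * tau + 3 / 4 + 3 / 2 * B + 5 / 4 * Q) * f.
  by rewrite ler_wpM2r.
have Qf : 0 <= Q * f by rewrite mulr_ge0.
by rewrite /energy; lra.
Qed.

(** The turning region has width at most [h ~ tau / sqrt (1 - be)], and
    [h ^ 2 * energy / p ^ 2] is comparable to the Sonin function because
    [tau ^ 3] is comparable to [(1 - be) be ^ 2 / l ^ 2]. *)
Lemma amplitude_airy (x : R) : 0 <= x -> 1 - be - tau <= x ^+ 2 ->
  m ^+ 2 <= lam * (1 - x ^+ 2) -> u x ^+ 4 * tau <= airy_cst K ^+ 2 * S.
Proof.
have t_gt0 := tau_gt0; have t_le := tau_le; have t_ge := tau_ge.
move=> x0 hx hxm; move: (hbe) (th_01) => /andP[b0 b1] /andP[t0 t1].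
have D0 : 0 < 1 - be by lra.
have hD : tau <= (1 - be) / 2 by nra.
pose x1 := Num.sqrt (1 - be - tau).
have x10 : 0 <= x1 by rewrite sqrtr_ge0.
have ex1 : x1 ^+ 2 = 1 - be - tau by rewrite sqr_sqrtr//; lra.
have es : turn_gap be x1 = tau by rewrite /turn_gap ex1; ring.
have x1x : x1 <= x by rewrite -(@ler_pXn2r _ 2)// ex1.
have p0 : be / 3 <= 1 - x ^+ 2.
  rewrite -(ler_pM2l lam_gt0); apply: le_trans hxm.
  rewrite mulrA [lam * be]mulrC hm; have := m2; lra.
have xlt1 : x < 1 by nra.
have x1x' : 0 <= x1 <= x by rewrite x10.
have hsup := energy_sup hsol (ltW lam_gt0) x1x' xlt1 hxm.
have hE := airy_energy x10 ex1.
set f := sonin l be u U x1 in hE.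
have s1 : 0 < turn_gap be x1 by rewrite es.
have f0 : 0 <= f by apply: sonin_ge0.
have hf : tau * f ^+ 2 <= S.
  by have := sonin_bound hsol hbe hm x10 s1; rewrite es => h; apply: le_trans hS.
have hu : u x1 ^+ 2 <= f.
  rewrite /f /sonin lerDl divr_ge0 ?sqr_ge0// ltW//; apply: sonin_coef_gt0 => //.
  by rewrite es; apply/andP; split => //; lra.
set B := 3 * _ + _ + _ + _ in hE.
have K0 : 0 <= K.
  by rewrite leNgt; apply/negP => k0; have := mulr_gt0 lam_gt0 tau_gt0; have := tau_ge; nra.
have hh : (x - x1) ^+ 2 <= 2 * (1 + K / 2) ^+ 2 * (tau ^+ 2 / (1 - be)).
  have e1 : x ^+ 2 - x1 ^+ 2 <= (1 + K / 2) * tau.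
    rewrite -(ler_pM2l lam_gt0) ex1.
    have -> : lam * (x ^+ 2 - (1 - be - tau)) = be * lam + lam * tau - lam * (1 - x ^+ 2).
      by ring.
    by rewrite hm; have := tau_ge; lra.
  have e2 : (x - x1) * x <= (1 + K / 2) * tau.
    by apply: le_trans e1; rewrite subr_sqr ler_wpM2l ?subr_ge0// lerDl.
  have e3 : ((x - x1) * x) ^+ 2 <= ((1 + K / 2) * tau) ^+ 2.
    rewrite ler_pXn2r// nnegrE; first by rewrite mulr_ge0// subr_ge0.
    by rewrite mulr_ge0 ?ltW//; lra.
  rewrite mulrA ler_pdivlMr//.
  have e4 : (x - x1) ^+ 2 * (1 - be) <= (x - x1) ^+ 2 * (2 * x ^+ 2).
    by rewrite ler_wpM2l ?sqr_ge0//; lra.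
  by nra.
have hp : ((1 - x ^+ 2) ^+ 2)^-1 <= 9 / be ^+ 2.
  have -> : 9 / be ^+ 2 = ((be / 3) ^+ 2)^-1 by field; rewrite gt_eqF.
  have b3 : 0 < be / 3 by lra.
  have px : 0 < 1 - x ^+ 2 by lra.
  by rewrite lef_pV2 ?posrE ?exprn_gt0//; apply: lerXn2r; rewrite ?nnegrE// ltW.
have hB : 0 <= B.
  have w1 : 0 <= l ^+ 2 * tau by rewrite mulr_ge0 ?sqr_ge0// ltW.
  have w2 : 0 <= be / tau by rewrite divr_ge0// ltW.
  have w3 : 0 <= (1 - be) * be ^+ 2 / tau ^+ 2.
    by rewrite divr_ge0 ?sqr_ge0// mulr_ge0 ?sqr_ge0// ltW.
  rewrite /B; lra.
have key : tau ^+ 2 / ((1 - be) * be ^+ 2) * B <= 9.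
  have -> : tau ^+ 2 / ((1 - be) * be ^+ 2) * B =
     3 * (l ^+ 2 * tau ^+ 3 / ((1 - be) * be ^+ 2)) +
     2 * (1 - be) * (tau / (be * (1 - be))) ^+ 2 +
     3 * (tau / (be * (1 - be))) + 4.
    by rewrite /B; field; rewrite !gt_eqF.
  rewrite tau_cube.
  have -> : th * (1 - be) * be ^+ 2 / ((1 - be) * be ^+ 2) = th by field; rewrite !gt_eqF.
  have : tau / (be * (1 - be)) <= 2^-1 by rewrite ler_pdivrMr ?mulr_gt0//; lra.
  have : 0 <= tau / (be * (1 - be)) by rewrite divr_ge0 ?mulr_ge0// ltW.
  by move: (tau / _) => w w0 w1; have : w ^+ 2 <= 4^-1; nra.
have hu2 : u x ^+ 2 <= airy_cst K * f.
  have -> : airy_cst K * f = 2 * f + 324 * (1 + K / 2) ^+ 2 * f.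
    by rewrite /airy_cst; ring.
  apply: (le_trans hsup); apply: lerD; first by rewrite ler_wpM2l.
  have e1 : (x - x1) ^+ 2 * energy l m u U x1 <=
      2 * (1 + K / 2) ^+ 2 * (tau ^+ 2 / (1 - be)) * (f * B).
    apply: (@le_trans _ _ ((x - x1) ^+ 2 * (f * B))); first by rewrite ler_wpM2l ?sqr_ge0.
    by apply: ler_wpM2r hh; exact: mulr_ge0.
  have fB0 : 0 <= 2 * (1 + K / 2) ^+ 2 * (tau ^+ 2 / (1 - be)) * (f * B).
    apply: mulr_ge0; last exact: mulr_ge0.
    apply: mulr_ge0; first by rewrite mulr_ge0 ?sqr_ge0.
    by rewrite divr_ge0 ?sqr_ge0// ltW.
  apply: (@le_trans _ _
      (2 * (2 * (1 + K / 2) ^+ 2 * (tau ^+ 2 / (1 - be)) * (f * B)) * (9 / be ^+ 2))).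
    apply: (@le_trans _ _
      (2 * (2 * (1 + K / 2) ^+ 2 * (tau ^+ 2 / (1 - be)) * (f * B)) / (1 - x ^+ 2) ^+ 2)).
      by rewrite ler_wpM2r ?invr_ge0 ?sqr_ge0// -mulrA ler_wpM2l.
    by rewrite ler_wpM2l// mulr_ge0.
  have -> : 2 * (2 * (1 + K / 2) ^+ 2 * (tau ^+ 2 / (1 - be)) * (f * B)) * (9 / be ^+ 2) =
     36 * (1 + K / 2) ^+ 2 * f * (tau ^+ 2 / ((1 - be) * be ^+ 2) * B).
    by field; rewrite !gt_eqF.
  have -> : 324 * (1 + K / 2) ^+ 2 * f = 36 * (1 + K / 2) ^+ 2 * f * 9 by ring.
  apply: ler_wpM2l key; apply: mulr_ge0 f0.
  by rewrite mulr_ge0 ?sqr_ge0.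
have A0 : 0 <= airy_cst K by rewrite /airy_cst; have := sqr_ge0 (1 + K / 2); lra.
have -> : u x ^+ 4 = (u x ^+ 2) ^+ 2 by rewrite -exprM.
apply: (@le_trans _ _ ((airy_cst K * f) ^+ 2 * tau)).
  by rewrite ler_wpM2r ?(ltW tau_gt0)// ler_pXn2r// nnegrE ?sqr_ge0// mulr_ge0.
by rewrite exprMn -mulrA ler_wpM2l ?sqr_ge0// mulrC.
Qed.

Hypothesis hu1 : vanish_at1 u.
Hypothesis hU1 : vanish_at1 U.

Local Notation turn2 := (1 - m ^+ 2 / lam).

Let K_ge0 : 0 <= K.
Proof.
have t_ge := tau_ge; have h := mulr_gt0 lam_gt0 tau_gt0.
by rewrite leNgt; apply/negP => k0; nra.
Qed.

Let turn2E : turn2 = 1 - be + (2 * lam)^-1.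
Proof.
have l0 : lam != 0 by rewrite gt_eqF.
have -> : m ^+ 2 = be * lam - 2^-1 by rewrite hm addrK.
by move: lam l0 => w l0; field.
Qed.

Let lam_inv : (2 * lam)^-1 <= K * tau / 2.
Proof.
have h0 := lam_gt0; have t_ge := tau_ge.
rewrite -[leLHS]mul1r ler_pdivrMr ?mulr_gt0//; lra.
Qed.

Let lam_inv0 : 0 < (2 * lam)^-1.
Proof. by rewrite invr_gt0 mulr_gt0. Qed.

Let turn2_01 : 0 < turn2 < 1.
Proof.
have h0 := lam_gt0; have h2 := m2; have h3 := lam_inv0; move: hbe => /andP[b0 b1].
apply/andP; split; first by rewrite turn2E; lra.
by rewrite ltrBlDr ltrDl divr_gt0//; lra.
Qed.

Let qE (x : R) : m ^+ 2 - lam * (1 - x ^+ 2) = lam * (x ^+ 2 - turn2).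
Proof.
have l0 : lam != 0 by rewrite gt_eqF.
by move: lam l0 => w l0; field.
Qed.

(** Past the turning point [|u|] decreases, so the estimate there carries over. *)
Lemma amplitude_turn (x : R) : 0 <= x < 1 -> 1 - be - tau <= x ^+ 2 ->
  u x ^+ 4 * tau <= airy_cst K ^+ 2 * S.
Proof.
move=> /andP[x0 x1] hx; have h0 := lam_gt0.
have [h|h] := leP (x ^+ 2) turn2.
  apply: amplitude_airy => //; rewrite -subr_le0 qE mulr_ge0_le0 ?subr_le0//.
  exact: ltW.
have /andP[t0 t1] := turn2_01.
pose t := Num.sqrt turn2.
have et : t ^+ 2 = turn2 by rewrite sqr_sqrtr// ltW.
have tt : 0 <= t by rewrite sqrtr_ge0.
have tx : t <= x by rewrite -(@ler_pXn2r _ 2)// et ltW.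
apply: (@le_trans _ _ (u t ^+ 4 * tau)).
  rewrite ler_wpM2r ?(ltW tau_gt0)//.
  apply: (norm_nincr hsol (ltW lam_gt0) hu1 hU1) => //; first by rewrite tt.
  by rewrite -subr_ge0 qE et subrr mulr0.
apply: amplitude_airy => //.
  have := lam_inv0; have := tau_gt0; rewrite et turn2E; lra.
by rewrite -subr_le0 qE et subrr mulr0.
Qed.

(** [K'] makes [4 lam r ^ 3 >= x ^ 2 (1 - x ^ 2) ^ 2] hold for [r >= K' tau],
    which is where [u ^ 4 * (x ^ 2 - turn2)] starts to decrease. *)
Let K' := (1 + K) / th.

Let K'_ge1 : 1 <= K'.
Proof.
move: th_01 => /andP[t0 t1]; have := K_ge0.
by rewrite /K' ler_pdivlMr//; lra.
Qed.

Lemma amplitude_exp (x : R) : 0 <= x < 1 -> K' * tau <= x ^+ 2 - turn2 ->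
  u x ^+ 4 * (x ^+ 2 - turn2) <= K' * (airy_cst K ^+ 2 * S).
Proof.
move=> /andP[x0 x1] hx; have h0 := lam_gt0; have /andP[t0 t1] := turn2_01.
have t_gt0 := tau_gt0; have t_le := tau_le; have k1 := K'_ge1; have k0 := K_ge0.
move: (hbe) (th_01) => /andP[b0 b1] /andP[th0 th1].
have Kt0 : 0 < K' * tau by rewrite mulr_gt0//; lra.
pose t := Num.sqrt (turn2 + K' * tau).
have et : t ^+ 2 = turn2 + K' * tau by rewrite sqr_sqrtr//; lra.
have tt : 0 <= t by rewrite sqrtr_ge0.
have tx : t <= x by rewrite -(@ler_pXn2r _ 2)// et; lra.
apply: (@le_trans _ _ (u t ^+ 4 * (t ^+ 2 - turn2))); last first.
  have -> : t ^+ 2 - turn2 = K' * tau by rewrite et; ring.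
  rewrite mulrCA ler_wpM2l//; first by lra.
  apply: amplitude_turn; first by rewrite tt (le_lt_trans tx).
  by have := lam_inv0; rewrite et turn2E; lra.
have hq s : t <= s -> K' * tau <= s ^+ 2 - turn2.
  by move=> ts; have := lerXn2r 2 tt (le_trans tt ts) ts; rewrite et; lra.
apply: (decay (w := fun s => s ^+ 2 - turn2) (dw := fun s => 2 * s)
  (g := fun s => s * (1 - s ^+ 2) / (2 * (s ^+ 2 - turn2))) hsol (ltW lam_gt0) hu1 hU1) => //.
- by rewrite tt.
- by rewrite -subr_ge0 qE et mulr_ge0 ?ltW//; lra.
- by move=> s _; apply: (der_congr (der_sub (der_sqr (der_var s)) (der_cst s turn2))); ring.
move=> s /andP[ts sx]; have s0 : 0 <= s by lra.
have hr := hq _ ts; have r0 : 0 < s ^+ 2 - turn2 by lra.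
have s1 : s < 1 by lra.
have p0 : 0 <= 1 - s ^+ 2 by nra.
have pb : 1 - s ^+ 2 <= be by have := turn2E; have := lam_inv0; lra.
split; first exact: ltW.
- by rewrite divr_ge0// mulr_ge0// ltW.
(* With [g = s (1 - s ^ 2) / (2 r)] the weight [r] is exactly critical; what
   remains is [s ^ 2 (1 - s ^ 2) ^ 2 <= 4 lam r ^ 3], split below into the two
   summands of [s ^ 2 = turn2 + r]. *)
- rewrite qE; set r := s ^+ 2 - turn2 in hr r0 *.
  have -> : (s * (1 - s ^+ 2) / (2 * r)) ^+ 2 = s ^+ 2 * (1 - s ^+ 2) ^+ 2 / (4 * r ^+ 2).
    by field; rewrite gt_eqF.
  rewrite ler_pdivrMr ?mulr_gt0 ?exprn_gt0//.
  have hs2 : s ^+ 2 <= (1 - be) * (1 + K) + r.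
    have := turn2E; have := lam_inv; rewrite /r.
    have : K * (2 * tau) <= K * (be * (1 - be)) by rewrite ler_wpM2l.
    have : K * (be * (1 - be)) <= K * (1 - be) by rewrite ler_wpM2l//; nra.
    have : 0 <= K * (1 - be) by rewrite mulr_ge0//; lra.
    by lra.
  apply: (@le_trans _ _ (((1 - be) * (1 + K) + r) * be ^+ 2)).
    apply: ler_pM; rewrite ?sqr_ge0//.
    by apply: lerXn2r; rewrite ?nnegrE// ltW.
  have hl2 := lam_ge.
  have r2 : (K' * tau) ^+ 2 <= r ^+ 2 by apply: lerXn2r; rewrite ?nnegrE// ltW.
  have thK : th * K' = 1 + K by rewrite /K' mulrC divfK// gt_eqF.
  have hr2 : be ^+ 2 <= 2 * lam * r ^+ 2.
    have e1 : be <= l ^+ 2 * tau ^+ 2 * K'.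
      have : 2 * tau * be <= 2 * tau * (l ^+ 2 * tau ^+ 2 * K').
        have -> : 2 * tau * (l ^+ 2 * tau ^+ 2 * K') = 2 * (l ^+ 2 * tau ^+ 3) * K' by ring.
        rewrite tau_cube.
        have -> : 2 * (th * (1 - be) * be ^+ 2) * K' =
          2 * (be * (1 - be)) * be * (th * K') by ring.
        rewrite thK.
        have : 2 * tau * be <= be * (1 - be) * be by rewrite ler_wpM2r// ltW.
        have w0 : 0 <= be * (1 - be) * be by rewrite !mulr_ge0//; lra.
        have : 0 <= be * (1 - be) * be * K by rewrite mulr_ge0.
        by lra.
      by rewrite ler_pM2l// mulr_gt0.
    have e2 : l ^+ 2 * tau ^+ 2 * K' <= l ^+ 2 * tau ^+ 2 * (K' * K').
      apply: ler_wpM2l; first by rewrite mulr_ge0 ?sqr_ge0.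
      by rewrite ler_peMl//; lra.
    have e3 : l ^+ 2 * (K' * tau) ^+ 2 <= 4 / 3 * lam * r ^+ 2.
      by apply: ler_pM; rewrite ?sqr_ge0//; lra.
    have e4 : be ^+ 2 <= be by rewrite expr2 ler_piMl// ltW.
    have e5 : 0 <= lam * r ^+ 2 by rewrite mulr_ge0 ?sqr_ge0// ltW.
    by rewrite exprMn in e3; lra.
  have hr3 : (1 - be) * (1 + K) * be ^+ 2 <= 2 * lam * r ^+ 3.
    have r3 : (K' * tau) ^+ 3 <= r ^+ 3 by apply: lerXn2r; rewrite ?nnegrE// ltW.
    have e1 : l ^+ 2 * (K' * tau) ^+ 3 <= 4 / 3 * lam * r ^+ 3.
      apply: ler_pM; rewrite ?sqr_ge0//; [by rewrite exprn_ge0// ltW|by lra].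
    have e2 : (1 - be) * (1 + K) * be ^+ 2 <= l ^+ 2 * (K' * tau) ^+ 3.
      have -> : l ^+ 2 * (K' * tau) ^+ 3 = K' ^+ 2 * (th * K' * ((1 - be) * be ^+ 2)).
        by rewrite exprMn mulrCA tau_cube; ring.
      rewrite thK.
      have -> : (1 - be) * (1 + K) * be ^+ 2 = (1 + K) * ((1 - be) * be ^+ 2) by ring.
      rewrite ler_peMl//; last by rewrite exprn_ege1.
      by rewrite !mulr_ge0 ?sqr_ge0//; lra.
    have e5 : 0 <= lam * r ^+ 3 by rewrite mulr_ge0 ?exprn_ge0// ltW.
    by lra.
  have : r * be ^+ 2 <= r * (2 * lam * r ^+ 2) by rewrite ler_wpM2l// ltW.
  by lra.
- rewrite le_eqVlt; apply/orP; left; apply/eqP.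
  by move: (s ^+ 2 - turn2) (lt0r_neq0 r0) => w w0; field.
Qed.

(** The three regions are [x ^ 2 < 1 - be - tau], the rest up to a distance
    [K' tau] beyond the turning point, and what is left.  The points
    [1 - be], [turn2] and [1 - m ^ 2 / l ^ 2] differ by [O (1 / lam)], which
    [tau_ge] absorbs into [tau]. *)
Lemma amplitude (x : R) : m <= l -> 0 <= x < 1 ->
  u x ^+ 4 * (tau + `|x ^+ 2 - (1 - m ^+ 2 / l ^+ 2)|) <=
  (2 + K + K') * (airy_cst K ^+ 2 * S).
Proof.
move=> hml hx01; have /andP[x0 x1] := hx01.
have h0 := lam_gt0; have t_gt0 := tau_gt0; have k1 := K'_ge1; have k0 := K_ge0.
have li := lam_inv; have li0 := lam_inv0; have te := turn2E; have t_ge := tau_ge.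
have S0 : 0 <= S.
  by apply: le_trans hS; rewrite mulr_ge0 ?sqr_ge0//; move: hbe => /andP[? ?]; lra.
have A1 : 1 <= airy_cst K by rewrite /airy_cst; have := sqr_ge0 (1 + K / 2); lra.
have AS : S <= airy_cst K ^+ 2 * S by rewrite ler_peMl// exprn_ege1.
set W := airy_cst K ^+ 2 * S in AS *.
have W0 : 0 <= W by apply: le_trans AS.
have u4 : 0 <= u x ^+ 4 by rewrite exprn_even_ge0.
have l20 : 0 < l ^+ 2 by have := l2; lra.
have da : 0 <= m ^+ 2 / lam - m ^+ 2 / l ^+ 2 <= (2 * lam)^-1.
  have -> : m ^+ 2 / lam - m ^+ 2 / l ^+ 2 = m ^+ 2 / l ^+ 2 / 2 * (2 * lam)^-1.
    have w1 := l2; have w2 := hl; field.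
    by apply/andP; split; rewrite gt_eqF//; lra.
  have h : 0 <= m ^+ 2 / l ^+ 2 <= 1.
    rewrite divr_ge0 ?sqr_ge0//= ler_pdivrMr// mul1r.
    by apply: lerXn2r; rewrite ?nnegrE//; have := hl; have := m_ge; lra.
  move: h => /andP[h1 h2]; apply/andP; split.
    by apply: mulr_ge0; [rewrite divr_ge0|exact: ltW].
  by apply: ler_piMl; [exact: ltW|lra].
move: da => /andP[da0 da1].
set a2 := 1 - m ^+ 2 / l ^+ 2.
have [hs|hs] := ltP (x ^+ 2) (1 - be - tau).
  have s0 : 0 < turn_gap be x by rewrite /turn_gap; lra.
  have := amplitude_osc x0 s0.
  have hb : tau + `|x ^+ 2 - a2| <= (2 + K) * turn_gap be x.
    rewrite ler0_norm; last by rewrite /a2; lra.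
    have : K * tau <= K * turn_gap be x by rewrite ler_wpM2l// /turn_gap; lra.
    by move: hs s0; rewrite /turn_gap /a2; lra.
  move=> h.
  apply: (@le_trans _ _ (u x ^+ 4 * ((2 + K) * turn_gap be x))); first by rewrite ler_wpM2l.
  rewrite mulrCA; apply: (@le_trans _ _ ((2 + K) * W)).
    by rewrite ler_wpM2l; lra.
  by rewrite ler_wpM2r//; lra.
have hA := amplitude_turn hx01 hs.
have [ht|ht] := leP (x ^+ 2 - turn2) (K' * tau).
  have hb : tau + `|x ^+ 2 - a2| <= (2 + K + K') * tau.
    have : `|x ^+ 2 - a2| <= (1 + K + K') * tau.
      have kt : 0 <= K' * tau by rewrite mulr_ge0//; lra.
      have kt' : 0 <= K * tau by rewrite mulr_ge0//; lra.
      by rewrite ler_norml; apply/andP; split; rewrite /a2; lra.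
    by lra.
  apply: (@le_trans _ _ (u x ^+ 4 * ((2 + K + K') * tau))); first by rewrite ler_wpM2l.
  by rewrite mulrCA ler_wpM2l//; lra.
have hE := amplitude_exp hx01 (ltW ht); rewrite -/W in hE.
have hb : tau + `|x ^+ 2 - a2| <= (1 + K) * tau + (x ^+ 2 - turn2).
  have kt : 0 <= K' * tau by rewrite mulr_ge0//; lra.
  have kt' : 0 <= K * tau by rewrite mulr_ge0//; lra.
  have : `|x ^+ 2 - a2| <= K * tau + (x ^+ 2 - turn2).
    by rewrite ler_norml; apply/andP; split; rewrite /a2; lra.
  by lra.
apply: (@le_trans _ _ (u x ^+ 4 * ((1 + K) * tau + (x ^+ 2 - turn2)))).
  by rewrite ler_wpM2l.
rewrite mulrDr mulrCA.
have : (1 + K) * (u x ^+ 4 * tau) <= (1 + K) * W by rewrite ler_wpM2l//; lra.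
by lra.
Qed.

End Amplitude.

(** * The solutions given by Jacobi polynomials *)

Definition ufun (R : realType) (m : R) (n : nat) (x : R) : R :=
  c_ (m + n%:R + 2^-1) m * (1 - x ^+ 2) `^ (m / 2) * (jacobi m m n).[x].

(** [(1 - x ^ 2) (p ^ (m / 2) P)' = p ^ (m / 2) ((1 - x ^ 2) P' - m x P)]. *)
Definition Upoly (R : realType) (m : R) (n : nat) : {poly R} :=
  (1 - 'X ^+ 2) * (jacobi m m n)^`() - m%:P * 'X * jacobi m m n.

Definition Ufun (R : realType) (m : R) (n : nat) (x : R) : R :=
  c_ (m + n%:R + 2^-1) m * (1 - x ^+ 2) `^ (m / 2) * (Upoly m n).[x].

Section Instance.
Variables (R : realType) (m : R) (n : nat).
Local Notation P := (jacobi m m n).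
Local Notation K := ((-1) ^+ n / (2 ^+ n * (n`!)%:R) : R).

Lemma jacobi_ode (x : R) :
  (1 - x ^+ 2) * P^`()^`().[x] - 2 * (m + 1) * x * P^`().[x]
    + n%:R * (n%:R + 2 * m + 1) * P.[x] = 0.
Proof.
rewrite jacobi_rpoly derivM derivC mul0r add0r derivM derivC mul0r add0r.
rewrite !hornerM !hornerC.
have := rpoly_ode m x n; rewrite /= => h.
by rewrite -[RHS](mulr0 K) -h; ring.
Qed.

Lemma jacobiN (x : R) : P.[- x] = (-1) ^+ n * P.[x].
Proof. by rewrite jacobi_rpoly !hornerM !hornerC horner_rpolyN mulrCA. Qed.

Lemma is_derive_1Bsq (x : R) : is_derive x 1 (fun t : R => 1 - t ^+ 2) (- (2 * x)).
Proof. by apply: (der_congr (der_sub (der_cst x 1) (der_sqr (der_var x)))); ring. Qed.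

Lemma legendre_sol_jacobi : legendre_sol (m + n%:R + 2^-1) m (ufun m n) (Ufun m n).
Proof.
move=> x /andP[x1 x2]; have p0 : 0 < 1 - x ^+ 2 by nra.
have dp := is_derive_1Bsq x.
have dw := der_powR (m / 2) dp p0.
have ew : (1 - x ^+ 2) `^ (m / 2) = (1 - x ^+ 2) `^ (m / 2 - 1) * (1 - x ^+ 2).
  rewrite -{3}(powRr1 (ltW p0)) -powRD ?subrK//.
  by rewrite (gt_eqF p0) implybT.
have dc := der_cst x (c_ (m + n%:R + 2^-1) m).
have dP := is_derive_poly P x.
have dU := is_derive_poly (Upoly m n) x.
have p1 : 1 - x ^+ 2 != 0 by rewrite gt_eqF.
split.
  apply: (der_congr (der_mul (der_mul dc dw) dP)).
  rewrite /Ufun /Upoly !hornerE /= ew.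
  by move: (c_ _ _) (_ `^ (m / 2 - 1)) (P.[x]) (P^`().[x]) => c w a b; field.
apply: (der_congr (der_mul (der_mul dc dw) dU)).
rewrite /ufun /Upoly derivB !derivM !derivC derivB -polyC1 !derivC derivX derivXn.
move: (c_ _ _) => c; rewrite !hornerE /= ew.
have := jacobi_ode x.
move: (_ `^ (m / 2 - 1)) (P.[x]) (P^`().[x]) (P^`()^`().[x]) => w a b e h.
move: (n%:R : R) h => N h.
apply/eqP; rewrite -subr_eq0; apply/eqP.
transitivity (c * w * (1 - x ^+ 2) *
  ((1 - x ^+ 2) * e - 2 * (m + 1) * x * b + N * (N + 2 * m + 1) * a)); last first.
  by rewrite h mulr0.
by field.
Qed.

Lemma poly_bound (q : {poly R}) : exists2 B, 0 < B & forall x, `|x| <= 1 -> `|q.[x]| <= B.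
Proof.
exists (1 + \sum_(i < size q) `|q`_i|).
  by rewrite ltr_wpDr// sumr_ge0.
move=> x x1; rewrite horner_coef; apply: (le_trans (ler_norm_sum _ _ _)).
apply: (@le_trans _ _ (\sum_(i < size q) `|q`_i|)); last by rewrite lerDr.
apply: ler_sum => i _; rewrite normrM normrX ler_piMr// exprn_ile1//.
Qed.

Lemma vanish_powR_poly (c : R) (q : {poly R}) : 0 < m ->
  vanish_at1 (fun x => c * (1 - x ^+ 2) `^ (m / 2) * q.[x]).
Proof.
move=> m0 e e0; have [B B0 hB] := poly_bound q.
pose del := e / ((`|c| + 1) * B).
have c0 : 0 < `|c| + 1 by rewrite ltr_wpDl.
have del0 : 0 < del by rewrite divr_gt0// mulr_gt0.
have w0 : 0 < del `^ (2 / m) by rewrite powR_gt0.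
exists (Num.max 0 (1 - del `^ (2 / m) / 2)).
  by rewrite gt_max ltr01 ltrBlDr ltrDl divr_gt0.
move=> x /andP[]; rewrite gt_max => /andP[x0 hx] x1.
have p0 : 0 <= 1 - x ^+ 2 by nra.
have hp : 1 - x ^+ 2 <= del `^ (2 / m) by nra.
have hw : (1 - x ^+ 2) `^ (m / 2) <= del.
  have -> : del = (del `^ (2 / m)) `^ (m / 2).
    rewrite -powRrM (_ : 2 / m * (m / 2) = 1) ?powRr1 ?ltW//.
    by field; rewrite gt_eqF.
  by apply: ge0_ler_powR; rewrite ?nnegrE// ?ltW// divr_gt0.
rewrite !normrM [`|_ `^ _|]ger0_norm ?powR_ge0//.
have -> : e = (`|c| + 1) * del * B by rewrite /del; field; rewrite !gt_eqF.
apply: ler_pM; rewrite ?mulr_ge0 ?powR_ge0//.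
  by apply: ler_pM; rewrite ?powR_ge0 ?lerDl.
by apply: hB; rewrite ger0_norm ltW.
Qed.

(** [P ^ 2 + (1 - x ^ 2) P' ^ 2 / (n (n + 2 m + 1))] has the derivative
    [2 (2 m + 1) x P' ^ 2 / (n (n + 2 m + 1))], so it increases with [|x|]. *)
Lemma jacobi_le1 (x : R) : 0 <= m -> -1 <= x <= 1 -> P.[x] ^+ 2 <= P.[1] ^+ 2.
Proof.
move=> m0.
suff main (y : R) : 0 <= y <= 1 -> P.[y] ^+ 2 <= P.[1] ^+ 2.
  move=> /andP[x1 x2]; have [x0|x0] := leP 0 x; first by apply: main; rewrite x0.
  have -> : P.[x] ^+ 2 = P.[- x] ^+ 2.
    by rewrite jacobiN exprMn -exprM mulnC exprM sqrrN !expr1n mul1r.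
  by apply: main; apply/andP; split; lra.
move=> /andP[y0 y1].
pose N : R := n%:R * (n%:R + 2 * m + 1).
have N0 : 0 <= N by rewrite mulr_ge0// !addr_ge0// mulr_ge0.
have hd (t : R) : is_derive t 1 (fun t => - (N * P.[t] ^+ 2 + (1 - t ^+ 2) * P^`().[t] ^+ 2))
   (- (2 * (2 * m + 1) * t * P^`().[t] ^+ 2)).
  have dP := is_derive_poly P t.
  have dP' := is_derive_poly P^`() t.
  apply: (der_congr (der_opp (der_add (der_mul (der_cst t N) (der_sqr dP))
    (der_mul (is_derive_1Bsq t) (der_sqr dP'))))).
  have := jacobi_ode t; rewrite -/N => h; apply/eqP; rewrite -subr_eq0; apply/eqP.
  transitivity (- 2 * P^`().[t] *
    ((1 - t ^+ 2) * P^`()^`().[t] - 2 * (m + 1) * t * P^`().[t] + N * P.[t])).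
    ring.
  by rewrite h mulr0.
have := derive_le0_nincr y1 (fun t _ => hd t).
rewrite expr1n subrr mul0r addr0 lerN2 => /(_ _) h.
have h1 : N * P.[y] ^+ 2 + (1 - y ^+ 2) * P^`().[y] ^+ 2 <= N * P.[1] ^+ 2.
  apply: h => t /andP[yt t1]; rewrite oppr_le0 mulr_ge0 ?sqr_ge0// mulr_ge0//; lra.
have [n0|n0] := posnP n.
  by rewrite n0 !jacobi_rpoly /= !hornerE.
have Np : 0 < N by rewrite mulr_gt0 ?ltr0n// ltr_wpDl// addr_ge0// mulr_ge0.
rewrite -(ler_pM2l Np); apply: le_trans h1; rewrite lerDl mulr_ge0 ?sqr_ge0//; nra.
Qed.

End Instance.

(** * Normalization and values at the pole and at the equator *)

Lemma Gamma_nat (R : realType) (n : nat) : Gamma (n%:R + 1) = (n`!)%:R :> R.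
Proof.
elim: n => [|n IH]; first by rewrite add0r Gamma1.
rewrite GammaS; last by rewrite -natr1 lerDr.
by rewrite -natr1 IH factS natrM -natr1.
Qed.

(** Pairing the factors symmetrically about the middle one. *)
Lemma Gamma_ratio_le (R : realType) (N : nat) (x : R) : 0 <= x ->
  Gamma (x + 1 + N%:R) <= (x + (N%:R + 1) / 2) ^+ N * Gamma (x + 1).
Proof.
have [k] := ubnP N; elim: k N x => // k IH [|[|N]] x.
- by rewrite addr0 expr0 mul1r.
- move=> _ x0; rewrite (@GammaS _ (x + 1)); last by lra.
  by rewrite expr1 [(1 + 1) / 2]divff.
rewrite ltnS => hk x0.
have x1 : 0 <= x + 1 by lra.
have := IH N (x + 1) (ltnW hk) x1.
have -> : x + 1 + N.+2%:R = (x + 1 + 1 + N%:R) + 1 by rewrite -!natr1; ring.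
rewrite (@GammaS _ (x + 1 + 1 + N%:R)); last by have : 0 <= N%:R :> R by []; lra.
have -> : x + (N.+2%:R + 1) / 2 = x + 1 + (N%:R + 1) / 2 by rewrite -!natr1; field.
set w := x + 1 + (N%:R + 1) / 2 => h.
rewrite (@GammaS _ (x + 1)) in h; last by lra.
have N0 : 0 <= N%:R :> R by [].
have G0 : 0 < Gamma (x + 1) by apply: Gamma_gt0; lra.
have w0 : 0 <= w ^+ N by apply: exprn_ge0; rewrite /w; lra.
apply: (@le_trans _ _ ((x + 1 + 1 + N%:R) * (w ^+ N * ((x + 1) * Gamma (x + 1))))).
  by apply: ler_wpM2l h; lra.
have -> : (x + 1 + 1 + N%:R) * (w ^+ N * ((x + 1) * Gamma (x + 1))) =
  (x + 1 + 1 + N%:R) * (x + 1) * (w ^+ N * Gamma (x + 1)) by ring.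
have -> : w ^+ N.+2 * Gamma (x + 1) = w ^+ 2 * (w ^+ N * Gamma (x + 1)).
  by rewrite 2!exprS; ring.
apply: ler_wpM2r; first by rewrite mulr_ge0// ltW.
rewrite /w; have := sqr_ge0 ((N%:R + 1) / 2 : R).
move: (N%:R : R) N0 => y y0 h2.
have -> : (x + 1 + (y + 1) / 2) ^+ 2 = (x + 1) ^+ 2 + (x + 1) * (y + 1) + ((y + 1) / 2) ^+ 2.
  by field.
have -> : (x + 1 + 1 + y) * (x + 1) = (x + 1) ^+ 2 + (x + 1) * (y + 1) by ring.
by lra.
Qed.

Section Normalization.
Variables (R : realType) (m : R) (n : nat).
Hypothesis m0 : 0 <= m.
Local Notation l := (m + n%:R + 2^-1).
Local Notation P := (jacobi m m n).

Lemma c_sq : c_ l m ^+ 2 = l * n`!%:R * Gamma (2 * m + n%:R + 1)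
  / ((2 `^ m) ^+ 2 * Gamma (m + n%:R + 1) ^+ 2).
Proof.
have n0 : 0 <= n%:R :> R by [].
have e1 : l - m + 2^-1 = n%:R + 1 by field.
have e2 : l + m + 2^-1 = 2 * m + n%:R + 1 by field.
have e3 : l + 2^-1 = m + n%:R + 1 by field.
rewrite /c_ e1 e2 e3 Gamma_nat expr_div_n exprMn sqr_sqrtr//.
rewrite !mulr_ge0// ?ltW ?Gamma_gt0//; have := m0; lra.
Qed.

Lemma jacobi1_sq : P.[1] ^+ 2 * (n`!%:R * Gamma (m + 1)) ^+ 2 = Gamma (m + n%:R + 1) ^+ 2.
Proof.
have hprod k : \prod_(i < k) (m + k%:R - i%:R) * Gamma (m + 1) = Gamma (m + k%:R + 1).
  elim: k => [|k IH]; first by rewrite big_ord0 mul1r addr0.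
  rewrite big_ord_recl subr0 -natr1 addrA [RHS]GammaS; last first.
    by have := m0; have : 0 <= k%:R :> R by []; lra.
  rewrite -IH -mulrA; congr (_ * (_ * _)).
  by apply: eq_bigr => i _; rewrite /= /bump /= add1n -natr1; ring.
rewrite -hprod jacobi_rpoly hornerM hornerC horner_rpoly1.
have -> : \prod_(i < n) (2 * (i%:R - (m + n%:R))) =
    (-1) ^+ n * 2 ^+ n * \prod_(i < n) (m + n%:R - i%:R) :> R.
  move: (m + n%:R); elim: n => [|k IH] A; first by rewrite !big_ord0 !expr0 !mulr1.
  by rewrite !big_ord_recr /= IH !exprS; ring.
have e1 : ((-1) ^+ n) ^+ 2 = 1 :> R by rewrite -exprM mulnC exprM sqrrN !expr1n.
have f0 : n`!%:R != 0 :> R by rewrite gt_eqF// ltr0n fact_gt0.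
have t0 : 2 ^+ n != 0 :> R by rewrite gt_eqF// exprn_gt0.
move: ((-1) ^+ n) (2 ^+ n) (n`!%:R) e1 f0 t0 => s t f e1 f0 t0.
transitivity ((s ^+ 2) ^+ 2 * (\prod_(i < n) (m + n%:R - i%:R) * Gamma (m + 1)) ^+ 2).
  by field; rewrite f0 t0.
by rewrite e1 expr1n mul1r.
Qed.

(** The value at the pole is [l * Gamma (2 m + n + 1) / n!], up to the explicit
    denominator, and [l = n + (2 m + 1) / 2] is the middle factor in
    [Gamma_ratio_le]. *)
Lemma c_jacobi1_le (N : nat) : 2 * m = N%:R ->
  (c_ l m * P.[1]) ^+ 2 * ((2 `^ m) ^+ 2 * Gamma (m + 1) ^+ 2) <= l * l ^+ N.
Proof.
move=> hN; have n0 : 0 <= n%:R :> R by [].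
have f0 : 0 < n`!%:R :> R by rewrite ltr0n fact_gt0.
have G1 : 0 < Gamma (m + 1) by apply: Gamma_gt0; have := m0; lra.
have G2 : 0 < Gamma (m + n%:R + 1) by apply: Gamma_gt0; have := m0; lra.
have t0 : 0 < 2 `^ m :> R by rewrite powR_gt0.
have := @Gamma_ratio_le R N n%:R n0; rewrite Gamma_nat => h.
have eP : P.[1] ^+ 2 = Gamma (m + n%:R + 1) ^+ 2 / (n`!%:R * Gamma (m + 1)) ^+ 2.
  rewrite -jacobi1_sq mulfK//; apply: expf_neq0.
  by apply: mulf_neq0; apply: lt0r_neq0.
rewrite exprMn c_sq eP.
have -> : l * n`!%:R * Gamma (2 * m + n%:R + 1) / ((2 `^ m) ^+ 2 * Gamma (m + n%:R + 1) ^+ 2) *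
  (Gamma (m + n%:R + 1) ^+ 2 / (n`!%:R * Gamma (m + 1)) ^+ 2) *
  ((2 `^ m) ^+ 2 * Gamma (m + 1) ^+ 2) = l * (Gamma (2 * m + n%:R + 1) / n`!%:R).
  move: (Gamma (m + 1)) (Gamma (m + n%:R + 1)) (Gamma (2 * m + n%:R + 1)) G1 G2.
  move: (2 `^ m) (n`!%:R : R) t0 f0 => t f t0 f0 g1 g2 g3 /lt0r_neq0 g10 /lt0r_neq0 g20.
  by field; rewrite g10 g20 !gt_eqF.
apply: ler_wpM2l; first by have := m0; lra.
rewrite ler_pdivrMr// (_ : 2 * m + n%:R + 1 = n%:R + 1 + N%:R); last by rewrite hN; ring.
by rewrite (_ : l = n%:R + (N%:R + 1) / 2)// -hN; field.
Qed.

End Normalization.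

(** With [a = l - 1/2] fixed, [rsq0 a n * l / (2 ^ a * Gamma (a + 1)) ^ 2] is
    [u (0) ^ 2] for [m = a - n]. *)
Definition rsq0 (R : realType) (a : R) (n : nat) : R :=
  (rpoly a n).[0] ^+ 2 * Gamma (2 * a + 1 - n%:R) / n`!%:R.

Lemma rpoly_odd0 (R : realType) (a : R) (n : nat) : odd n -> (rpoly a n).[0] = 0.
Proof.
move=> on; have := horner_rpolyN a 0 n; rewrite oppr0 -signr_odd on expr1 => h.
by lra.
Qed.

(** The weights are chosen so that, with [N = n] and [M = 2 a - n], the factors
    [(N + 1) (N + 3) / (N + 2) ^ 2] and [M ^ 2 (M - 3/2) / ((M - 1) ^ 2 (M + 1/2))]
    are both at most 1. *)
Lemma rsq0_step (R : realType) (a : R) (n : nat) : n.+2%:R <= a ->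
  rsq0 a n.+2 ^+ 2 * (n.+3%:R * (2 * a - n.+2%:R + 2^-1)) <=
  rsq0 a n ^+ 2 * (n.+1%:R * (2 * a - n%:R + 2^-1)).
Proof.
move=> ha; have n0 : 0 <= n%:R :> R by [].
rewrite -!natr1 in ha.
have e : rsq0 a n.+2 = rsq0 a n * ((n%:R + 1) * (2 * a - n%:R) / ((n%:R + 2) * (2 * a - n%:R - 1))).
  rewrite /rsq0 horner_rpolySS mulr0 mul0r sub0r expr0n subr0 mulr1.
  have -> : 2 * a + 1 - n%:R = 2 * a + 1 - n.+2%:R + 1 + 1 by rewrite -!natr1; ring.
  rewrite GammaS; last by rewrite -!natr1; lra.
  rewrite GammaS; last by rewrite -!natr1; lra.
  rewrite !factS !natrM /rcoef -!natr1.
  have f0 : n`!%:R != 0 :> R by rewrite gt_eqF// ltr0n fact_gt0.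
  field; rewrite f0 !gt_eqF//; lra.
rewrite e exprMn -[leLHS]mulrA; apply: ler_wpM2l; first exact: sqr_ge0.
have -> : n.+3%:R = n%:R + 3 :> R by rewrite -natrD addn3.
have -> : n.+2%:R = n%:R + 2 :> R by rewrite -natrD addn2.
have -> : n.+1%:R = n%:R + 1 :> R by rewrite natr1.
move: (n%:R : R) n0 ha => N N0 ha.
set M := 2 * a - N; have hM : N + 4 <= M by rewrite /M; lra.
have -> : 2 * a - (N + 2) + 2^-1 = M - 3 / 2 by rewrite /M; field.
have -> : ((N + 1) * M / ((N + 2) * (M - 1))) ^+ 2 * ((N + 3) * (M - 3 / 2)) =
  ((N + 1) ^+ 2 * (N + 3) / (N + 2) ^+ 2) * (M ^+ 2 * (M - 3 / 2) / (M - 1) ^+ 2).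
  by field; rewrite !gt_eqF//; lra.
apply: ler_pM.
- by rewrite divr_ge0 ?sqr_ge0// mulr_ge0 ?sqr_ge0//; lra.
- by rewrite divr_ge0 ?sqr_ge0// mulr_ge0 ?sqr_ge0//; lra.
- rewrite ler_pdivrMr; last by rewrite exprn_gt0//; lra.
  have -> : (N + 1) ^+ 2 * (N + 3) = (N + 1) * ((N + 1) * (N + 3)) by ring.
  by rewrite ler_wpM2l; nra.
- rewrite ler_pdivrMr; last by rewrite exprn_gt0//; lra.
  by nra.
Qed.

Lemma rsq0_le (R : realType) (a : R) (k : nat) : (k.*2)%:R <= a ->
  rsq0 a k.*2 ^+ 2 * ((k.*2).+1%:R * (2 * a - (k.*2)%:R + 2^-1)) <=
  Gamma (2 * a + 1) ^+ 2 * (2 * a + 1).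
Proof.
elim: k => [|k IH] ha.
  have -> : rsq0 a 0.*2 = Gamma (2 * a + 1).
    have e0 : (rpoly a 0).[0] = 1 by rewrite /= hornerE.
    by rewrite double0 /rsq0 e0 expr1n subr0 mul1r divr1.
  by rewrite double0 subr0 mul1r; apply: ler_wpM2l; [exact: sqr_ge0|lra].
rewrite doubleS in ha *.
have ha2 : (k.*2)%:R <= a by apply: le_trans ha; rewrite ler_nat -addn2 leq_addr.
exact: le_trans (rsq0_step ha) (IH ha2).
Qed.

(** [l * wallis a] is [u (0) ^ 2] for [n = 0], where [m = a].  It satisfies the
    recursion of the Wallis quotients. *)
Definition wallis (R : realType) (a : R) : R :=
  Gamma (2 * a + 1) / (2 `^ a * Gamma (a + 1)) ^+ 2.

Lemma wallis_step (R : realType) (a : R) : 0 <= a ->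
  wallis (a + 1) ^+ 2 * (2 * (a + 1) + 1) <= wallis a ^+ 2 * (2 * a + 1).
Proof.
move=> a0.
have G1 : 0 < Gamma (a + 1) by apply: Gamma_gt0; lra.
have t0 : 0 < 2 `^ a :> R by rewrite powR_gt0.
have -> : wallis (a + 1) = wallis a * ((a + 2^-1) / (a + 1)).
  rewrite /wallis.
  have -> : 2 * (a + 1) + 1 = 2 * a + 1 + 1 + 1 by ring.
  rewrite (@GammaS _ (2 * a + 1 + 1)); last by lra.
  rewrite (@GammaS _ (2 * a + 1)); last by lra.
  rewrite (@GammaS _ (a + 1)); last by lra.
  rewrite powRD; last by rewrite pnatr_eq0 implybT.
  rewrite powRr1//; field.
  by rewrite !gt_eqF//; lra.
rewrite exprMn -[leLHS]mulrA; apply: ler_wpM2l; first exact: sqr_ge0.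
have -> : ((a + 2^-1) / (a + 1)) ^+ 2 * (2 * (a + 1) + 1) =
   ((2 * a + 1) ^+ 2 * (2 * a + 3) / 4) / (a + 1) ^+ 2.
  by field; rewrite gt_eqF//; lra.
by rewrite ler_pdivrMr ?exprn_gt0; nra.
Qed.

Lemma wallis_le (R : realType) (a : R) (k : nat) : 0 <= a ->
  wallis (a + k%:R) ^+ 2 * (2 * (a + k%:R) + 1) <= wallis a ^+ 2 * (2 * a + 1).
Proof.
move=> a0; elim: k => [|k IH]; first by rewrite addr0.
rewrite -natr1 addrA; apply: le_trans IH; apply: wallis_step.
by rewrite addr_ge0.
Qed.

Section SoninAt0.
Variables (R : realType) (mu : R) (i n : nat) (be : R).
Hypothesis mu0 : 0 <= mu.
Local Notation m := (mu + i%:R).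
Local Notation a := (m + n%:R).
Local Notation l := (m + n%:R + 2^-1).
Local Notation den := ((2 `^ a * Gamma (a + 1)) ^+ 2).
Local Notation C := (wallis mu ^+ 2 * (2 * mu + 1)).

Let m0 : 0 <= m. Proof. by rewrite addr_ge0. Qed.

Let den_gt0 : 0 < den.
Proof.
rewrite exprn_gt0// mulr_gt0 ?powR_gt0// Gamma_gt0// lerDr addr_ge0//; exact: m0.
Qed.

Let sqrM3 (x y z : R) : (x * (y * z)) ^+ 2 = x ^+ 2 * y ^+ 2 * z ^+ 2.
Proof. ring. Qed.

Let ufun0 : ufun m n 0 = c_ l m * (jacobi m m n).[0].
Proof. by rewrite /ufun expr0n subr0 powR1 mulr1. Qed.

Let Ufun0 : Ufun m n 0 = c_ l m * (jacobi m m n)^`().[0].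
Proof.
by rewrite /Ufun expr0n subr0 powR1 mulr1 /Upoly; congr (_ * _); rewrite !hornerE /=; ring.
Qed.

Let coef_sq : c_ l m ^+ 2 * ((-1) ^+ n / (2 ^+ n * n`!%:R)) ^+ 2 =
  l * Gamma (2 * a + 1 - n%:R) / n`!%:R / den.
Proof.
rewrite c_sq//.
have e1 : ((-1) ^+ n) ^+ 2 = 1 :> R by rewrite -exprM mulnC exprM sqrrN !expr1n.
have -> : 2 * a + 1 - n%:R = 2 * m + n%:R + 1 by ring.
rewrite (_ : 2 `^ a = 2 `^ m * 2 ^+ n); last first.
  by rewrite powRD ?powR_mulrn// pnatr_eq0 implybT.
have f0 : n`!%:R != 0 :> R by rewrite gt_eqF// ltr0n fact_gt0.
have t0 : 2 ^+ n != 0 :> R by rewrite gt_eqF// exprn_gt0.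
have t1 : 2 `^ m != 0 :> R by rewrite gt_eqF// powR_gt0.
have G1 : Gamma (a + 1) != 0.
  by rewrite gt_eqF// Gamma_gt0// lerDr addr_ge0//; exact: m0.
rewrite exprMn e1.
move: (2 `^ m) t1 (2 ^+ n) t0 (Gamma (a + 1)) G1 (n`!%:R) f0 => w w0 v v0 g g0 f f0.
by field; rewrite w0 v0 g0 f0.
Qed.

Let rsq0_den_le (k : nat) : (k.*2)%:R <= a ->
  (rsq0 a k.*2 / den) ^+ 2 * ((k.*2).+1%:R * (2 * a - (k.*2)%:R + 2^-1)) <= C.
Proof.
move=> ka; have := wallis_le (i + n) mu0; rewrite natrD addrA.
apply: le_trans; have h := rsq0_le ka.
have -> : wallis a ^+ 2 * (2 * a + 1) = Gamma (2 * a + 1) ^+ 2 * (2 * a + 1) / den ^+ 2.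
  by rewrite /wallis expr_div_n mulrAC.
by rewrite expr_div_n mulrAC ler_wpM2r// invr_ge0 sqr_ge0.
Qed.

Hypothesis hl : 1 <= l.
Hypothesis hbe : 0 < be < 1.
Hypothesis hm : be * (l ^+ 2 - 4^-1) = m ^+ 2 + 2^-1.

(** For even [n] the derivative vanishes at 0 and for odd [n] the value does.  In
    the second case the derivative reduces to the value at 0 of the neighbour
    of degree [n - 1] with the same [a]. *)
Lemma sonin_at0_le : (1 - be) * sonin l be (ufun m n) (Ufun m n) 0 ^+ 2 <= 2 * C.
Proof.
move: (hbe) (hl) m0 => /andP[b0 b1] l1 m_ge0.
have n0 : 0 <= n%:R :> R by [].
have C0 : 0 <= C by rewrite mulr_ge0 ?sqr_ge0//; have := mu0; lra.
have lam0 : 0 < l ^+ 2 - 4^-1 by nra.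
have eD : (1 - be) * (l ^+ 2 - 4^-1) = l ^+ 2 - m ^+ 2 - 3 / 4.
  by rewrite mulrBl hm; field.
have es : turn_gap be 0 = 1 - be by rewrite /turn_gap expr0n subr0.
have eZ : sonin_flux be (ufun m n) (Ufun m n) 0 = Ufun m n 0 by rewrite /sonin_flux !mul0r subr0.
rewrite /sonin es eZ.
have [on|en] := boolP (odd n).
- have eu : ufun m n 0 = 0.
    by rewrite ufun0 jacobi_rpoly hornerM rpoly_odd0// mulr0 mulr0.
  rewrite eu expr0n add0r.
  have [k ek] : exists k, n = k.*2.+1.
    by exists n./2; rewrite -[LHS]odd_double_half on.
  pose g := rcoef a n.
  have eg : g = n%:R * (2 * a + 1 - n%:R) by [].
  have g0 : 0 <= g by rewrite eg mulr_ge0//; lra.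
  have nS : n%:R = (k.*2)%:R + 1 :> R by rewrite ek -natr1.
  have eU : Ufun m n 0 ^+ 2 = l * g * (rsq0 a k.*2 / den).
    rewrite Ufun0 jacobi_rpoly derivM derivC mul0r add0r hornerM hornerC.
    rewrite [in rpoly a n]ek deriv_rpoly -ek hornerM hornerC -/g.
    rewrite sqrM3 coef_sq /rsq0.
    have -> : 2 * a + 1 - (k.*2)%:R = 2 * a + 1 - n%:R + 1 by rewrite nS; ring.
    rewrite (@GammaS _ (2 * a + 1 - n%:R)); last by lra.
    rewrite ek factS natrM -ek eg.
    have f0 : (k.*2)`!%:R != 0 :> R by rewrite gt_eqF// ltr0n fact_gt0.
    have n1 : n%:R != 0 :> R by rewrite ek pnatr_eq0.
    by move: den (lt0r_neq0 den_gt0) => D D0; field; rewrite f0 n1 D0.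
  have kle : (k.*2)%:R <= a by lra.
  have hr := rsq0_den_le kle; set w := rsq0 _ _ / den in eU hr.
  have hM : l ^+ 2 * (1 - be) <= sonin_coef l be (1 - be).
    have hb : 0 < 1 - be <= 1 - be by rewrite lexx andbT; lra.
    by have := sonin_coef_ge l hbe hb; lra.
  have M0 : 0 < l ^+ 2 * (1 - be) by rewrite mulr_gt0 ?exprn_gt0//; lra.
  apply: (@le_trans _ _ ((1 - be) * (Ufun m n 0 ^+ 2 / (l ^+ 2 * (1 - be))) ^+ 2)).
    apply: ler_wpM2l; first by lra.
    apply: lerXn2r; rewrite ?nnegrE ?divr_ge0 ?sqr_ge0//; try lra.
    by apply: ler_wpM2l; rewrite ?sqr_ge0// lef_pV2 ?posrE//; lra.
  rewrite eU.
  have -> : (1 - be) * (l * g * w / (l ^+ 2 * (1 - be))) ^+ 2 =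
     g * (w ^+ 2 * g) / (l ^+ 2 * (1 - be)).
    by field; rewrite !gt_eqF//; lra.
  have hwg : w ^+ 2 * g <= C.
    apply: le_trans hr; apply: ler_wpM2l; first exact: sqr_ge0.
    have en1 : (k.*2).+1%:R = n%:R :> R by rewrite -ek.
    by rewrite eg en1; apply: ler_wpM2l => //; lra.
  rewrite ler_pdivrMr//; apply: (@le_trans _ _ (g * C)); first by rewrite ler_wpM2l.
  have -> : 2 * C * (l ^+ 2 * (1 - be)) = 2 * (l ^+ 2 * (1 - be)) * C by ring.
  apply: ler_wpM2r => //.
  have n1 : 1 <= n%:R :> R by rewrite ek ler1n.
  have -> : 2 * (l ^+ 2 * (1 - be)) = 2 * ((1 - be) * (l ^+ 2 - 4^-1)) + (1 - be) / 2 by field.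
  rewrite eD eg; have : 0 <= m * n%:R by rewrite mulr_ge0.
  by nra.
have ek : n = n./2.*2 by rewrite -[LHS]odd_double_half (negbTE en).
have eU : Ufun m n 0 = 0.
  rewrite Ufun0 jacobi_rpoly derivM derivC mul0r add0r hornerM hornerC.
  case: (n) en => [|k] ok; first by rewrite /= -polyC1 derivC hornerC !mulr0.
  by rewrite deriv_rpoly hornerM [(rpoly _ _).[0]]rpoly_odd0 ?mulr0//; move: ok; rewrite /= negbK.
rewrite eU expr0n mul0r addr0.
have eu : ufun m n 0 ^+ 2 = l * (rsq0 a n / den).
  rewrite ufun0 jacobi_rpoly hornerM hornerC sqrM3 coef_sq /rsq0.
  have f0 : n`!%:R != 0 :> R by rewrite gt_eqF// ltr0n fact_gt0.
  by move: den (lt0r_neq0 den_gt0) => D D0; field; rewrite f0 D0.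
have kle : (n./2.*2)%:R <= a by rewrite -ek; lra.
have := rsq0_den_le kle; rewrite -ek.
rewrite eu; set w := rsq0 _ _ / den => hw.
have h1 : l ^+ 2 - m ^+ 2 <= n.+1%:R * (2 * a - n%:R + 2^-1).
  have -> : n.+1%:R = n%:R + 1 :> R by rewrite natr1.
  by move: (n%:R : R) n0 (mu + i%:R) m_ge0 => y y0 z z0; lra.
rewrite -(ler_pM2r lam0).
have -> : (1 - be) * (l * w) ^+ 2 * (l ^+ 2 - 4^-1) =
   l ^+ 2 * (w ^+ 2 * ((1 - be) * (l ^+ 2 - 4^-1))) by ring.
rewrite eD.
have h2 : w ^+ 2 * (l ^+ 2 - m ^+ 2 - 3 / 4) <= C.
  by apply: le_trans hw; apply: ler_wpM2l; [exact: sqr_ge0|lra].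
apply: (@le_trans _ _ (l ^+ 2 * C)); first by rewrite ler_wpM2l ?sqr_ge0.
have -> : 2 * C * (l ^+ 2 - 4^-1) = 2 * (l ^+ 2 - 4^-1) * C by ring.
by apply: ler_wpM2r => //; nra.
Qed.

End SoninAt0.

(** * Uniform amplitude of the normalized solutions *)

Lemma ufunN (R : realType) (m : R) (n : nat) (x : R) : ufun m n (- x) ^+ 4 = ufun m n x ^+ 4.
Proof.
rewrite /ufun jacobiN sqrrN; set c := c_ _ _ * _.
by rewrite mulrCA exprMn -exprM mulnC exprM (_ : (-1) ^+ 4 = 1) ?expr1n ?mul1r //; ring.
Qed.

Lemma order_lt_half (R : realType) (d i : nat) : (2 <= d)%N ->
  (d%:R - 2) / 2 + i%:R < 2^-1 :> R -> (d%:R - 2) / 2 = 0 :> R /\ i = 0%N.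
Proof.
move=> hd h.
have e : ((d%:R - 2) / 2 + i%:R) * 2 = (d - 2 + 2 * i)%:R :> R.
  by rewrite natrD natrB// natrM; field.
have : (d - 2 + 2 * i)%:R < 1 :> R by rewrite -e; lra.
rewrite -[1]/(1%:R) ltr_nat ltnS leqn0 addn_eq0 muln_eq0 /= => /andP[/eqP h1 /eqP h2]; split => //.
by rewrite -(natrB R hd) h1 mul0r.
Qed.

(** The width of the turning region: the cube root of
    [(1 - be) be ^ 2 / l ^ 2], scaled by [k / 8] so as not to exceed
    [be (1 - be) / 2]. *)
Lemma airy_scale (R : realType) (l be k q sg : R) : 0 < k <= 1 -> 0 < q <= 1 ->
  1 <= l -> 0 < be < 1 -> k <= l ^+ 2 * be * (1 - be) ^+ 2 ->
  (l ^+ 2)^-1 <= sg -> q * (l ^+ 2 * sg ^+ 3) <= (1 - be) * be ^+ 2 ->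
  exists2 tau : R, 0 < tau & [/\ 2 * tau <= be * (1 - be),
    l ^+ 2 * tau ^+ 3 = k / 8 * (1 - be) * be ^+ 2,
    k / 8 * q * sg <= tau & 1 <= 2 / (k / 8 * q) * (l ^+ 2 - 4^-1) * tau].
Proof.
move=> /andP[k0 k1] /andP[q0 q1] l1 /andP[be0 be1] hk hsg hq.
set th := k / 8.
have th0 : 0 < th by rewrite divr_gt0.
have th1 : th <= 1 by rewrite /th; lra.
have tq0 : 0 < th * q by rewrite mulr_gt0.
have tq1 : th * q <= 1 by apply: mulr_ile1 => //; exact: ltW.
have l2 : 1 <= l ^+ 2 by rewrite exprn_ege1.
have l20 : 0 < l ^+ 2 by lra.
have D0 : 0 < 1 - be by rewrite subr_gt0.
have sg0 : 0 < sg by apply: lt_le_trans hsg; rewrite invr_gt0.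
have w0 : 0 < th * (1 - be) * be ^+ 2 / l ^+ 2.
  by rewrite divr_gt0// mulr_gt0 ?exprn_gt0// mulr_gt0.
pose tau := (th * (1 - be) * be ^+ 2 / l ^+ 2) `^ 3^-1.
have tau0 : 0 < tau by rewrite powR_gt0.
have tau3 : tau ^+ 3 = th * (1 - be) * be ^+ 2 / l ^+ 2.
  have e3 : 3^-1 * 3%:R = 1 :> R by rewrite mulVf.
  by rewrite -powR_mulrn ?(ltW tau0)// /tau -powRrM e3 powRr1// ltW.
clearbody tau.
have tau_cube : l ^+ 2 * tau ^+ 3 = th * (1 - be) * be ^+ 2.
  by rewrite tau3 mulrC divfK// gt_eqF.
have tau_sg : th * q * sg <= tau.
  have a0 : 0 <= th * q * sg by apply: mulr_ge0; apply: ltW.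
  rewrite -(@ler_pXn2r _ 3)// ?nnegrE ?(ltW tau0)//.
  rewrite -(ler_pM2l l20) tau_cube.
  have -> : l ^+ 2 * (th * q * sg) ^+ 3 = (th * q) ^+ 2 * (th * (q * (l ^+ 2 * sg ^+ 3))) by ring.
  apply: (@le_trans _ _ (1 * (th * ((1 - be) * be ^+ 2)))); last by rewrite mul1r mulrA.
  apply: ler_pM; rewrite ?sqr_ge0//.
  - have s3 : 0 <= l ^+ 2 * sg ^+ 3 by rewrite mulr_ge0 ?sqr_ge0// exprn_ge0// ltW.
    by apply: mulr_ge0; [exact: ltW|apply: mulr_ge0 => //; exact: ltW].
  - by rewrite exprn_ile1// ltW.
  - by apply: ler_wpM2l hq; exact: ltW.
exists tau => //; split => //.
  have b0 : 0 <= be * (1 - be) by rewrite mulr_ge0 ?ltW.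
  rewrite -(@ler_pXn2r _ 3)// ?nnegrE ?mulr_ge0 ?(ltW tau0)//.
  rewrite -(ler_pM2l l20) exprMn mulrCA tau_cube /th.
  have -> : 2 ^+ 3 * (k / 8 * (1 - be) * be ^+ 2) = k * ((1 - be) * be ^+ 2) by field.
  have -> : l ^+ 2 * (be * (1 - be)) ^+ 3 =
    (l ^+ 2 * be * (1 - be) ^+ 2) * ((1 - be) * be ^+ 2) by ring.
  by apply: ler_wpM2r hk; rewrite mulr_ge0 ?sqr_ge0// ltW.
have h1 : (th * q) * (l ^+ 2)^-1 <= tau.
  by apply: le_trans tau_sg; apply: ler_wpM2l hsg; exact: ltW.
have h2 : 0 <= 2 / (th * q) * (l ^+ 2 - 4^-1).
  by apply: mulr_ge0; [apply: divr_ge0 => //; exact: ltW|lra].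
apply: le_trans (ler_wpM2l h2 h1).
have -> : 2 / (th * q) * (l ^+ 2 - 4^-1) * (th * q * (l ^+ 2)^-1) = 2 * ((l ^+ 2 - 4^-1) / l ^+ 2).
  move: (th * q) (l ^+ 2) tq0 l20 => a b /lt0r_neq0 a0 /lt0r_neq0 b0.
  by field; rewrite a0 b0.
by rewrite mulrA ler_pdivlMr//; lra.
Qed.

Section AmplitudeUfun.
Variables (R : realType) (d : nat).
Hypothesis hd : (2 <= d)%N.
Local Notation mu := ((d%:R - 2) / 2 : R).

Let mu_ge0 : 0 <= mu.
Proof. by rewrite divr_ge0// subr_ge0 ler_nat. Qed.

Lemma ufun_m0 (n : nat) (x : R) : -1 <= x <= 1 ->
  ufun (0 : R) n x ^+ 4 <= (0 + n%:R + 2^-1) ^+ 2.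
Proof.
move=> hx; rewrite /ufun mul0r powRr0 mulr1.
have h := @c_jacobi1_le R 0 n (lexx 0) 0 (mulr0 2).
rewrite powRr0 expr1n (add0r 1) Gamma1 expr1n !mulr1 in h.
have hP := jacobi_le1 n (lexx 0) hx.
have e : (c_ (0 + n%:R + 2^-1) 0 * (jacobi 0 0 n).[x]) ^+ 2 <= 0 + n%:R + 2^-1.
  apply: le_trans h; rewrite exprMn [leRHS]exprMn.
  by move: (sqr_ge0 (c_ (0 + n%:R + 2^-1) 0 : R)) hP => ? ?; apply: ler_wpM2l.
rewrite (_ : 4%N = (2 * 2)%N)// !exprM; apply: lerXn2r; rewrite ?nnegrE ?sqr_ge0//.
Qed.

(** The scale of [airy_scale] satisfies the hypotheses of [amplitude] and is at
    least a multiple of [sg].  An order below [1/2] is 0, and then the turning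
    point is the pole itself. *)
Lemma ufun_amplitude (k q : R) : 0 < k <= 1 -> 0 < q <= 1 ->
  exists2 C, 0 < C & forall (i n : nat) (sg : R),
  let m := mu + i%:R in let l := m + n%:R + 2^-1 in
  let be := (m ^+ 2 + 2^-1) / (l ^+ 2 - 4^-1) in
  1 <= l -> be < 1 -> k <= l ^+ 2 * be * (1 - be) ^+ 2 ->
  (l ^+ 2)^-1 <= sg -> q * (l ^+ 2 * sg ^+ 3) <= (1 - be) * be ^+ 2 ->
  forall x, -1 <= x <= 1 ->
  ufun m n x ^+ 4 * (sg + `|x ^+ 2 - (1 - m ^+ 2 / l ^+ 2)|) <= C.
Proof.
move=> k01 q01; move: (k01) (q01) => /andP[k0 k1] /andP[q0 q1].
pose th := k / 8.
have th01 : 0 < th <= 1 by apply/andP; split; rewrite /th; lra.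
have /andP[th0 th1] := th01.
pose K := 2 / (th * q).
have tq0 : 0 < th * q by rewrite mulr_gt0.
have tq1 : th * q <= 1 by apply: mulr_ile1 => //; exact: ltW.
have K0 : 0 < K by rewrite divr_gt0.
pose S := 2 * (wallis mu ^+ 2 * (2 * mu + 1)).
have S0 : 0 <= S.
  by rewrite /S mulr_ge0// mulr_ge0 ?sqr_ge0//; have := mu_ge0; lra.
pose C1 := (2 + K + (1 + K) / th) * (airy_cst K ^+ 2 * S).
have C10 : 0 <= C1.
  apply: mulr_ge0; last by rewrite mulr_ge0 ?sqr_ge0.
  by rewrite addr_ge0//; [lra|rewrite divr_ge0//; lra].
pose C2 := (2 + K) * S + 4.
have C20 : 0 < C2 by rewrite ltr_wpDl// mulr_ge0//; lra.
exists ((C1 + C2) / (th * q)); first by rewrite divr_gt0//; lra.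
move=> i n sg m l be l1 be1 hk hsg hq.
have l2 : 1 <= l ^+ 2 by rewrite exprn_ege1.
have lam0 : 0 < l ^+ 2 - 4^-1 by lra.
have hbe : 0 < be < 1.
  by rewrite be1 andbT divr_gt0// ltr_wpDl ?sqr_ge0.
have hm : be * (l ^+ 2 - 4^-1) = m ^+ 2 + 2^-1 by rewrite /be divfK// gt_eqF.
have [tau tau0 [tau_le tau_cube tau_sg tau_ge]] := airy_scale k01 q01 l1 hbe hk hsg hq.
have hS : (1 - be) * sonin l be (ufun m n) (Ufun m n) 0 ^+ 2 <= S.
  exact: sonin_at0_le.
have hsol : legendre_sol l m (ufun m n) (Ufun m n) by exact: legendre_sol_jacobi.
have key x : 0 <= x <= 1 ->
    ufun m n x ^+ 4 * (tau + `|x ^+ 2 - (1 - m ^+ 2 / l ^+ 2)|) <= C1 + C2.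
  move=> /andP[x0 x1].
  have [hm2|hm2] := leP 2^-1 m.
    have mp : 0 < m by apply: lt_le_trans hm2.
    have hml : m <= l by rewrite /l -addrA lerDl addr_ge0.
    move: x1; rewrite le_eqVlt => /predU1P[->|x1].
      have m20 : m / 2 != 0 by rewrite gt_eqF// divr_gt0.
      rewrite /ufun expr1n subrr (powR0 m20) mulr0 mul0r expr0n mul0r.
      by rewrite addr_ge0// ltW.
    apply: (@le_trans _ _ C1); last by rewrite lerDl ltW.
    apply: (@amplitude R l m be tau K th S _ _ hsol l1 hbe hm hS tau0
      tau_le tau_cube th01 tau_ge hm2) => //.
    - exact: vanish_powR_poly.
    - exact: vanish_powR_poly.
    - by rewrite x0.
  have [mu00 i00] := order_lt_half hd hm2.
  have mz : m = 0 by rewrite /m mu00 i00 addr0.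
  have x01 : 0 <= x <= 1 by rewrite x0.
  have x11 : -1 <= x <= 1 by rewrite x1 andbT (le_trans _ x0)// lerN10.
  have hu : ufun m n x ^+ 4 <= l ^+ 2.
    by have := ufun_m0 n x11; rewrite /l mz.
  apply: (@le_trans _ _ C2); last by rewrite lerDr.
  have -> : 1 - m ^+ 2 / l ^+ 2 = 1 by rewrite mz expr0n mul0r subr0.
  exact: (amplitude_order0 hsol l1 hbe hm hS tau0 tau_le tau_ge mz x01 hu).
move=> x /andP[x1 x2].
have hkey : ufun m n x ^+ 4 * (tau + `|x ^+ 2 - (1 - m ^+ 2 / l ^+ 2)|) <= C1 + C2.
  have [x0|/ltW x0] := leP 0 x; first by apply: key; rewrite x0.
  by have := key (- x); rewrite ufunN sqrrN; apply; rewrite oppr_ge0 x0 lerNl.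
rewrite ler_pdivlMr//; apply: le_trans hkey.
rewrite -mulrA; apply: ler_wpM2l; first by rewrite exprn_even_ge0.
by rewrite mulrDl [sg * _]mulrC lerD// ler_piMr.
Qed.

End AmplitudeUfun.

Section Regimes.
Variables (R : realType) (d : nat).
Hypothesis hd : (2 <= d)%N.
Local Notation mu := ((d%:R - 2) / 2 : R).

Let mu_ge0 : 0 <= mu.
Proof. by rewrite divr_ge0// subr_ge0 ler_nat. Qed.

(** For [m >= eps l] the width of the turning region is at least of order [1 / l],
    because [1 - (m / l) ^ 2] is. *)
Lemma ufun_large_m (eps : R) : 0 < eps < 1 ->
  exists2 C, 0 < C & exists L : R, forall (i n : nat),
  let m := mu + i%:R in let l := m + n%:R + 2^-1 in
  L <= l -> eps * l <= m -> forall x, -1 <= x <= 1 ->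
  ufun m n x ^+ 4 * (l^-1 + `|x ^+ 2 - (1 - m ^+ 2 / l ^+ 2)|) <= C.
Proof.
move=> /andP[e0 e1].
(* [k] and [q] come from [eps ^ 2 <= be] and [eps / (2 l) <= 1 - be]. *)
have k01 : 0 < eps ^+ 4 / 4 <= 1.
  rewrite divr_gt0 ?exprn_gt0//= ler_pdivrMr// mul1r.
  by apply: (@le_trans _ _ 1); [apply: exprn_ile1 => //; exact: ltW|rewrite ler1n].
have q01 : 0 < eps ^+ 5 / 2 <= 1.
  rewrite divr_gt0 ?exprn_gt0//= ler_pdivrMr// mul1r.
  by apply: (@le_trans _ _ 1); [apply: exprn_ile1 => //; exact: ltW|rewrite ler1n].
have [C C0 hC] := ufun_amplitude hd k01 q01.
exists C => //; exists (eps^-1 + 1) => i n m l hL hm.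
have i0 : 0 <= i%:R :> R by [].
have n0 : 0 <= n%:R :> R by [].
have el : 1 + eps <= eps * l.
  have := ler_wpM2l (ltW e0) hL; rewrite mulrDr divff ?gt_eqF//; lra.
have m1 : 1 < m by lra.
have l1 : m + 2^-1 <= l by rewrite /l; lra.
have l0 : 0 < l by lra.
have H := hC i n l^-1; rewrite /= -/m -/l in H; clearbody m l.
have lam0 : 0 < l ^+ 2 - 4^-1 by nra.
pose be := (m ^+ 2 + 2^-1) / (l ^+ 2 - 4^-1).
have hbe : be * (l ^+ 2 - 4^-1) = m ^+ 2 + 2^-1 by rewrite /be divfK// gt_eqF.
have be0 : 0 < be by rewrite divr_gt0// ltr_wpDl ?sqr_ge0.
have be1 : be < 1 by rewrite ltr_pdivrMr// mul1r; nra.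
have D0 : 0 < 1 - be by lra.
have hD : eps <= (1 - be) * (2 * l).
  rewrite -(ler_pM2r l0); apply: (@le_trans _ _ ((1 - be) * 2 * (l ^+ 2 - 4^-1))).
    rewrite [_ * 2]mulrC -mulrA mulrBl hbe; nra.
  have -> : (1 - be) * (2 * l) * l = (1 - be) * 2 * l ^+ 2 by ring.
  by apply: ler_wpM2l; [rewrite mulr_ge0// ltW|lra].
have hb : eps ^+ 2 <= be.
  have e2 : eps ^+ 2 * l ^+ 2 <= m ^+ 2.
    have w0 : 0 <= eps * l by rewrite mulr_ge0// ltW.
    by rewrite -exprMn; apply: lerXn2r => //; rewrite nnegrE; lra.
  rewrite -(ler_pM2r lam0) hbe.
  have : 0 <= eps ^+ 2 by rewrite sqr_ge0.
  by lra.
have l2 : 0 < l ^+ 2 by rewrite exprn_gt0.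
apply: H; rewrite -/be//.
- by lra.
- have h1 : (eps / 2) ^+ 2 <= ((1 - be) * l) ^+ 2.
    have w0 : 0 <= (1 - be) * l by rewrite mulr_ge0// ltW.
    by apply: lerXn2r; rewrite ?nnegrE//; lra.
  have -> : l ^+ 2 * be * (1 - be) ^+ 2 = be * ((1 - be) * l) ^+ 2 by ring.
  have -> : eps ^+ 4 / 4 = eps ^+ 2 * (eps / 2) ^+ 2 by field.
  by apply: ler_pM; rewrite ?sqr_ge0.
- by rewrite lef_pV2 ?posrE// expr2 ler_peMl ?(ltW l0)//; lra.
have h1 : eps / (2 * l) <= 1 - be by rewrite ler_pdivrMr// mulr_gt0.
have -> : eps ^+ 5 / 2 * (l ^+ 2 * l^-1 ^+ 3) = eps / (2 * l) * (eps ^+ 2) ^+ 2.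
  by field; rewrite gt_eqF.
apply: ler_pM => //.
- by rewrite divr_ge0 ?mulr_ge0// ltW.
- by rewrite sqr_ge0.
- by apply: lerXn2r; rewrite ?nnegrE ?sqr_ge0// ltW.
Qed.

(** For [m <= eps l] the turning point stays away from the equator, and the width
    of the turning region is of order [(1 + m) ^ (4/3) / l ^ 2]. *)
Lemma ufun_small_m (eps : R) : 0 < eps < 1 ->
  exists2 C, 0 < C & exists L : R, forall (i n : nat),
  let m := mu + i%:R in let l := m + n%:R + 2^-1 in
  L <= l -> m <= eps * l -> forall x, -1 <= x <= 1 ->
  ufun m n x ^+ 4 * (l `^ (- 2) * (1 + m) `^ (4 / 3)
    + `|x ^+ 2 - (1 - m ^+ 2 / l ^+ 2)|) <= C.
Proof.
move=> /andP[e0 e1].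
pose de := (1 - eps) / 2.
have de0 : 0 < de by rewrite /de; lra.
have de1 : de <= 1 by rewrite /de; lra.
(* [k] and [q] come from [de <= 1 - be], [(m ^ 2 + 1/2) / l ^ 2 <= be] and
   [(1 + m) ^ 2 <= 4 (m ^ 2 + 1/2)]. *)
have k01 : 0 < de ^+ 2 / 2 <= 1.
  rewrite divr_gt0 ?exprn_gt0//= ler_pdivrMr// mul1r.
  by apply: (@le_trans _ _ 1); [apply: exprn_ile1 => //; exact: ltW|rewrite ler1n].
have q01 : 0 < de / 16 <= 1 by apply/andP; split; lra.
have [C C0 hC] := ufun_amplitude hd k01 q01.
exists C => //; exists (1 + de^-1) => i n m l hL hm.
have i0 : 0 <= i%:R :> R by [].
have n0 : 0 <= n%:R :> R by [].
have m0 : 0 <= m by rewrite /m; have := mu_ge0; lra.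
have di0 : 0 < de^-1 by rewrite invr_gt0.
have l1 : 1 <= l by lra.
have dl : 1 <= de * l.
  have : de * de^-1 <= de * l by apply: ler_wpM2l; [exact: ltW|lra].
  by rewrite divff// gt_eqF.
have H := hC i n (l `^ (- 2) * (1 + m) `^ (4 / 3)).
rewrite /= -/m -/l in H; clearbody m l.
have l0 : 0 < l by lra.
have l2 : 0 < l ^+ 2 by rewrite exprn_gt0.
have lam0 : 0 < l ^+ 2 - 4^-1 by nra.
pose be := (m ^+ 2 + 2^-1) / (l ^+ 2 - 4^-1).
have hbe : be * (l ^+ 2 - 4^-1) = m ^+ 2 + 2^-1 by rewrite /be divfK// gt_eqF.
have be0 : 0 < be by rewrite divr_gt0// ltr_wpDl ?sqr_ge0.
have hm2 : m ^+ 2 <= eps * l ^+ 2.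
  apply: (@le_trans _ _ ((eps * l) ^+ 2)).
    have w0 : 0 <= eps * l by rewrite mulr_ge0// ltW.
    by apply: lerXn2r; rewrite ?nnegrE.
  by rewrite exprMn; apply: ler_wpM2r; rewrite ?sqr_ge0//; nra.
have dl2 : 1 <= de * l ^+ 2 by nra.
have hD : de <= 1 - be.
  have : de * (l ^+ 2 - 4^-1) <= (1 - be) * (l ^+ 2 - 4^-1).
    by rewrite mulrBl hbe; move: dl2; rewrite /de; lra.
  by rewrite ler_pM2r.
have D0 : 0 < 1 - be by apply: lt_le_trans hD.
have hb : (m ^+ 2 + 2^-1) / l ^+ 2 <= be.
  by rewrite ler_pdivrMr// -hbe; apply: ler_wpM2l; [exact: ltW|lra].
have s1 : 1 <= (1 + m) `^ (4 / 3).
  rewrite -[leLHS](powRr0 (1 + m)); apply: ler_powR; first by lra.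
  by rewrite divr_ge0.
have sl : l `^ (- 2) = (l ^+ 2)^-1 by rewrite powRN powR_mulrn// ltW.
apply: H; rewrite -/be//.
- by lra.
- have h1 : 2^-1 <= l ^+ 2 * be.
    have : (m ^+ 2 + 2^-1) / l ^+ 2 * l ^+ 2 <= be * l ^+ 2 by rewrite ler_wpM2r// ltW.
    by rewrite divfK ?gt_eqF//; have := sqr_ge0 m; lra.
  have h2 : de ^+ 2 <= (1 - be) ^+ 2 by apply: lerXn2r; rewrite ?nnegrE// ltW.
  by rewrite mulrC; apply: ler_pM; rewrite ?sqr_ge0.
- by rewrite sl ler_peMr// invr_ge0 ltW.
have s3 : ((1 + m) `^ (4 / 3)) ^+ 3 = (1 + m) ^+ 4.
  rewrite -powR_mulrn ?powR_ge0// -powRrM -powR_mulrn; last by lra.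
  by congr powR; field.
rewrite sl exprMn s3.
have -> : de / 16 * (l ^+ 2 * ((l ^+ 2)^-1 ^+ 3 * (1 + m) ^+ 4)) =
  de * (((1 + m) ^+ 2 / 4) / l ^+ 2) ^+ 2 by field; rewrite gt_eqF.
apply: ler_pM => //.
- exact: ltW.
- by rewrite sqr_ge0.
- have w0 : 0 <= (1 + m) ^+ 2 / 4 / l ^+ 2.
    by rewrite divr_ge0 ?sqr_ge0// divr_ge0 ?sqr_ge0.
  apply: lerXn2r; rewrite ?nnegrE ?(ltW be0)//.
  apply: le_trans hb; apply: ler_wpM2r; first by rewrite invr_ge0 ltW.
  by have := sqr_ge0 (m - 1); have := sqr_ge0 m; lra.
Qed.

End Regimes.

Lemma root4_le (R : realType) (X C w : R) : 0 <= C -> 0 < w -> X ^+ 4 * w <= C ->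
  `|X| <= C `^ 4^-1 * w `^ (- 4^-1).
Proof.
move=> C0 w0 h.
have e4 (t : R) : 0 <= t -> (t `^ 4^-1) ^+ 4 = t.
  move=> t0; rewrite -powR_mulrn ?powR_ge0// -powRrM mulVf ?powRr1//.
rewrite -(@ler_pXn2r _ 4)// ?nnegrE ?mulr_ge0 ?powR_ge0//.
rewrite exprMn e4// powRN exprVn e4 ?(ltW w0)// ler_pdivlMr//.
by rewrite -normrX ger0_norm// exprn_even_ge0.
Qed.

(** * The functions X *)

Lemma Id_param (R : realType) (d : nat) (l m : R) : (2 <= d)%N -> Id d l m ->
  exists i n : nat, m = (d%:R - 2) / 2 + i%:R /\ l = m + n%:R + 2^-1.
Proof.
move=> hd [[j _ <-] [i _ <-]] hle.
have ed : d.-1%:R = d%:R - 1 :> R.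
  by case: d hd {hle} => // k _; rewrite -[k.+1%:R]natr1 addrK.
rewrite ed in hle *.
have ij : (i <= j)%N.
  by rewrite -ltnS -(ltr_nat R) -[j.+1%:R]natr1; lra.
exists i, (j - i)%N; split; first by field.
by rewrite natrB//; field.
Qed.

Section Xfun.
Variables (R : realType) (d i n : nat).
Hypothesis hd : (2 <= d)%N.
Local Notation mu := ((d%:R - 2) / 2 : R).
Local Notation m := (mu + i%:R).
Local Notation l := (m + n%:R + 2^-1).
Local Notation X := (X_ d l m).
Local Notation P := (jacobi m m n).

Let mu_ge0 : 0 <= mu.
Proof. by rewrite divr_ge0// subr_ge0 ler_nat. Qed.

Let m_ge0 : 0 <= m. Proof. by rewrite addr_ge0//; exact: mu_ge0. Qed.

Lemma X_jacobi (x : R) : X x = c_ l m * (1 - x ^+ 2) `^ (i%:R / 2) * P.[x].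
Proof.
rewrite /X_ (_ : l - m - 2^-1 = n%:R); last by ring.
by rewrite natrK (_ : m / 2 - (d%:R - 2) / 4 = i%:R / 2)//; field.
Qed.

Lemma X_ufun (x : R) : x ^+ 2 < 1 -> X x = ufun m n x * (1 - x ^+ 2) `^ (- (mu / 2)).
Proof.
move=> x1; rewrite X_jacobi /ufun.
have -> : (1 - x ^+ 2) `^ (i%:R / 2) = (1 - x ^+ 2) `^ (m / 2) * (1 - x ^+ 2) `^ (- (mu / 2)).
  rewrite -powRD; first by congr powR; field.
  by rewrite [X in _ ==> X](_ : _ = true) ?implybT// gt_eqF// subr_gt0.
by rewrite !mulrA mulrAC.
Qed.

Lemma X_ufun0 (x : R) : mu = 0 -> X x = ufun m n x.
Proof. by move=> e; rewrite X_jacobi /ufun e add0r. Qed.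

Lemma X_normN (x : R) : `|X (- x)| = `|X x|.
Proof.
rewrite !X_jacobi sqrrN jacobiN mulrCA normrM normrX normrN1 expr1n mul1r//.
Qed.

Lemma X_norm_le (x : R) : -1 <= x <= 1 ->
  `|X x| <= `|c_ l m * P.[1]| * (1 - x ^+ 2) `^ (i%:R / 2).
Proof.
move=> hx; rewrite X_jacobi mulrAC normrM [`|_ `^ _|]ger0_norm ?powR_ge0//.
apply: ler_wpM2r; first exact: powR_ge0.
rewrite !normrM; apply: ler_wpM2l => //.
have := jacobi_le1 n m_ge0 hx.
by rewrite -(ler_pXn2r (n := 2))// ?nnegrE// !real_normK ?num_real.
Qed.

Lemma X_pole_eq0 (x : R) : (0 < i)%N -> x ^+ 2 = 1 -> X x = 0.
Proof.
move=> i0 e; rewrite X_jacobi e subrr powR0 ?mulr0 ?mul0r//.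
by rewrite gt_eqF// divr_gt0// ltr0n.
Qed.

End Xfun.

(** Only finitely many index pairs have [l <= L]. *)
Lemma X_small_l (R : realType) (d : nat) (L : R) : (2 <= d)%N ->
  exists2 C, 0 < C & forall i n : nat,
  let m := (d%:R - 2) / 2 + i%:R in let l := m + n%:R + 2^-1 in l <= L ->
  forall x, -1 <= x <= 1 -> `|X_ d l m x| <= C * (1 - x ^+ 2) `^ (i%:R / 2).
Proof.
move=> hd; pose N := (Num.truncn L).+1.
pose B i n := let m := (d%:R - 2) / 2 + i%:R in let l := m + n%:R + 2^-1 in
   `|c_ l m * (jacobi m m n).[1]| : R.
have B0 i n : 0 <= B i n by rewrite /B.
exists (1 + \sum_(i < N) \sum_(n < N) B i n).
  by rewrite ltr_wpDr// sumr_ge0// => i _; rewrite sumr_ge0.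
move=> i n m l hL x hx; apply: le_trans (@X_norm_le R d i n hd x hx) _.
apply: ler_wpM2r; first exact: powR_ge0.
have mu0 : 0 <= (d%:R - 2) / 2 :> R by rewrite divr_ge0// subr_ge0 ler_nat.
have i0 : 0 <= i%:R :> R by [].
have n0 : 0 <= n%:R :> R by [].
have LN : L < N%:R by apply: truncnS_gt.
have iN : (i < N)%N by rewrite -(ltr_nat R); move: hL; rewrite /l /m; lra.
have nN : (n < N)%N by rewrite -(ltr_nat R); move: hL; rewrite /l /m; lra.
apply: (@le_trans _ _ (\sum_(i < N) \sum_(n < N) B i n)); last by rewrite lerDr.
rewrite (bigD1 (Ordinal iN))//= (bigD1 (Ordinal nN))//= -addrA lerDl.
by rewrite addr_ge0// sumr_ge0// => k _; rewrite sumr_ge0.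
Qed.

(** A half of Stirling's bound: [(1 + 1/m) ^ i <= e] when [i <= m]. *)
Lemma Gamma_lower (R : realType) (mu : R) (i : nat) : 0 <= mu ->
  ((mu + i%:R) / (2 * expR 1)) ^+ i * Gamma (mu + 1) <= Gamma (mu + i%:R + 1).
Proof.
move=> mu0; have e1 : 2 <= expR 1 :> R by have := @expR_ge1Dx R 1; lra.
elim: i => [|i IH]; first by rewrite expr0 mul1r addr0.
have i0 : 0 <= i%:R :> R by [].
set m := mu + i%:R in IH.
have m0 : 0 <= m by rewrite addr_ge0.
have -> : mu + i.+1%:R = m + 1 by rewrite -natr1 /m; ring.
rewrite (@GammaS _ (m + 1)); last by lra.
have G0 : 0 < Gamma (mu + 1) by apply: Gamma_gt0; lra.
apply: le_trans (ler_wpM2l (_ : 0 <= m + 1) IH); last by lra.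
rewrite mulrA; apply: ler_wpM2r; first exact: ltW.
have E0 : 0 < expR 1 :> R by rewrite expR_gt0.
rewrite exprS !expr_div_n.
have hi : (m + 1) ^+ i <= expR 1 * m ^+ i.
  have [->|in0] := posnP i; first by rewrite !expr0 mulr1; lra.
  have ip : 0 < i%:R :> R by rewrite ltr0n.
  have mp : 0 < m by rewrite /m; lra.
  have h1 : 1 + m^-1 <= expR m^-1 by exact: expR_ge1Dx.
  have -> : m + 1 = (1 + m^-1) * m by field; rewrite gt_eqF.
  rewrite exprMn; apply: ler_wpM2r; first by rewrite exprn_ge0.
  apply: (@le_trans _ _ (expR m^-1 ^+ i)).
    apply: lerXn2r => //; rewrite nnegrE ?expR_ge0//.
    by rewrite addr_ge0// invr_ge0.
  rewrite -expRM_natl ler_expR ler_pdivrMr// mul1r /m; lra.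
have t0 : 0 < (2 * expR 1) ^+ i :> R by rewrite exprn_gt0// mulr_gt0.
have -> : (m + 1) / (2 * expR 1) * ((m + 1) ^+ i / (2 * expR 1) ^+ i) =
  (m + 1) * ((m + 1) ^+ i / (2 * expR 1)) / (2 * expR 1) ^+ i.
  by field; rewrite !gt_eqF.
have -> : (m + 1) * (m ^+ i / (2 * expR 1) ^+ i) = (m + 1) * m ^+ i / (2 * expR 1) ^+ i.
  by rewrite mulrA.
apply: ler_wpM2r; first by rewrite invr_ge0 ltW.
apply: ler_wpM2l; first by lra.
rewrite ler_pdivrMr ?mulr_gt0//; apply: (le_trans hi).
have : 0 <= expR 1 * m ^+ i by rewrite mulr_ge0 ?exprn_ge0// ltW.
lra.
Qed.

(** [y ^ i <= (m / (2 e l)) ^ i] gains [Gamma (m + 1) / l ^ i] by [Gamma_lower],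
    against the value at the pole, which is at most
    [l ^ (m + 1/2) / (2 ^ m Gamma (m + 1))]. *)
Lemma X_polar (R : realType) (d : nat) : (2 <= d)%N ->
  exists2 C, 0 < C & forall i n : nat,
  let m := (d%:R - 2) / 2 + i%:R in let l := m + n%:R + 2^-1 in
  forall x : R, -1 <= x <= 1 -> Num.sqrt (1 - x ^+ 2) <= m / l / (2 * expR 1) ->
  `|X_ d l m x| <= C * l `^ ((d%:R - 1) / 2) * 2 `^ (- m).
Proof.
move=> hd; set mu := (d%:R - 2) / 2.
have mu0 : 0 <= mu by rewrite divr_ge0// subr_ge0 ler_nat.
have G0 : 0 < Gamma (mu + 1) by apply: Gamma_gt0; lra.
exists (Gamma (mu + 1))^-1; first by rewrite invr_gt0.
move=> i n m l x hx hy.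
have i0 : 0 <= i%:R :> R by [].
have n0 : 0 <= n%:R :> R by [].
have m0 : 0 <= m by rewrite addr_ge0.
have l0 : 0 < l by rewrite /l; lra.
have p0 : 0 <= 1 - x ^+ 2 by move: hx => /andP[? ?]; nra.
have Gm : 0 < Gamma (m + 1) by apply: Gamma_gt0; lra.
have t0 : 0 < 2 `^ m :> R by rewrite powR_gt0.
have hN : 2 * m = (d - 2 + 2 * i)%:R by rewrite natrD natrB// natrM /m /mu; field.
have hc := @c_jacobi1_le R m n m0 _ hN.
have ly : l * l ^+ (d - 2 + 2 * i) = (l `^ (2^-1 + m)) ^+ 2.
  rewrite -powR_mulrn ?powR_ge0// -powRrM -powR_mulrn ?ltW//.
  rewrite -{1}(powRr1 (ltW l0)) -powRD; last by rewrite (gt_eqF l0) implybT.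
  by congr powR; rewrite -hN; field.
have hcP : `|c_ l m * (jacobi m m n).[1]| <= l `^ (2^-1 + m) / (2 `^ m * Gamma (m + 1)).
  have w0 : 0 < 2 `^ m * Gamma (m + 1) by rewrite mulr_gt0.
  have w1 : 0 <= `|c_ l m * (jacobi m m n).[1]| * (2 `^ m * Gamma (m + 1)).
    by rewrite mulr_ge0// ltW.
  rewrite ler_pdivlMr// -(ler_pXn2r (n := 2))// ?nnegrE ?powR_ge0//.
  by rewrite -ly exprMn real_normK ?num_real// [(2 `^ m * _) ^+ 2]exprMn.
apply: le_trans (@X_norm_le R d i n hd x hx) _; rewrite -/mu -/m -/l.
have hp : (1 - x ^+ 2) `^ (i%:R / 2) = Num.sqrt (1 - x ^+ 2) ^+ i.
  rewrite -powR12_sqrt//; move: (1 - x ^+ 2) => p.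
  by rewrite -powR_mulrn ?powR_ge0// -powRrM; congr powR; field.
rewrite hp.
have hyi : Num.sqrt (1 - x ^+ 2) ^+ i <= (m / (2 * expR 1)) ^+ i / l ^+ i.
  rewrite -expr_div_n (_ : m / (2 * expR 1) / l = m / l / (2 * expR 1)); last by ring.
  have w0 : 0 <= m / l / (2 * expR 1).
    by apply: divr_ge0; [apply: divr_ge0 => //; exact: ltW|rewrite mulr_ge0 ?expR_ge0].
  by apply: lerXn2r => //; rewrite nnegrE sqrtr_ge0.
have hG := Gamma_lower i mu0; rewrite -/m in hG.
have hr : (m / (2 * expR 1)) ^+ i <= Gamma (m + 1) / Gamma (mu + 1).
  by move: (Gamma (mu + 1)) (Gamma (m + 1)) G0 hG => g g' g0; rewrite ler_pdivlMr.
have li0 : 0 < l ^+ i by rewrite exprn_gt0.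
apply: (@le_trans _ _ (l `^ (2^-1 + m) / (2 `^ m * Gamma (m + 1)) *
   (Gamma (m + 1) / Gamma (mu + 1) / l ^+ i))).
  apply: ler_pM => //.
  apply: le_trans hyi _; apply: ler_wpM2r => //.
  by rewrite invr_ge0 ltW.
have -> : l `^ (2^-1 + m) = l `^ ((d%:R - 1) / 2) * l ^+ i.
  rewrite -powR_mulrn ?ltW// -powRD; last by rewrite (gt_eqF l0) implybT.
  by congr powR; rewrite /m /mu; field.
rewrite powRN le_eqVlt; apply/orP; left; apply/eqP.
move: (Gamma (mu + 1)) (Gamma (m + 1)) G0 Gm => g g' /lt0r_neq0 g0 /lt0r_neq0 g0'.
move: (2 `^ m) (l ^+ i) t0 li0 => t li /lt0r_neq0 t0 /lt0r_neq0 li0.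
by field; rewrite g0 g0' t0 li0.
Qed.

(** * Orders comparable to the degree *)

Lemma powRN_le (R : realType) (a p r : R) : 0 < a <= p -> 0 <= r -> p `^ (- r) <= a `^ (- r).
Proof.
move=> /andP[a0 ap] r0; have p0 : 0 < p by apply: lt_le_trans ap.
rewrite !powRN lef_pV2 ?posrE ?powR_gt0//.
by apply: ge0_ler_powR; rewrite ?nnegrE// ltW.
Qed.

Lemma powR_root4_ge1 (R : realType) (w W : R) : 0 < w <= W ->
  1 <= W `^ 4^-1 * w `^ (- 4^-1).
Proof.
move=> /andP[w0 wW]; rewrite powRN ler_pdivlMr ?powR_gt0// mul1r.
apply: ge0_ler_powR; rewrite ?nnegrE ?(ltW w0)//.
by apply: le_trans wW; exact: ltW.
Qed.

Lemma powR_le1 (R : realType) (p r : R) : 0 <= p <= 1 -> 0 <= r -> p `^ r <= 1.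
Proof.
move=> /andP[p0 p1] r0; have := ge0_ler_powR r0 (p0 : p \in Num.nneg) (ler01 : 1 \in Num.nneg) p1.
by rewrite powR1.
Qed.

Lemma one_sub_sqr_01 (R : realType) (x : R) : -1 <= x <= 1 -> 0 <= 1 - x ^+ 2 <= 1.
Proof. by move=> /andP[? ?]; apply/andP; split; [nra|rewrite gerBl sqr_ge0]. Qed.

Lemma sqr_ratio_01 (R : realType) (m l : R) : 0 <= m <= l -> 0 < l -> 0 <= m ^+ 2 / l ^+ 2 <= 1.
Proof.
move=> /andP[m0 ml] l0; rewrite divr_ge0 ?sqr_ge0//= ler_pdivrMr ?exprn_gt0// mul1r.
by apply: lerXn2r; rewrite ?nnegrE// ltW.
Qed.

Lemma dist_sqr_le1 (R : realType) (x t : R) : -1 <= x <= 1 -> 0 <= t <= 1 ->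
  `|x ^+ 2 - (1 - t)| <= 1.
Proof.
move=> /one_sub_sqr_01 /andP[? ?] /andP[? ?].
by rewrite ler_norml; apply/andP; split; lra.
Qed.

Section XBounds.
Variables (R : realType) (d : nat).
Hypothesis hd : (2 <= d)%N.
Local Notation mu := ((d%:R - 2) / 2 : R).

Let mu_ge0 : 0 <= mu.
Proof. by rewrite divr_ge0// subr_ge0 ler_nat. Qed.

Lemma X_pow4_ufun (i n : nat) (x : R) : let m := mu + i%:R in let l := m + n%:R + 2^-1 in
  x ^+ 2 < 1 -> X_ d l m x ^+ 4 = ufun m n x ^+ 4 * (1 - x ^+ 2) `^ (- (2 * mu)).
Proof.
move=> m l x1; have -> : (1 - x ^+ 2) `^ (- (2 * mu)) = ((1 - x ^+ 2) `^ (- (mu / 2))) ^+ 4.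
  move: (1 - x ^+ 2) => p; rewrite -[RHS]powR_mulrn ?powR_ge0// -powRrM.
  by congr powR; field.
by rewrite X_ufun// exprMn.
Qed.

Lemma X_pow4N (l m x : R) (i n : nat) : m = mu + i%:R -> l = m + n%:R + 2^-1 ->
  X_ d l m (- x) ^+ 4 = X_ d l m x ^+ 4.
Proof.
move=> -> ->; have e (t : R) : t ^+ 4 = `|t| ^+ 4 by rewrite -normrX ger0_norm// exprn_even_ge0.
by rewrite e X_normN -e.
Qed.

(** Where [1 - x ^ 2] is much smaller than [(m / l) ^ 2], the solution decays
    faster than the weight [(1 - x ^ 2) ^ (- mu / 2)] grows. *)
Lemma X_pow4_nincr (i n : nat) (x y : R) : let m := mu + i%:R in let l := m + n%:R + 2^-1 in
  1 <= l -> 0 < m -> 2 * mu <= m -> 0 <= x <= y -> y < 1 ->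
  1 - x ^+ 2 <= m ^+ 2 / l ^+ 2 / 4 -> X_ d l m y ^+ 4 <= X_ d l m x ^+ 4.
Proof.
move=> m l l1 m0 hmu /andP[x0 xy] y1 hx; have mu0 := mu_ge0.
rewrite !X_pow4_ufun; [|by nra|by nra].
have l2 : 1 <= l ^+ 2 by rewrite exprn_ege1.
have hq t : x <= t -> 3 / 4 * m ^+ 2 <= m ^+ 2 - (l ^+ 2 - 4^-1) * (1 - t ^+ 2).
  move=> xt.
  have pt : 1 - t ^+ 2 <= m ^+ 2 / l ^+ 2 / 4 by apply: le_trans hx; nra.
  have : (l ^+ 2 - 4^-1) * (1 - t ^+ 2) <= l ^+ 2 * (m ^+ 2 / l ^+ 2 / 4).
    have [p0|p0] := leP 0 (1 - t ^+ 2); first by apply: ler_pM => //; lra.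
    apply: (@le_trans _ _ 0); first by rewrite mulr_ge0_le0 ?ltW//; lra.
    by rewrite mulr_ge0 ?divr_ge0 ?sqr_ge0.
  have -> : l ^+ 2 * (m ^+ 2 / l ^+ 2 / 4) = m ^+ 2 / 4 by field; rewrite gt_eqF//; lra.
  by lra.
have hpt t : x <= t <= y -> 0 < 1 - t ^+ 2 by move=> /andP[? ?]; nra.
have hsol : legendre_sol l m (ufun m n) (Ufun m n) by exact: legendre_sol_jacobi.
have lam0 : 0 <= l ^+ 2 - 4^-1 by lra.
have hu1 : vanish_at1 (ufun m n) by exact: vanish_powR_poly.
have hU1 : vanish_at1 (Ufun m n) by exact: vanish_powR_poly.
apply: (decay (w := fun t => (1 - t ^+ 2) `^ (- (2 * mu)))
  (dw := fun t => 4 * mu * t * ((1 - t ^+ 2) `^ (- (2 * mu)) / (1 - t ^+ 2)))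
  (g := fun=> mu) hsol lam0 hu1 hU1).
- by rewrite x0.
- by [].
- by have := hq _ (lexx x); have := sqr_ge0 m; lra.
- move=> t ht; have p0 := hpt _ ht.
  apply: (der_congr (der_powR _ (is_derive_1Bsq t) p0)).
  rewrite powRD; last by rewrite [X in X ==> _](_ : _ = false)//; apply/negbTE; rewrite lt_eqF//; lra.
  by rewrite powR_inv1 ?(ltW p0)//; ring.
move=> t ht; have p0 := hpt _ ht; have /andP[xt ty] := ht.
split => //; first exact: powR_ge0.
  by apply: le_trans (hq _ xt); nra.
rewrite mulrCA [X in _ * X <= _]mulrC divfK ?gt_eqF//.
by apply: ler_wpM2r; [exact: powR_ge0|nra].
Qed.

(** Comparison with the point [z] where [1 - z ^ 2 = (m / l) ^ 2 / 4], where
    [z ^ 2] is at distance [3/4 (m / l) ^ 2] from its value at the turning point. *)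
Lemma X_pow4_pole (i n : nat) (e B t : R) : let m := mu + i%:R in let l := m + n%:R + 2^-1 in
  1 <= l -> (0 < i)%N -> 2 * mu <= m -> 0 < e <= m ^+ 2 / l ^+ 2 ->
  (forall z, -1 <= z <= 1 -> m ^+ 2 / l ^+ 2 / 4 <= 1 - z ^+ 2 ->
    X_ d l m z ^+ 4 * (l^-1 + `|z ^+ 2 - (1 - m ^+ 2 / l ^+ 2)|) <= B) ->
  0 <= t <= 1 -> 1 - t ^+ 2 < m ^+ 2 / l ^+ 2 / 4 -> X_ d l m t ^+ 4 * 3 <= B * (4 / e).
Proof.
move=> m l l1 i0 hmu /andP[e0 her] near /andP[t0 t1] hbt.
have n0 : 0 <= n%:R :> R by [].
have ip : 0 < i%:R :> R by rewrite ltr0n.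
have mp : 0 < m by rewrite /m; have := mu_ge0; lra.
have l0 : 0 < l by apply: lt_le_trans l1.
have ml : 0 <= m <= l by rewrite ltW//= /l -addrA lerDl addr_ge0.
have /andP[r0 r1] := sqr_ratio_01 ml l0.
have B0 : 0 <= B.
  apply: le_trans (near 0 _ _); rewrite ?expr0n ?subr0 ?lerN10 ?ler01//=.
    by rewrite mulr_ge0 ?exprn_even_ge0// addr_ge0// invr_ge0 ltW.
  by lra.
move: t1; rewrite le_eqVlt => /predU1P[t1|t1].
  by rewrite X_pole_eq0// ?t1 ?expr1n// expr0n mul0r mulr_ge0// divr_ge0// ltW.
set r := m ^+ 2 / l ^+ 2 in her near hbt r0 r1.
pose z := Num.sqrt (1 - r / 4).
have ez : z ^+ 2 = 1 - r / 4 by rewrite sqr_sqrtr//; lra.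
have z0 : 0 <= z by rewrite sqrtr_ge0.
have zt : z <= t by rewrite -(ler_pXn2r (n := 2))// ?nnegrE// ez; lra.
have z11 : -1 <= z <= 1 by rewrite (le_trans _ z0) ?lerN10// (le_trans zt)// ltW.
have hz : X_ d l m t ^+ 4 <= X_ d l m z ^+ 4.
  apply: X_pow4_nincr => //; rewrite ?z0 ?ez//.
  by rewrite opprB addrCA subrr addr0.
have h : X_ d l m z ^+ 4 * (l^-1 + `|z ^+ 2 - (1 - r)|) <= B.
  by apply: near => //; rewrite ez opprB addrCA subrr addr0.
have X0 : 0 <= X_ d l m z ^+ 4 by rewrite exprn_even_ge0.
have li0 : 0 <= l^-1 by rewrite invr_ge0 ltW.
move: (X_ d l m z) (X_ d l m t) (l^-1) hz h X0 li0 => Xz Xt li hz h X0 li0.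
rewrite mulrA ler_pdivlMr//; clear near B0.
have hw : 3 / 4 * e <= li + `|z ^+ 2 - (1 - r)|.
  by rewrite ez ger0_norm; lra.
have h2 := le_trans (ler_wpM2l X0 hw) h.
have : Xt ^+ 4 * e <= Xz ^+ 4 * e by apply: ler_wpM2r => //; exact: ltW.
by lra.
Qed.

(** Where [1 - x ^ 2] is bounded below, [X] and [ufun] are comparable.  The
    threshold [L'] forces [2 mu + 1 <= m], as needed near the poles. *)
Lemma X_equatorial (eps : R) : 0 < eps < 1 ->
  exists2 C, 0 < C & forall i n : nat,
  let m := mu + i%:R in let l := m + n%:R + 2^-1 in
  eps * l <= m -> forall x, -1 <= x <= 1 ->
  `|X_ d l m x| <= C * (l^-1 + `|x ^+ 2 - (1 - m ^+ 2 / l ^+ 2)|) `^ (- 4^-1).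
Proof.
move=> heps; have /andP[e0 e1] := heps; have mu0 := mu_ge0.
have [C C0 [L hC]] := ufun_large_m hd heps.
pose L' := Num.max L (1 + (2 * mu + 1) / eps).
have [B B0 hB] := X_small_l L' hd.
pose E := (eps ^+ 2 / 4) `^ (- (2 * mu)).
have E0 : 0 < E by rewrite powR_gt0// divr_gt0// exprn_gt0.
pose C1 := (C * E) * (1 + 4 / eps ^+ 2).
have C10 : 0 <= C1.
  by rewrite mulr_ge0// ?addr_ge0// ?divr_ge0 ?sqr_ge0// mulr_ge0// ltW.
exists (C1 `^ 4^-1 + B * 3 `^ 4^-1).
  by rewrite ltr_wpDl ?powR_ge0// mulr_gt0// powR_gt0.
move=> i n m l hm x hx.
have i0 : 0 <= i%:R :> R by [].
have n0 : 0 <= n%:R :> R by [].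
have m0 : 0 <= m by rewrite /m; lra.
have l12 : 2^-1 <= l by rewrite /l; lra.
have l0 : 0 < l by lra.
have ml : 0 <= m <= l by rewrite m0 /l; lra.
have hr := sqr_ratio_01 ml l0.
set w := l^-1 + _.
have li0 : 0 < l^-1 by rewrite invr_gt0.
have w0 : 0 < w by rewrite ltr_pwDl.
have hp := one_sub_sqr_01 hx.
have [lL|lL] := leP l L'.
  have hXB : `|X_ d l m x| <= B.
    apply: le_trans (hB i n lL x hx) _; rewrite ler_piMr ?(ltW B0)//.
    by apply: powR_le1 => //; rewrite divr_ge0.
  have w3 : w <= 3.
    have : l^-1 <= 2 by rewrite -[leRHS]invrK lef_pV2 ?posrE.
    by have := dist_sqr_le1 hx hr; rewrite /w; lra.
  apply: (le_trans hXB); rewrite mulrDl -mulrA.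
  have h1 : B * 1 <= B * (3 `^ 4^-1 * w `^ (- 4^-1)).
    by apply: ler_wpM2l; [exact: ltW|apply: powR_root4_ge1; rewrite w0].
  have : 0 <= C1 `^ 4^-1 * w `^ (- 4^-1) by rewrite mulr_ge0 ?powR_ge0.
  by lra.
have hL : L <= l by apply: le_trans (ltW lL); rewrite le_max lexx.
have hL2 : 1 + (2 * mu + 1) / eps <= l by apply: le_trans (ltW lL); rewrite le_max lexx orbT.
have l1 : 1 <= l.
  by apply: le_trans hL2; rewrite lerDl divr_ge0 ?(ltW e0)//; lra.
have m2mu : 2 * mu + 1 <= m.
  have := ler_wpM2l (ltW e0) hL2.
  by rewrite mulrDr [eps * (_ / _)]mulrC divfK ?gt_eqF//; move: hm; lra.
have mp : 0 < m by lra.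
have ip : (0 < i)%N by rewrite -(ltr_nat R) /=; move: m2mu; rewrite /m; lra.
have l2 : 0 < l ^+ 2 by rewrite exprn_gt0.
have b2 : eps ^+ 2 <= m ^+ 2 / l ^+ 2.
  rewrite ler_pdivlMr// -exprMn; apply: lerXn2r => //; rewrite nnegrE.
  by rewrite mulr_ge0// ltW.
have CE0 : 0 <= C * E by rewrite mulr_ge0// ltW.
have near t : -1 <= t <= 1 -> m ^+ 2 / l ^+ 2 / 4 <= 1 - t ^+ 2 ->
    X_ d l m t ^+ 4 * (l^-1 + `|t ^+ 2 - (1 - m ^+ 2 / l ^+ 2)|) <= C * E.
  move=> ht hbt; have eb : 0 < eps ^+ 2 / 4 by rewrite divr_gt0// exprn_gt0.
  have hbt' : eps ^+ 2 / 4 <= 1 - t ^+ 2 by lra.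
  rewrite X_pow4_ufun; last by lra.
  rewrite mulrAC; apply: ler_pM.
  - by rewrite mulr_ge0 ?exprn_even_ge0// addr_ge0// ltW.
  - exact: powR_ge0.
  - exact: hC.
  - by apply: powRN_le; [rewrite eb|lra].
suff hX : X_ d l m x ^+ 4 * w <= C1.
  apply: (le_trans (root4_le C10 w0 hX)); apply: ler_wpM2r; first exact: powR_ge0.
  by rewrite lerDl mulr_ge0 ?powR_ge0// ltW.
have [hb|hb] := leP (m ^+ 2 / l ^+ 2 / 4) (1 - x ^+ 2).
  apply: le_trans (near x hx hb) _; rewrite ler_peMr//.
  by rewrite lerDl divr_ge0 ?sqr_ge0.
have pole t : 0 <= t <= 1 -> 1 - t ^+ 2 < m ^+ 2 / l ^+ 2 / 4 ->
    X_ d l m t ^+ 4 * 3 <= C1.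
  move=> ht hbt; have ep2 : 0 < eps ^+ 2 <= m ^+ 2 / l ^+ 2 by rewrite exprn_gt0.
  apply: (le_trans (X_pow4_pole l1 ip _ ep2 near ht hbt)).
    by apply: le_trans m2mu; rewrite lerDl.
  by rewrite /C1; apply: ler_wpM2l => //; rewrite lerDr.
apply: (@le_trans _ _ (X_ d l m x ^+ 4 * 3)).
  apply: ler_wpM2l; first by rewrite exprn_even_ge0.
  have h : l^-1 <= 1 by rewrite invf_le1.
  by rewrite (le_trans (lerD h (dist_sqr_le1 hx hr)))// -[leLHS]/(2%:R) ler_nat.
have /andP[x1 x2] := hx.
have [x0|/ltW x0] := leP 0 x; first by apply: pole => //; rewrite x0.
rewrite -(@X_pow4N l m x i n erefl erefl); apply: pole; last by rewrite sqrrN.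
by rewrite oppr_ge0 x0 lerNl.
Qed.

End XBounds.

(** * Beyond twice the turning point, small orders, and the theorem *)

Lemma powR_anti (R : realType) (p e r : R) : 0 <= p <= 1 -> 0 <= e <= r -> p `^ r <= p `^ e.
Proof.
move=> /andP[p0 p1] /andP[e0 er]; move: p0; rewrite le_eqVlt => /predU1P[<-|p0].
  have [->|r0] := eqVneq r e; first by [].
  by rewrite powR0 ?powR_ge0// gt_eqF// (le_lt_trans e0)// lt_neqAle eq_sym r0.
by apply: ger_powR => //; rewrite p0.
Qed.

Lemma powRN_ge1 (R : realType) (p r : R) : 0 < p <= 1 -> 0 <= r -> 1 <= p `^ (- r).
Proof. by move=> hp r0; have := powRN_le hp r0; rewrite powR1. Qed.

Section XBounds2.
Variables (R : realType) (d : nat).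
Hypothesis hd : (2 <= d)%N.
Local Notation mu := ((d%:R - 2) / 2 : R).

Let mu_ge0 : 0 <= mu.
Proof. by rewrite divr_ge0// subr_ge0 ler_nat. Qed.

(** From [sqrt 2] times the turning point on, [m ^ 2 - lam (1 - t ^ 2)] is at least
    [l ^ 2 t ^ 2 / 2], so [ufun] decays like a power of [1 - t ^ 2] with exponent
    proportional to [l]; since [l t ^ 2 >= 1], a part of this decay compensates
    the factor [t ^ 2]. *)
Lemma ufun_beyond (i n : nat) (x y : R) : let m := mu + i%:R in let l := m + n%:R + 2^-1 in
  1 <= l -> 0 < m -> 0 <= x <= y -> y < 1 -> 2 * (1 - m ^+ 2 / l ^+ 2) <= x ^+ 2 ->
  ufun m n y ^+ 4 * (y ^+ 2 * (1 - y ^+ 2) `^ (- (l / 4))) <=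
  ufun m n x ^+ 4 * (x ^+ 2 * (1 - x ^+ 2) `^ (- (l / 4))).
Proof.
move=> m l l1 m0 /andP[x0 xy] y1 hx.
have n0 : 0 <= n%:R :> R by [].
have l2 : 1 <= l ^+ 2 by rewrite exprn_ege1.
have lm : m + 2^-1 <= l by rewrite /l; lra.
have a2l : 2^-1 <= (1 - m ^+ 2 / l ^+ 2) * l.
  have l20 : 0 < l by lra.
  have -> : (1 - m ^+ 2 / l ^+ 2) * l = (l ^+ 2 - m ^+ 2) / l by field; rewrite gt_eqF.
  by rewrite ler_pdivlMr//; nra.
have eml : l ^+ 2 * (m ^+ 2 / l ^+ 2) = m ^+ 2 by rewrite mulrC divfK// gt_eqF//; lra.
have ht t : x <= t -> 2 * (1 - m ^+ 2 / l ^+ 2) <= t ^+ 2.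
  by move=> xt; apply: (le_trans hx); nra.
have hpt t : x <= t <= y -> 0 < 1 - t ^+ 2 by move=> /andP[? ?]; nra.
have hq t : x <= t <= y -> (7 / 10 * l * t) ^+ 2 <= m ^+ 2 - (l ^+ 2 - 4^-1) * (1 - t ^+ 2).
  move=> hxt; have p0 := hpt _ hxt; have /andP[xt _] := hxt; have h2 := ht _ xt.
  have : l ^+ 2 * (2 * (1 - m ^+ 2 / l ^+ 2)) <= l ^+ 2 * t ^+ 2 by rewrite ler_wpM2l ?sqr_ge0.
  have : 0 <= l ^+ 2 * t ^+ 2 by rewrite mulr_ge0 ?sqr_ge0.
  rewrite !exprMn; lra.
have hsol : legendre_sol l m (ufun m n) (Ufun m n) by exact: legendre_sol_jacobi.
have lam0 : 0 <= l ^+ 2 - 4^-1 by lra.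
have hu1 : vanish_at1 (ufun m n) by exact: vanish_powR_poly.
have hU1 : vanish_at1 (Ufun m n) by exact: vanish_powR_poly.
apply: (decay (w := fun t => t ^+ 2 * (1 - t ^+ 2) `^ (- (l / 4)))
  (dw := fun t => (1 - t ^+ 2) `^ (- (l / 4)) * (2 * t + l / 2 * t ^+ 3 / (1 - t ^+ 2)))
  (g := fun t => 7 / 10 * l * t) hsol lam0 hu1 hU1).
- by rewrite x0.
- by [].
- have hxx : x <= x <= y by rewrite lexx.
  by have := hq _ hxx; have := sqr_ge0 (7 / 10 * l * x); lra.
- move=> t hxt; have p0 := hpt _ hxt.
  apply: (der_congr (der_mul (der_sqr (der_var t)) (der_powR _ (is_derive_1Bsq t) p0))).
  rewrite powRD; last by rewrite [X in X ==> _](_ : _ = false)//; apply/negbTE; rewrite lt_eqF//; lra.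
  rewrite powR_inv1 ?(ltW p0)//; move: (_ `^ _) => W.
  by move: (1 - t ^+ 2) (lt0r_neq0 p0) => p pn0; field.
move=> t hxt; have p0 := hpt _ hxt; have /andP[xt ty] := hxt.
have t0 : 0 <= t by apply: le_trans xt.
split; last 2 first.
- exact: hq.
- have W0 := powR_ge0 (1 - t ^+ 2) (- (l / 4)).
  have -> : (1 - t ^+ 2) * ((1 - t ^+ 2) `^ (- (l / 4)) * (2 * t + l / 2 * t ^+ 3 / (1 - t ^+ 2))) =
    (2 * (1 - t ^+ 2) * t + l / 2 * t ^+ 3) * (1 - t ^+ 2) `^ (- (l / 4)).
    move: (_ `^ _) => W.
    by move: (1 - t ^+ 2) (lt0r_neq0 p0) => p pn0; field.
  rewrite mulrA; apply: ler_wpM2r => //.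
  have lt2 : 1 <= l * t ^+ 2 by have := ht _ xt; nra.
  have : t * 1 <= t * (l * t ^+ 2) by rewrite ler_wpM2l.
  have : 0 <= t * t ^+ 2 by rewrite mulr_ge0 ?sqr_ge0.
  have -> : t ^+ 3 = t * t ^+ 2 by rewrite exprS.
  have -> : 4 * (7 / 10 * l * t) * t ^+ 2 = 14 / 5 * (t * (l * t ^+ 2)) by field.
  have -> : l / 2 * (t * t ^+ 2) = 2^-1 * (t * (l * t ^+ 2)) by field.
  have -> : 2 * (1 - t ^+ 2) * t = 2 * t - 2 * (t * t ^+ 2) by ring.
  by lra.
- by rewrite mulr_ge0 ?sqr_ge0 ?powR_ge0.
- by rewrite !mulr_ge0//; lra.
Qed.

(** The decay starts at [z = sqrt 2 a], before [2 a], so that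
    [1 - t ^ 2 <= (1 - z ^ 2) ^ 2] for [t >= 2 a] and half of the exponent
    [l / 4] survives the normalization at [z]. *)
Lemma X_pow4_beyond (i n : nat) (C t : R) : let m := mu + i%:R in let l := m + n%:R + 2^-1 in
  1 <= l -> 0 < m -> 4 * (1 - m ^+ 2 / l ^+ 2) <= t ^+ 2 -> 0 <= t < 1 ->
  (forall z, -1 <= z <= 1 ->
    ufun m n z ^+ 4 * (l^-1 + `|z ^+ 2 - (1 - m ^+ 2 / l ^+ 2)|) <= C) ->
  X_ d l m t ^+ 4 * t ^+ 2 <= 2 * C * ((1 - t ^+ 2) `^ (32^-1 * l - mu / 2)) ^+ 4.
Proof.
move=> m l l1 mp hat /andP[t0 t1] hC.
have n0 : 0 <= n%:R :> R by [].
have l0 : 0 < l by apply: lt_le_trans l1.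
have ml : 0 <= m <= l by rewrite ltW//= /l -addrA lerDl addr_ge0.
have /andP[r0 r1] := sqr_ratio_01 ml l0.
have pt : 0 < 1 - t ^+ 2 by clear hC hat; nra.
set a2 := 1 - m ^+ 2 / l ^+ 2 in hat hC.
have a20 : 0 <= a2 by rewrite /a2 subr_ge0.
pose z := Num.sqrt (2 * a2).
have ez : z ^+ 2 = 2 * a2 by rewrite sqr_sqrtr// mulr_ge0.
have z0 : 0 <= z by rewrite sqrtr_ge0.
have zt : z <= t by rewrite -(ler_pXn2r (n := 2))// ?nnegrE// ez; clear hC; lra.
have z11 : -1 <= z <= 1 by rewrite (le_trans _ z0) ?lerN10// (le_trans zt)// ltW.
have pz : 0 < 1 - z ^+ 2 by rewrite ez; clear hC; lra.
have hpp : (1 - z ^+ 2) `^ (- (l / 4)) <= (1 - t ^+ 2) `^ (- (l / 8)).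
  have -> : (1 - z ^+ 2) `^ (- (l / 4)) = ((1 - z ^+ 2) ^+ 2) `^ (- (l / 8)).
    rewrite -[(1 - z ^+ 2) ^+ 2]powR_mulrn ?(ltW pz)// -powRrM.
    by congr powR; field.
  apply: powRN_le; last by rewrite divr_ge0// ltW.
  by rewrite pt ez; have := sqr_ge0 a2; clear hC; lra.
have hz01 : 0 <= z <= t by rewrite z0.
have hz2 : 2 * a2 <= z ^+ 2 by rewrite ez.
have hdec := ufun_beyond l1 mp hz01 t1 hz2.
have {}hC := hC z z11.
rewrite -/m -/l in hdec.
have u0 : 0 <= ufun m n z ^+ 4 by rewrite exprn_even_ge0.
have hz : ufun m n z ^+ 4 * z ^+ 2 <= 2 * C.
  rewrite ez mulrCA; apply: ler_wpM2l => //; apply: le_trans hC; apply: ler_wpM2l => //.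
  have -> : z ^+ 2 - a2 = a2 by rewrite ez; ring.
  by rewrite ger0_norm// lerDr invr_ge0 ltW.
have hu : ufun m n t ^+ 4 * t ^+ 2 <= 2 * C * (1 - t ^+ 2) `^ (l / 8).
  have q0 : 0 < (1 - t ^+ 2) `^ (- (l / 4)) by rewrite powR_gt0.
  rewrite -(ler_pM2r q0) -(mulrA (ufun m n t ^+ 4)); apply: (le_trans hdec).
  have -> : 2 * C * (1 - t ^+ 2) `^ (l / 8) * (1 - t ^+ 2) `^ (- (l / 4)) =
      2 * C * (1 - t ^+ 2) `^ (- (l / 8)).
    rewrite -mulrA -powRD; first by congr (_ * _); congr powR; field.
    by rewrite (gt_eqF pt) implybT.
  rewrite mulrA; apply: ler_pM => //; last exact: powR_ge0.
  by rewrite mulr_ge0 ?sqr_ge0.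
rewrite X_pow4_ufun//; last by rewrite -subr_gt0.
rewrite mulrAC.
have -> : ((1 - t ^+ 2) `^ (32^-1 * l - mu / 2)) ^+ 4 =
    (1 - t ^+ 2) `^ (l / 8) * (1 - t ^+ 2) `^ (- (2 * mu)).
  rewrite -powRD; last by rewrite (gt_eqF pt) implybT.
  move: (1 - t ^+ 2) => p; rewrite -[LHS]powR_mulrn ?powR_ge0// -powRrM.
  by congr powR; field.
by rewrite (mulrA (2 * C)); apply: ler_wpM2r => //; exact: powR_ge0.
Qed.

(** For small [l] the exponent is at most [i / 2], the one present in [X] itself:
    [2 a <= |x|] implies [l / 2 <= m]. *)
Lemma X_beyond :
  exists2 C, 0 < C & forall i n : nat,
  let m := mu + i%:R in let l := m + n%:R + 2^-1 in
  forall x, -1 <= x <= 1 -> 4 * (1 - m ^+ 2 / l ^+ 2) <= x ^+ 2 -> x != 0 ->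
  `|X_ d l m x| <= C * `|x| `^ (- 2^-1) *
     (1 - x ^+ 2) `^ (Num.max (32^-1 * l - (d%:R - 2) / 4) 0).
Proof.
have mu0 := mu_ge0.
have h2 : 0 < (2^-1 : R) < 1 by apply/andP; split; lra.
have [C C0 [L hC]] := ufun_large_m hd h2.
pose L' := Num.max L (1 + 16 * mu).
have [B B0 hB] := X_small_l L' hd.
have C20 : 0 < 2 * C by rewrite mulr_gt0.
exists (B + (2 * C) `^ 4^-1); first by rewrite ltr_wpDr ?powR_ge0.
move=> i n m l x hx hax xn0.
have i0 : 0 <= i%:R :> R by [].
have n0 : 0 <= n%:R :> R by [].
have m0 : 0 <= m by rewrite /m; lra.
have lm : m + 2^-1 <= l by rewrite /l; lra.
have l0 : 0 < l by lra.
have l20 : 0 < l ^+ 2 by rewrite exprn_gt0.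
have ml : 0 <= m <= l by rewrite m0; lra.
have /andP[r0 r1] := sqr_ratio_01 ml l0.
have /andP[p0 p1] := one_sub_sqr_01 hx.
have r34 : 3 / 4 <= m ^+ 2 / l ^+ 2 by lra.
have ml2 : l / 2 <= m.
  have : 3 / 4 * l ^+ 2 <= m ^+ 2 by rewrite -ler_pdivlMr.
  by nra.
set e := Num.max _ _.
have ax0 : 0 < `|x| by rewrite normr_gt0.
have ax1 : `|x| <= 1 by rewrite ler_norml.
have hx1 : 1 <= `|x| `^ (- 2^-1) by apply: powRN_ge1; rewrite ?ax0//; lra.
have pe0 := powR_ge0 (1 - x ^+ 2) e.
have e0 : 0 <= e by rewrite le_max lexx orbT.
have [lL|lL] := leP l L'.
  have ei : 0 <= e <= i%:R / 2.
    rewrite e0 /= ge_max; apply/andP; split; last by rewrite divr_ge0.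
    by move: ml2; rewrite /m; lra.
  apply: le_trans (hB i n lL x hx) _.
  apply: (@le_trans _ _ (B * (1 - x ^+ 2) `^ e)).
    by apply: ler_wpM2l; [exact: ltW|apply: powR_anti; rewrite ?p0].
  apply: ler_wpM2r => //; rewrite mulrDl.
  have : B * 1 <= B * `|x| `^ (- 2^-1) by apply: ler_wpM2l => //; exact: ltW.
  have : 0 <= (2 * C) `^ 4^-1 * `|x| `^ (- 2^-1) by rewrite mulr_ge0 ?powR_ge0.
  by lra.
have hL : L <= l by apply: le_trans (ltW lL); rewrite le_max lexx.
have hL2 : 1 + 16 * mu <= l by apply: le_trans (ltW lL); rewrite le_max lexx orbT.
have l1 : 1 <= l by lra.
have mp : 0 < m by lra.
have ip : (0 < i)%N by rewrite -(ltr_nat R) /=; move: ml2; rewrite /m; lra.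
have ee : e = 32^-1 * l - mu / 2.
  have -> : mu / 2 = (d%:R - 2) / 4 by field.
  by apply/max_idPl; lra.
apply: (@le_trans _ _ ((2 * C) `^ 4^-1 * `|x| `^ (- 2^-1) * (1 - x ^+ 2) `^ e)); last first.
  apply: ler_wpM2r => //; apply: ler_wpM2r; first exact: powR_ge0.
  by rewrite lerDr ltW.
have := p0; rewrite le_eqVlt => /predU1P[px|px].
  rewrite X_pole_eq0//; last by lra.
  by rewrite normr0 !mulr_ge0 ?powR_ge0.
have main t : 0 <= t < 1 -> 4 * (1 - m ^+ 2 / l ^+ 2) <= t ^+ 2 ->
    X_ d l m t ^+ 4 * t ^+ 2 <= 2 * C * ((1 - t ^+ 2) `^ e) ^+ 4.
  move=> t01 hat; rewrite ee; apply: X_pow4_beyond => // z hz.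
  by apply: hC => //; rewrite mulrC.
have mainx : X_ d l m x ^+ 4 * x ^+ 2 <= 2 * C * ((1 - x ^+ 2) `^ e) ^+ 4.
  have ex : x ^+ 2 = `|x| ^+ 2 by rewrite real_normK// num_real.
  have eX : X_ d l m x ^+ 4 = X_ d l m `|x| ^+ 4.
    have [x0|x0] := leP 0 x; first by rewrite ger0_norm.
    by rewrite ltr0_norm// (@X_pow4N R d l m x i n).
  rewrite eX ex; apply: main; last by rewrite -ex.
  rewrite ltW//= -(ltr_pXn2r (n := 2))// ?nnegrE// ?expr1n -?ex//; lra.
move: (X_ d l m x) mainx => X mainx.
rewrite -(ler_pXn2r (n := 4))// ?nnegrE ?mulr_ge0 ?powR_ge0//.
have X40 : 0 <= X ^+ 4 by rewrite exprn_even_ge0.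
rewrite -normrX (ger0_norm X40) !exprMn.
have -> : ((2 * C) `^ 4^-1) ^+ 4 = 2 * C.
  by rewrite -powR_mulrn ?powR_ge0// -powRrM mulVf ?powRr1 ?ltW.
have -> : (`|x| `^ (- 2^-1)) ^+ 4 = (x ^+ 2)^-1.
  rewrite -[x ^+ 2]real_normK ?num_real// -powR_mulrn ?powR_ge0// -powRrM.
  by rewrite -[in RHS]powR_mulrn// -powRN; congr powR; field.
by rewrite mulrAC ler_pdivlMr// exprn_even_gt0.
Qed.

(** At the poles [ufun] is still controlled, but the weight is only finite there
    if [mu = 0]. *)
Lemma X_small_order (eps : R) : 0 < eps < 1 ->
  exists2 C, 0 < C & forall i n : nat,
  let m := mu + i%:R in let l := m + n%:R + 2^-1 in
  m <= eps * l -> forall x, -1 <= x <= 1 -> x ^+ 2 < 1 \/ mu = 0 ->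
  `|X_ d l m x| <= C * (Num.sqrt (1 - x ^+ 2)) `^ (- mu) *
   (l `^ (- 2) * (1 + m) `^ (4 / 3) + `|x ^+ 2 - (1 - m ^+ 2 / l ^+ 2)|) `^ (- 4^-1).
Proof.
move=> heps; have mu0 := mu_ge0.
have [C C0 [L hC]] := ufun_small_m hd heps.
have [B B0 hB] := X_small_l L hd.
pose W := (2^-1 : R) `^ (- 2) * (1 + L) `^ (4 / 3) + 1.
have W0 : 0 < W by rewrite ltr_wpDl// mulr_ge0 ?powR_ge0.
exists (C `^ 4^-1 + B * W `^ 4^-1).
  by rewrite ltr_wpDl ?powR_ge0// mulr_gt0// powR_gt0.
move=> i n m l hm x hx hx1.
have i0 : 0 <= i%:R :> R by [].
have n0 : 0 <= n%:R :> R by [].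
have m0 : 0 <= m by rewrite /m; lra.
have lm : m + 2^-1 <= l by rewrite /l; lra.
have l0 : 0 < l by lra.
have ml : 0 <= m <= l by rewrite m0; lra.
have hr := sqr_ratio_01 ml l0.
have hp := one_sub_sqr_01 hx; have /andP[p0 p1] := hp.
set w := l `^ (- 2) * _ + _.
have w0 : 0 < w by rewrite ltr_pwDl// mulr_gt0// powR_gt0//; lra.
have ey : (Num.sqrt (1 - x ^+ 2)) `^ (- mu) = (1 - x ^+ 2) `^ (- (mu / 2)).
  by rewrite -powR12_sqrt// -powRrM; congr powR; field.
rewrite ey.
have y1 : 1 <= (1 - x ^+ 2) `^ (- (mu / 2)).
  case: hx1 => [h|->]; last by rewrite mul0r oppr0 powRr0.
  by apply: powRN_ge1; [rewrite p1 andbT; lra|rewrite divr_ge0].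
rewrite mulrAC mulrDl.
have [lL|lL] := leP l L.
  have hXB : `|X_ d l m x| <= B.
    apply: le_trans (hB i n lL x hx) _; rewrite ler_piMr ?(ltW B0)//.
    by apply: powR_le1 => //; rewrite divr_ge0.
  have wW : w <= W.
    apply: lerD; last exact: dist_sqr_le1.
    apply: ler_pM; rewrite ?powR_ge0//.
      by apply: powRN_le => //; apply/andP; split; lra.
    by apply: ge0_ler_powR; rewrite ?nnegrE ?divr_ge0//; lra.
  have h1 : B * 1 <= B * (W `^ 4^-1 * w `^ (- 4^-1)).
    by apply: ler_wpM2l; [exact: ltW|apply: powR_root4_ge1; rewrite w0].
  have h2 : 0 <= C `^ 4^-1 * w `^ (- 4^-1) by rewrite mulr_ge0 ?powR_ge0.
  apply: (le_trans hXB); rewrite -[leLHS]mulr1; apply: ler_pM => //; first exact: ltW.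
  by rewrite -mulrA; lra.
have hw : ufun m n x ^+ 4 * w <= C by apply: hC => //; exact: ltW.
have hu := root4_le (ltW C0) w0 hw.
have -> : X_ d l m x = ufun m n x * (1 - x ^+ 2) `^ (- (mu / 2)).
  case: hx1 => [h|h]; first exact: X_ufun.
  have -> : (1 - x ^+ 2) `^ (- (mu / 2)) = 1 by rewrite h mul0r oppr0 powRr0.
  by rewrite mulr1; exact: X_ufun0.
rewrite normrM [`|_ `^ _|]ger0_norm ?powR_ge0//.
apply: ler_wpM2r; first exact: powR_ge0.
by apply: (le_trans hu); rewrite lerDl mulr_ge0 ?powR_ge0// mulr_ge0 ?powR_ge0// ltW.
Qed.

End XBounds2.

Unset Implicit Arguments.

Theorem theorem1p1 (R : realType) (d : nat) (hd : (2 <= d)%N) (eps : R)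
    (heps : 0 < eps < 1) :
  exists2 c : R, 0 < c < 1 &
  exists2 C : R, 0 < C &
  forall l m : R, Id d l m ->
  (eps * l <= m ->
    (forall x : R, -1 <= x <= 1 ->
      (`|X_ d l m x|%R%:E <=
       C%:E * bpow (l^-1 + `|x ^+ 2 - a_ l m ^+ 2|)%R (- 4^-1)%R)%E) /\
    (forall x : R, -1 <= x <= 1 -> 2 * a_ l m <= `|x| ->
      (`|X_ d l m x|%R%:E <=
       C%:E * bpow `|x|%R (- 2^-1)%R *
       bpow (1 - x ^+ 2)%R (Num.max (c * l - (d%:R - 2) / 4) 0)%R)%E)) /\
  (m <= eps * l ->
    (forall x : R, -1 <= x <= 1 ->
      let y := Num.sqrt (1 - x ^+ 2) in
      (`|X_ d l m x|%R%:E <=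
       C%:E * bpow y (- ((d%:R - 2) / 2))%R *
       bpow (l `^ (- 2) * (1 + m) `^ (4 / 3) + `|y ^+ 2 - b_ l m ^+ 2|)%R
         (- 4^-1)%R)%E) /\
    (forall x : R, -1 <= x <= 1 ->
      let y := Num.sqrt (1 - x ^+ 2) in
      y <= b_ l m / (2 * expR 1) ->
      `|X_ d l m x| <= C * l `^ ((d%:R - 1) / 2) * 2 `^ (- m))).
Proof.
have [C1 C10 h1] := X_equatorial hd heps.
have [C2 C20 h2] := @X_beyond R d hd.
have [C3 C30 h3] := X_small_order hd heps.
have [C4 C40 h4] := @X_polar R d hd.
(* The weight [(1 - t ^ 2) ^ (- l / 4)] in [ufun_beyond] is for the fourth power,
   and half of it is lost: [1/32 = 1/4 * 1/4 * 1/2]. *)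
exists 32^-1; first by apply/andP; split; lra.
exists (C1 + C2 + C3 + C4); first by rewrite !addr_gt0.
set C := C1 + C2 + C3 + C4.
move=> l m hId; have [i [n [em el]]] := Id_param hd hId.
have mu0 : 0 <= (d%:R - 2) / 2 :> R by rewrite divr_ge0// subr_ge0 ler_nat.
have i0 : 0 <= i%:R :> R by [].
have n0 : 0 <= n%:R :> R by [].
have m0 : 0 <= m by lra.
have l0 : 0 < l by lra.
have ml : 0 <= m <= l by apply/andP; split; lra.
have /andP[r0 r1] := sqr_ratio_01 ml l0.
have lm : m + 2^-1 <= l by lra.
have ea : a_ l m ^+ 2 = 1 - m ^+ 2 / l ^+ 2.
  by rewrite /a_ /b_ expr_div_n sqr_sqrtr//; lra.
have a0 : 0 < 1 - m ^+ 2 / l ^+ 2.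
  have : 0 < (l - m) * (l + m).
    by apply: mulr_gt0; lra.
  rewrite -subr_sqr subr_gt0 => hlm.
  by rewrite subr_gt0 ltr_pdivrMr ?exprn_gt0// mul1r.
have bpowE (x r : R) : 0 < x -> bpow x r = (x `^ r)%:E.
  by move=> x0; rewrite /bpow gt_eqF.
split=> [hm|hm]; split=> x hx.
- have w0 : 0 < l^-1 + `|x ^+ 2 - a_ l m ^+ 2| by rewrite ltr_pwDl// invr_gt0.
  rewrite bpowE// -EFinM lee_fin ea.
  have := h1 i n; rewrite /= -em -el => /(_ hm x hx) h.
  apply: (le_trans h); apply: ler_wpM2r; first exact: powR_ge0.
  by rewrite /C; lra.
- move=> hax.
  have hax2 : 4 * (1 - m ^+ 2 / l ^+ 2) <= x ^+ 2.
    rewrite -ea -[x ^+ 2]real_normK ?num_real//.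
    have -> : 4 * a_ l m ^+ 2 = (2 * a_ l m) ^+ 2 by ring.
    by apply: lerXn2r; rewrite ?nnegrE// mulr_ge0// sqrtr_ge0.
  have xn0 : x != 0.
    by apply/eqP => x0; move: hax2; rewrite x0 expr0n /=; lra.
  rewrite bpowE ?normr_gt0//.
  have -> : bpow (1 - x ^+ 2) (Num.max (32^-1 * l - (d%:R - 2) / 4) 0) =
     ((1 - x ^+ 2) `^ (Num.max (32^-1 * l - (d%:R - 2) / 4) 0))%:E.
    rewrite /bpow; case: ifP => // /andP[_].
    by rewrite ltNge le_max lexx orbT.
  rewrite -!EFinM lee_fin.
  have := h2 i n; rewrite /= -em -el => /(_ x hx hax2 xn0) h.
  apply: (le_trans h); apply: ler_wpM2r; first exact: powR_ge0.
  apply: ler_wpM2r; first exact: powR_ge0.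
  by rewrite /C; lra.
- lazy zeta; set y := Num.sqrt (1 - x ^+ 2).
  have /andP[p0 p1] := one_sub_sqr_01 hx.
  have ey : y ^+ 2 = 1 - x ^+ 2 by rewrite sqr_sqrtr.
  have ew : `|y ^+ 2 - b_ l m ^+ 2| = `|x ^+ 2 - (1 - m ^+ 2 / l ^+ 2)|.
    rewrite ey /b_ expr_div_n -normrN; congr `|_|; ring.
  have w0 : 0 < l `^ (- 2) * (1 + m) `^ (4 / 3) + `|y ^+ 2 - b_ l m ^+ 2|.
    by rewrite ltr_pwDl// mulr_gt0// powR_gt0//; lra.
  rewrite (bpowE _ _ w0) ew; rewrite ew in w0.
  have C0 : 0 < C by rewrite !addr_gt0.
  (* At the poles, for [2 < d], the right-hand side is infinite. *)
  rewrite /bpow; case: ifPn => [hinf|hfin].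
    rewrite gt0_muley ?lte_fin// gt0_mulye ?leey//.
    by rewrite lte_fin powR_gt0.
  rewrite -!EFinM lee_fin.
  have hx1 : x ^+ 2 < 1 \/ (d%:R - 2) / 2 = 0 :> R.
    move: hfin; rewrite negb_and oppr_lt0 -leNgt => /orP[yn0|mle]; last first.
      by right; apply/eqP; rewrite eq_le mle.
    left; rewrite -subr_gt0 lt0r p0 andbT; apply: contra yn0 => /eqP e.
    by rewrite /y e sqrtr0.
  have := h3 i n; rewrite /= -em -el => /(_ hm x hx hx1) h.
  apply: (le_trans h); apply: ler_wpM2r; first exact: powR_ge0.
  apply: ler_wpM2r; first exact: powR_ge0.
  by rewrite /C; lra.
- move=> y hy.
  have := h4 i n; rewrite /= -em -el => /(_ x hx hy) h.
  apply: (le_trans h); apply: ler_wpM2r; first exact: powR_ge0.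
  apply: ler_wpM2r; first exact: powR_ge0.
  by rewrite /C; lra.
Qed.
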